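(* $\mathsf{RCA}_0$ proves: every complete separable metric space which is perfect and Lebesgue is Heine-Borel compact.
   Context: Systems. $\mathsf{RCA}_0$ is the theory in the two-sorted language of second order arithmetic (number variables, set variables, $0,1,+,\cdot,=,<,\in$) consisting of the basic arithmetical axioms, induction for $\Sigma^0_1$ formulas and comprehension for $\Delta^0_1$ formulas. Spaces (definitions made in $\mathsf{RCA}_0$; reals are coded by rapidly converging Cauchy sequences of rationals). A (code for a) complete separable metric space $\widehat A$ is a set $A\subseteq\mathbb N$ together with $d:A\times A\to\mathbb R$ such that $d(a,a)=0$, $d(a,b)=d(b,a)\ge 0$, $d(a,b)\le d(a,c)+d(c,b)$ for all $a,b,c\in A$. A point of $\widehat A$ is a sequence $\langle a_n:n\in\mathbb N\rangle$ of elements of $A$ with $d(a_n,a_{n+1})<2^{-n}$ for all $n$; $d$ extends to points in the obvious way and $x,y\in\widehat A$ are identified ($x=y$) when $d(x,y)=0$. $B(x,q)$ denotes the open ball $\{y\in\widehat A: d(x,y)<q\}$. An open set in $\widehat A$ is coded by a sequence $\langle (a_n,q_n):n\in\mathbb N\rangle$ of elements of $A\times\mathbb Q^+$ and means $\bigcup_n B(a_n,q_n)$. An open covering of $\widehat A$ is a sequence $\langle U_n:n\in\mathbb N\rangle$ of open sets such that every $x\in\widehat A$ belongs to some $U_n$. Perfect: a point $x\in\widehat A$ is isolated if for some $q\in\mathbb R^+$ there is no $y\in\widehat A$ with $0<d(x,y)<q$; $\widehat A$ is perfect if it has no isolated points. Lebesgue: $\widehat A$ is Lebesgue if for every open covering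 $\langle U_n:n\in\mathbb N\rangle$ of $\widehat A$ there is $q\in\mathbb R^+$ (a Lebesgue number for the covering) such that $\forall x\in\widehat A\,\exists n\ B(x,q)\subseteq U_n$. Heine-Borel compact: $\widehat A$ is Heine-Borel compact if every open covering of $\widehat A$ has a finite subcovering. *)

(* Defs.v *)
(* Provability in RCA_0 is rendered literally: syntax of two-sorted second order
   arithmetic, a natural deduction calculus for classical two-sorted logic, and the
   axioms of RCA_0.  Only the Rocq standard library is used. *)
From Stdlib Require Import List.

(* Syntax, with de Bruijn indices; number variables and set variables are indexed
   independently, so [AllN] binds number variable 0 and [AllS] set variable 0. *)

Inductive term : Type :=
| Var (i : nat)
| Zero
| One
| Add (s t : term)
| Mul (s t : term).

Inductive form : Type :=
| Eq (s t : term)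
| Lt (s t : term)
| Mem (t : term) (X : nat)
| Bot
| Imp (p q : form)
| AllN (p : form)
| AllS (p : form).

(* The logic is classical, so the other connectives are abbreviations. *)
Definition Neg (p : form) : form := Imp p Bot.
Definition And (p q : form) : form := Neg (Imp p (Neg q)).
Definition Or (p q : form) : form := Imp (Neg p) q.
Definition Iff (p q : form) : form := And (Imp p q) (Imp q p).
Definition ExN (p : form) : form := Neg (AllN (Neg p)).
Definition ExS (p : form) : form := Neg (AllS (Neg p)).

Definition scons {T : Type} (x : T) (f : nat -> T) (i : nat) : T :=
  match i with O => x | S j => f j end.

Fixpoint tsubst (f : nat -> term) (t : term) : term :=
  match t with
  | Var i => f i
  | Zero => Zero
  | One => One
  | Add s t => Add (tsubst f s) (tsubst f t)
  | Mul s t => Mul (tsubst f s) (tsubst f t)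
  end.

Definition tshift : term -> term := tsubst (fun i => Var (S i)).

(* Simultaneous capture-avoiding substitution of terms for the number variables and
   of set variables for the set variables. *)
Fixpoint subst (f : nat -> term) (g : nat -> nat) (p : form) : form :=
  match p with
  | Eq s t => Eq (tsubst f s) (tsubst f t)
  | Lt s t => Lt (tsubst f s) (tsubst f t)
  | Mem t X => Mem (tsubst f t) (g X)
  | Bot => Bot
  | Imp p q => Imp (subst f g p) (subst f g q)
  | AllN p => AllN (subst (scons (Var 0) (fun i => tshift (f i))) g p)
  | AllS p => AllS (subst f (scons 0 (fun i => S (g i))) p)
  end.

Definition shiftN : form -> form := subst (fun i => Var (S i)) (fun X => X).
Definition shiftS : form -> form := subst Var S.
Definition instN (t : term) : form -> form := subst (scons t Var) (fun X => X).
Definition instS (X : nat) : form -> form := subst Var (scons X (fun Y => Y)).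

(* [derivable T G p]: p is derivable from the hypotheses G and the axioms T.  The
   eigenvariable conditions concern G only, so an axiom with free variables counts
   as its universal closure. *)
Inductive derivable (T : form -> Prop) : list form -> form -> Prop :=
| d_ax G p : T p -> derivable T G p
| d_hyp G p : In p G -> derivable T G p
| d_impI G p q : derivable T (p :: G) q -> derivable T G (Imp p q)
| d_impE G p q : derivable T G (Imp p q) -> derivable T G p -> derivable T G q
| d_raa G p : derivable T (Neg p :: G) Bot -> derivable T G p
| d_allNI G p : derivable T (map shiftN G) p -> derivable T G (AllN p)
| d_allNE G p t : derivable T G (AllN p) -> derivable T G (instN t p)
| d_allSI G p : derivable T (map shiftS G) p -> derivable T G (AllS p)
| d_allSE G p X : derivable T G (AllS p) -> derivable T G (instS X p)
| d_refl G t : derivable T G (Eq t t)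
| d_leibniz G p s t :
    derivable T G (Eq s t) -> derivable T G (instN s p) -> derivable T G (instN t p).

Definition proves (T : form -> Prop) (p : form) : Prop := derivable T nil p.

(* Sigma^0_0 formulas.  The bound [t] may not contain the bound variable, whence the
   [tshift]; bounded existential quantifiers are obtained by negation. *)
Inductive bounded : form -> Prop :=
| b_eq s t : bounded (Eq s t)
| b_lt s t : bounded (Lt s t)
| b_mem t X : bounded (Mem t X)
| b_bot : bounded Bot
| b_imp p q : bounded p -> bounded q -> bounded (Imp p q)
| b_all t p : bounded p -> bounded (AllN (Imp (Lt (Var 0) (tshift t)) p)).

(* p(n+1), where n is number variable 0 of p *)
Definition succ_inst : form -> form :=
  subst (scons (Add (Var 0) One) (fun i => Var (S i))) (fun X => X).

Inductive RCA0 : form -> Prop :=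
| ax_succ_neq0 : RCA0 (Neg (Eq (Add (Var 0) One) Zero))
| ax_succ_inj :
    RCA0 (Imp (Eq (Add (Var 0) One) (Add (Var 1) One)) (Eq (Var 0) (Var 1)))
| ax_add0 : RCA0 (Eq (Add (Var 0) Zero) (Var 0))
| ax_addS :
    RCA0 (Eq (Add (Var 0) (Add (Var 1) One)) (Add (Add (Var 0) (Var 1)) One))
| ax_mul0 : RCA0 (Eq (Mul (Var 0) Zero) Zero)
| ax_mulS :
    RCA0 (Eq (Mul (Var 0) (Add (Var 1) One)) (Add (Mul (Var 0) (Var 1)) (Var 0)))
| ax_lt0 : RCA0 (Neg (Lt (Var 0) Zero))
| ax_ltS :
    RCA0 (Iff (Lt (Var 0) (Add (Var 1) One))
              (Or (Lt (Var 0) (Var 1)) (Eq (Var 0) (Var 1))))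
(* Sigma^0_1 induction *)
| ax_ind r : bounded r ->
    let p := ExN r in
    RCA0 (Imp (And (instN Zero p) (AllN (Imp p (succ_inst p)))) (AllN p))
(* Delta^0_1 comprehension; [shiftS] keeps the new set variable out of p *)
| ax_comp r s : bounded r -> bounded s ->
    let p := ExN r in
    let q := AllN s in
    RCA0 (Imp (AllN (Iff p q)) (ExS (AllN (Iff (Mem (Var 0) 0) (shiftS p))))).

(* Formulas are written with Rocq binders.  [num], [setv] and [fml] are terms, set
   variables and formulas as functions of the number of enclosing number quantifiers
   (n) and set quantifiers (s); the variable bound by the quantifier at depth n has,
   at depth m > n, the de Bruijn index m - n - 1. *)

Definition num : Type := nat -> term.
Definition setv : Type := nat -> nat.
Definition fml : Type := nat -> nat -> form.

Definition f_zero : num := fun _ => Zero.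
Definition f_one : num := fun _ => One.
Definition f_add (x y : num) : num := fun n => Add (x n) (y n).
Definition f_mul (x y : num) : num := fun n => Mul (x n) (y n).
Definition f_eq (x y : num) : fml := fun n _ => Eq (x n) (y n).
Definition f_lt (x y : num) : fml := fun n _ => Lt (x n) (y n).
Definition f_mem (x : num) (X : setv) : fml := fun n s => Mem (x n) (X s).
Definition f_true : fml := fun _ _ => Neg Bot.
Definition f_not (p : fml) : fml := fun n s => Neg (p n s).
Definition f_imp (p q : fml) : fml := fun n s => Imp (p n s) (q n s).
Definition f_and (p q : fml) : fml := fun n s => And (p n s) (q n s).
Definition f_or (p q : fml) : fml := fun n s => Or (p n s) (q n s).
Definition f_alln (p : num -> fml) : fml :=
  fun n s => AllN (p (fun m => Var (m - S n)) (S n) s).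
Definition f_exn (p : num -> fml) : fml :=
  fun n s => ExN (p (fun m => Var (m - S n)) (S n) s).
Definition f_alls (p : setv -> fml) : fml :=
  fun n s => AllS (p (fun m => m - S s) n (S s)).
Definition f_exs (p : setv -> fml) : fml :=
  fun n s => ExS (p (fun m => m - S s) n (S s)).

Definition sentence (p : fml) : form := p 0 0.

Declare Scope l2_scope.
Delimit Scope l2_scope with l2.
Bind Scope l2_scope with num.
Bind Scope l2_scope with fml.
Open Scope l2_scope.

Notation "0" := f_zero : l2_scope.
Notation "1" := f_one : l2_scope.
Notation "2" := (f_add f_one f_one) : l2_scope.
Notation "3" := (f_add (f_add f_one f_one) f_one) : l2_scope.
Notation "x + y" := (f_add x y) : l2_scope.
Notation "x * y" := (f_mul x y) : l2_scope.
Notation "x == y" := (f_eq x y) (at level 70, no associativity) : l2_scope.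
Notation "x < y" := (f_lt x y) : l2_scope.
Notation "x <= y" := (f_or (f_lt x y) (f_eq x y)) : l2_scope.
Notation "x \in X" := (f_mem x X) (at level 70, no associativity) : l2_scope.
Notation "~ p" := (f_not p) : l2_scope.
Notation "p /\ q" := (f_and p q) : l2_scope.
Notation "p ==> q" := (f_imp p q) (at level 85, right associativity) : l2_scope.
Notation "'alln' x .. y , p" := (f_alln (fun x => .. (f_alln (fun y => p)) ..))
  (at level 200, x binder, y binder, right associativity) : l2_scope.
Notation "'exn' x .. y , p" := (f_exn (fun x => .. (f_exn (fun y => p)) ..))
  (at level 200, x binder, y binder, right associativity) : l2_scope.
Notation "'alls' x .. y , p" := (f_alls (fun x => .. (f_alls (fun y => p)) ..))
  (at level 200, x binder, y binder, right associativity) : l2_scope.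
Notation "'exs' x .. y , p" := (f_exs (fun x => .. (f_exs (fun y => p)) ..))
  (at level 200, x binder, y binder, right associativity) : l2_scope.

(* A definable class of numbers.  Sequences and reals below are classes, so that the
   definitions apply both to sets and to explicitly defined sequences; quantification
   is always over sets. *)
Definition cls : Type := num -> fml.

Definition of_set (X : setv) : cls := fun t => t \in X.

(* An injective pairing function *)
Definition npair (i j : num) : num := (i + j) * (i + j) + i.

(* (X)_i = {t : (t,i) in X} *)
Definition section (X : setv) (i : num) : cls := fun t => npair t i \in X.

(* F is (the graph of) a function from N to P *)
Definition seq_in (P F : cls) : fml :=
  (alln z, F z ==> exn n m, z == npair n m /\ P m)
  /\ (alln n, exn m, F (npair n m))
  /\ (alln n m m', F (npair n m) ==> F (npair n m') ==> m == m').

Definition const_seq (c : num) : cls := fun t => exn n, t == npair n c.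

(* m = 2^k: the recursion equations of the exponential determine Z *)
Definition pow2 (k m : num) : fml :=
  exs Z, seq_in (fun _ => f_true) (of_set Z)
         /\ npair 0 1 \in Z
         /\ (alln i z, npair i z \in Z ==> npair (i + 1) (2 * z) \in Z)
         /\ npair k m \in Z.

(* The rational (pos - neg) / den with den > 0.  A rational has several codes;
   equality and order are those of the values. *)
Record rat : Type := Rat { pos : num; neg : num; den : num }.

Definition rcode (q : rat) : num := npair (npair (pos q) (neg q)) (den q).

Definition f_allq (p : rat -> fml) : fml :=
  alln a b c, 0 < c ==> p (Rat a b c).
Definition f_exq (p : rat -> fml) : fml :=
  exn a b c, 0 < c /\ p (Rat a b c).

Notation "'allq' x .. y , p" := (f_allq (fun x => .. (f_allq (fun y => p)) ..))
  (at level 200, x binder, y binder, right associativity) : l2_scope.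
Notation "'exq' x .. y , p" := (f_exq (fun x => .. (f_exq (fun y => p)) ..))
  (at level 200, x binder, y binder, right associativity) : l2_scope.

Definition is_rat : cls := fun z => exq q, z == rcode q.

Definition qfrac (a b : num) : rat := Rat a 0 b.
Definition qadd (p q : rat) : rat :=
  Rat (pos p * den q + pos q * den p) (neg p * den q + neg q * den p) (den p * den q).
Definition qle (p q : rat) : fml :=
  pos p * den q + neg q * den p <= pos q * den p + neg p * den q.
Definition qpos (q : rat) : fml := neg q < pos q.
(* |p - q| <= e *)
Definition qnear (p q e : rat) : fml := qle p (qadd q e) /\ qle q (qadd p e).

(* x is a real: a sequence of rationals q_k with |q_k - q_{k+i}| <= 2^-k *)
Definition is_real (x : cls) : fml :=
  seq_in is_rat x
  /\ (alln k i m, pow2 k m ==>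
      allq p q, x (npair k (rcode p)) ==> x (npair (k + i) (rcode q)) ==>
        qnear p q (qfrac 1 m)).

(* x <= y iff q_k <= q'_k + 2^(-k+1) for all k; x = y iff |q_k - q'_k| <= 2^(-k+1)
   for all k; the k-th term of x + y is q_{k+1} + q'_{k+1} *)
Definition rle (x y : cls) : fml :=
  alln k m, pow2 k m ==>
    allq p q, x (npair k (rcode p)) ==> y (npair k (rcode q)) ==>
      qle p (qadd q (qfrac 2 m)).
Definition req (x y : cls) : fml :=
  alln k m, pow2 k m ==>
    allq p q, x (npair k (rcode p)) ==> y (npair k (rcode q)) ==>
      qnear p q (qfrac 2 m).
Definition rlt (x y : cls) : fml := ~ rle y x.
Definition radd (x y : cls) : cls := fun t =>
  exn k, exq p q, x (npair (k + 1) (rcode p)) /\ y (npair (k + 1) (rcode q))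
                  /\ t == npair k (rcode (qadd p q)).

Definition of_rat (q : rat) : cls := const_seq (rcode q).
Definition rzero : cls := of_rat (qfrac 0 1).

(* A code for a complete separable metric space: the set A and the double sequence of
   reals d, whose (a,b)-th term is the section at npair a b. *)
Record space : Type := Space { carrier : setv; metric : setv }.

Definition dA (M : space) (a b : num) : cls := section (metric M) (npair a b).

Definition is_space (M : space) : fml :=
  (alln a b, a \in carrier M ==> b \in carrier M ==> is_real (dA M a b))
  /\ (alln a, a \in carrier M ==> req (dA M a a) rzero)
  /\ (alln a b, a \in carrier M ==> b \in carrier M ==>
        req (dA M a b) (dA M b a) /\ rle rzero (dA M a b))
  /\ (alln a b c, a \in carrier M ==> b \in carrier M ==> c \in carrier M ==>
        rle (dA M a b) (radd (dA M a c) (dA M c b))).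

Definition is_point (M : space) (x : cls) : fml :=
  seq_in (of_set (carrier M)) x
  /\ (alln n m a b, pow2 n m ==> x (npair n a) ==> x (npair (n + 1) b) ==>
        rlt (dA M a b) (of_rat (qfrac 1 m))).

(* d(x,y) = lim_n d(a_n,b_n) for x = <a_n>, y = <b_n>.  The k-th rational term is the
   (k+3)-rd term of d(a_{k+3},b_{k+3}): since |d(a_n,b_n) - d(x,y)| <= 2^(-n+2), this is
   a real in the sense of is_real. *)
Definition dist (M : space) (x y : cls) : cls := fun t =>
  exn k a b, exq q,
    x (npair (k + 3) a) /\ y (npair (k + 3) b)
    /\ dA M a b (npair (k + 3) (rcode q)) /\ t == npair k (rcode q).

(* An open set is a sequence of elements of A x Q^+; [const_seq a] is the element a
   of A regarded as a point. *)
Definition is_open (M : space) (U : cls) : fml :=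
  seq_in (fun z => exn a, exq q, a \in carrier M /\ qpos q /\ z == npair a (rcode q)) U.

Definition in_open (M : space) (x U : cls) : fml :=
  exn n a, exq q, U (npair n (npair a (rcode q)))
                  /\ rlt (dist M x (const_seq a)) (of_rat q).

Definition is_covering (M : space) (U : setv) : fml :=
  (alln n, is_open M (section U n))
  /\ (alls x, is_point M (of_set x) ==> exn n, in_open M (of_set x) (section U n)).

Definition isolated (M : space) (x : cls) : fml :=
  exs q, is_real (of_set q) /\ rlt rzero (of_set q)
    /\ ~ (exs y, is_point M (of_set y)
                 /\ rlt rzero (dist M x (of_set y))
                 /\ rlt (dist M x (of_set y)) (of_set q)).

Definition perfect (M : space) : fml :=
  ~ (exs x, is_point M (of_set x) /\ isolated M (of_set x)).

Definition ball_sub (M : space) (x q U : cls) : fml :=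
  alls y, is_point M (of_set y) ==> rlt (dist M x (of_set y)) q ==>
    in_open M (of_set y) U.

Definition lebesgue (M : space) : fml :=
  alls U, is_covering M U ==>
    exs q, is_real (of_set q) /\ rlt rzero (of_set q)
      /\ (alls x, is_point M (of_set x) ==>
            exn n, ball_sub M (of_set x) (of_set q) (section U n)).

(* F is the finite, i.e. bounded, set of indices of the subcovering. *)
Definition heine_borel (M : space) : fml :=
  alls U, is_covering M U ==>
    exs F, (exn k, alln n, n \in F ==> n < k)
      /\ (alls x, is_point M (of_set x) ==>
            exn n, n \in F /\ in_open M (of_set x) (section U n)).

Close Scope l2_scope.

(* Main.v *)
(* By a completeness theorem for the calculus (Henkin's construction) it suffices to argue in an
   arbitrary model of RCA_0.  Its numbers form a discretely ordered semiring, whose ordered field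
   of fractions contains the rationals of the model.

   If [U] is a covering such that no [U_0, ..., U_(K-1)] cover, enumerate a refinement of [U] by
   balls [B(b_m, s_m)] whose doubles are contained in members of [U].  The first [K] doubles lie
   in finitely many members of [U], which do not cover, so there is [y_K] in the dense set [A]
   with [d(y_K, b_m) > s_m] for all [m < K].  This is Sigma^0_1, so [y_K] can be
   chosen as a function of [K], together with [z_K] in [A] such that
   [0 < d(y_K, z_K) < 2^-K], which exists by perfectness.  As the [y_K] leave each [B(b_m, s_m)],
   the balls that do not contain both [y_K] and [z_K] for any [K] cover the space, and this
   covering has no Lebesgue number. *)

(* Escaping points alone would not do: in an infinite space with all distances 1 every covering has
   a Lebesgue number. The pairs supply, at each scale 2^-K, two points that no member of the new
   covering contains together, so a Lebesgue number above 2^-K fails at [y_K]. The covering has to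
   be coded by a set of the model. That a ball misses a point of every pair is an infinite
   conjunction; but a ball inside [B(b_m, s_m)] contains no [y_K] with [K > m], so only the pairs up
   to [m] remain to be checked and the condition becomes Sigma^0_1. Every point is apart from one
   member of each of these pairs, by a margin that Sigma^0_1 induction makes uniform. A distance of
   two points need not have a value in the field of fractions. The argument uses only [d < r] and
   [d > r] with [r] in the field; both are Sigma^0_1, and every estimate is arranged with a strict
   margin. The notions refer to powers of 2 through sets coding them. Either the model has such a
   set, which then gives the function 2^n, or it has none, and then no real is less than another. *)
From Stdlib Require List Arith Lia Cantor Classical ClassicalEpsilon Ring.
From Stdlib Require FunctionalExtensionality PropExtensionality ProofIrrelevance.
From HB Require structures.
From mathcomp Require all_boot order ssralg ssrnum boolp ring lra.
Require Defs.

(** * Completeness of the calculus by Henkin's construction *)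

Module Completeness.
Import List ListNotations Arith Lia Cantor Classical ClassicalEpsilon.
Import FunctionalExtensionality PropExtensionality ProofIrrelevance.
Import Defs.

Record model : Type := Model {
  dom : Type; sdom : Type;
  mzero : dom; mone : dom;
  madd : dom -> dom -> dom; mmul : dom -> dom -> dom;
  mlt : dom -> dom -> Prop; mmem : dom -> sdom -> Prop }.

Fixpoint teval (M : model) (e : nat -> dom M) (t : term) : dom M :=
  match t with
  | Var i => e i
  | Zero => mzero M
  | One => mone M
  | Add s t => madd M (teval M e s) (teval M e t)
  | Mul s t => mmul M (teval M e s) (teval M e t)
  end.

Fixpoint sat (M : model) (e : nat -> dom M) (g : nat -> sdom M) (p : form) : Prop :=
  match p with
  | Eq s t => teval M e s = teval M e t
  | Lt s t => mlt M (teval M e s) (teval M e t)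
  | Mem t X => mmem M (teval M e t) (g X)
  | Bot => False
  | Imp p q => sat M e g p -> sat M e g q
  | AllN p => forall x, sat M (scons x e) g p
  | AllS p => forall X, sat M e (scons X g) p
  end.

Definition satisfies (M : model) (T : form -> Prop) : Prop :=
  forall p e g, T p -> sat M e g p.

Definition upN (f : nat -> term) : nat -> term := scons (Var 0) (fun i => tshift (f i)).
Definition upS (g : nat -> nat) : nat -> nat := scons 0 (fun i => S (g i)).

Lemma tsubst_comp f h t : tsubst f (tsubst h t) = tsubst (fun i => tsubst f (h i)) t.
Proof. induction t; simpl; congruence. Qed.

Lemma tsubst_Var t : tsubst Var t = t.
Proof. induction t; simpl; congruence. Qed.

Lemma upN_comp f h : (fun i => tsubst (upN f) (upN h i)) = upN (fun i => tsubst f (h i)).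
Proof.
  apply functional_extensionality; intros [|i]; simpl; auto.
  unfold tshift; now rewrite !tsubst_comp.
Qed.

Lemma upS_comp f h : (fun i => upS f (upS h i)) = upS (fun i => f (h i)).
Proof. now apply functional_extensionality; intros [|i]. Qed.

Lemma upN_Var : upN Var = Var.
Proof. now apply functional_extensionality; intros [|i]. Qed.

Lemma upS_id : upS (fun i => i) = (fun i => i).
Proof. now apply functional_extensionality; intros [|i]. Qed.

Lemma subst_comp f g f' g' p :
  subst f g (subst f' g' p) = subst (fun i => tsubst f (f' i)) (fun i => g (g' i)) p.
Proof.
  revert f g f' g'; induction p; intros; simpl; rewrite ?tsubst_comp; auto.
  - now rewrite IHp1, IHp2.
  - f_equal; rewrite IHp; f_equal; apply (upN_comp f f').
  - f_equal; rewrite IHp; f_equal; apply (upS_comp g g').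
Qed.

Lemma subst_Var p : subst Var (fun i => i) p = p.
Proof.
  induction p; simpl; rewrite ?tsubst_Var; auto.
  - congruence.
  - f_equal; etransitivity; [|exact IHp]; f_equal; apply upN_Var.
  - f_equal; etransitivity; [|exact IHp]; f_equal; apply upS_id.
Qed.

Lemma subst_instN f g t p :
  subst f g (instN t p) = instN (tsubst f t) (subst (upN f) g p).
Proof.
  unfold instN; rewrite !subst_comp; f_equal.
  apply functional_extensionality; intros [|i]; simpl; auto.
  unfold tshift; rewrite tsubst_comp; simpl; now rewrite tsubst_Var.
Qed.

Lemma subst_instS f g X p :
  subst f g (instS X p) = instS (g X) (subst f (upS g) p).
Proof.
  unfold instS; rewrite !subst_comp; f_equal.
  - apply functional_extensionality; intro i; simpl; now rewrite tsubst_Var.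
  - now apply functional_extensionality; intros [|i].
Qed.

Lemma map_shiftN f g G :
  map (subst (upN f) g) (map shiftN G) = map shiftN (map (subst f g) G).
Proof.
  rewrite !map_map; apply map_ext; intro p.
  unfold shiftN; rewrite !subst_comp; reflexivity.
Qed.

Lemma map_shiftS f g G :
  map (subst f (upS g)) (map shiftS G) = map shiftS (map (subst f g) G).
Proof.
  rewrite !map_map; apply map_ext; intro p.
  unfold shiftS; rewrite !subst_comp; f_equal.
  apply functional_extensionality; intro i; simpl; now rewrite tsubst_Var.
Qed.

(** Hypotheses are compared as sets, so exchange and contraction are included. *)
Lemma weakening T G G' p : derivable T G p -> incl G G' -> derivable T G' p.
Proof.
  intro D; revert G'; induction D; intros G' HG.
  - now apply d_ax.
  - apply d_hyp; auto.
  - apply d_impI, IHD; intros x [->|Hx]; simpl; auto.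
  - eapply d_impE; eauto.
  - apply d_raa, IHD; intros x [->|Hx]; simpl; auto.
  - apply d_allNI, IHD; now apply incl_map.
  - apply d_allNE; auto.
  - apply d_allSI, IHD; now apply incl_map.
  - apply d_allSE; auto.
  - apply d_refl.
  - eapply d_leibniz; eauto.
Qed.

Section Henkin.

Variable T : form -> Prop.
(** Axioms may have free variables, and an instance of an axiom is in general no axiom. Its
    derivability is what lets a substitution pass through [d_ax]. *)
Hypothesis T_subst : forall f g p, T p -> derivable T [] (subst f g p).

Lemma derivable_subst f g G p :
  derivable T G p -> derivable T (map (subst f g) G) (subst f g p).
Proof.
  intro D; revert f g; induction D; intros f g; simpl in *.
  - eapply weakening; [now apply T_subst | intros x []].
  - apply d_hyp, in_map; auto.
  - now apply d_impI, IHD.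
  - eapply d_impE; [apply IHD1 | apply IHD2].
  - now apply d_raa, IHD.
  - apply d_allNI; rewrite <- map_shiftN; apply IHD.
  - rewrite subst_instN; apply d_allNE, IHD.
  - apply d_allSI; rewrite <- map_shiftS; apply IHD.
  - rewrite subst_instS; apply d_allSE, IHD.
  - apply d_refl.
  - rewrite subst_instN in *; eapply d_leibniz; [apply IHD1 |].
    specialize (IHD2 f g); now rewrite subst_instN in IHD2.
Qed.

Fixpoint tbound (t : term) : nat :=
  match t with
  | Var i => S i
  | Zero | One => 0
  | Add s t | Mul s t => max (tbound s) (tbound t)
  end.

Fixpoint nbound (p : form) : nat :=
  match p with
  | Eq s t | Lt s t => max (tbound s) (tbound t)
  | Mem t _ => tbound t
  | Bot => 0
  | Imp p q => max (nbound p) (nbound q)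
  | AllN p => pred (nbound p)
  | AllS p => nbound p
  end.

Fixpoint sbound (p : form) : nat :=
  match p with
  | Eq _ _ | Lt _ _ | Bot => 0
  | Mem _ X => S X
  | Imp p q => max (sbound p) (sbound q)
  | AllN p => sbound p
  | AllS p => pred (sbound p)
  end.

Lemma tsubst_agree f f' t :
  (forall i, i < tbound t -> f i = f' i) -> tsubst f t = tsubst f' t.
Proof.
  induction t; simpl; intro H; auto;
    (f_equal; [apply IHt1 | apply IHt2]; intros; apply H; lia).
Qed.

Lemma subst_agree p : forall f g f' g',
  (forall i, i < nbound p -> f i = f' i) -> (forall i, i < sbound p -> g i = g' i) ->
  subst f g p = subst f' g' p.
Proof.
  induction p as [s t|s t|t X| |p1 IHp1 p2 IHp2|p IHp|p IHp];
    simpl; intros f g f' g' Hf Hg; auto.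
  - f_equal; apply tsubst_agree; intros; apply Hf; lia.
  - f_equal; apply tsubst_agree; intros; apply Hf; lia.
  - rewrite (tsubst_agree f f'), Hg; auto.
  - rewrite (IHp1 f g f' g'), (IHp2 f g f' g'); auto; intros; apply Hf || apply Hg; lia.
  - f_equal; apply IHp; auto. intros [|i] Hi; simpl; auto. rewrite Hf; auto; lia.
  - f_equal; apply IHp; auto. intros [|i] Hi; simpl; auto. rewrite Hg; auto; lia.
Qed.

Definition fresh (G : list form) : nat :=
  fold_right (fun p n => max (max (nbound p) (sbound p)) n) 0 G.

Lemma fresh_In G p : In p G -> nbound p <= fresh G /\ sbound p <= fresh G.
Proof. induction G as [|q G IH]; simpl; [tauto|]. intros [->|H]; [lia|]. apply IH in H; lia. Qed.

(** The derivation is renamed by [r], which sends [c] to 0 and shifts everything else. On [G], where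
    [c] does not occur, this is [shiftN]; on the instance of [q] it undoes the instantiation. The
    result is a premise of [d_allNI]. *)
Lemma generalizeN G q c : fresh G <= c -> nbound (AllN q) <= c ->
  derivable T G (instN (Var c) q) -> derivable T G (AllN q).
Proof.
  intros HG Hq D. apply d_allNI.
  set (r := fun i => if Nat.eq_dec i c then Var 0 else Var (S i)).
  apply (derivable_subst r (fun X => X)) in D.
  replace (map (subst r (fun X => X)) G) with (map shiftN G) in D.
  2:{ apply map_ext_in; intros p Hp; apply fresh_In in Hp. apply subst_agree; auto.
      intros i Hi; unfold r; destruct (Nat.eq_dec i c); auto; lia. }
  replace q with (subst r (fun X => X) (instN (Var c) q)); auto.
  unfold instN; rewrite subst_comp. rewrite <- (subst_Var q) at 2.
  apply subst_agree; auto. simpl in Hq.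
  intros [|i] Hi; simpl; unfold r; destruct Nat.eq_dec; auto; lia.
Qed.

Lemma generalizeS G q c : fresh G <= c -> sbound (AllS q) <= c ->
  derivable T G (instS c q) -> derivable T G (AllS q).
Proof.
  intros HG Hq D. apply d_allSI.
  set (r := fun i => if Nat.eq_dec i c then 0 else S i).
  apply (derivable_subst Var r) in D.
  replace (map (subst Var r) G) with (map shiftS G) in D.
  2:{ apply map_ext_in; intros p Hp; apply fresh_In in Hp. apply subst_agree; auto.
      intros i Hi; unfold r; destruct (Nat.eq_dec i c); auto; lia. }
  replace q with (subst Var r (instS c q)); auto.
  unfold instS; rewrite subst_comp. rewrite <- (subst_Var q) at 2.
  apply subst_agree; auto. simpl in Hq.
  intros [|i] Hi; simpl; unfold r; destruct Nat.eq_dec; auto; lia.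
Qed.

Fixpoint tcode (t : term) : nat :=
  match t with
  | Var i => to_nat (0, i)
  | Zero => to_nat (1, 0)
  | One => to_nat (2, 0)
  | Add s t => to_nat (3, to_nat (tcode s, tcode t))
  | Mul s t => to_nat (4, to_nat (tcode s, tcode t))
  end.

Fixpoint code (p : form) : nat :=
  match p with
  | Eq s t => to_nat (0, to_nat (tcode s, tcode t))
  | Lt s t => to_nat (1, to_nat (tcode s, tcode t))
  | Mem t X => to_nat (2, to_nat (tcode t, X))
  | Bot => to_nat (3, 0)
  | Imp p q => to_nat (4, to_nat (code p, code q))
  | AllN p => to_nat (5, code p)
  | AllS p => to_nat (6, code p)
  end.

Lemma to_nat_pair_inj a b c d : to_nat (a, b) = to_nat (c, d) -> a = c /\ b = d.
Proof. intro H; apply to_nat_inj in H; injection H; auto. Qed.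

Lemma tcode_inj s t : tcode s = tcode t -> s = t.
Proof.
  revert t; induction s; destruct t; cbn [tcode]; intro H;
    apply to_nat_pair_inj in H as [K H]; try discriminate K; clear K; try congruence;
    apply to_nat_pair_inj in H as [H1 H2]; f_equal; auto.
Qed.

Lemma code_inj p q : code p = code q -> p = q.
Proof.
  revert q; induction p; destruct q; cbn [code]; intro H;
    apply to_nat_pair_inj in H as [K H]; try discriminate K; clear K;
    try (f_equal; now auto);
    apply to_nat_pair_inj in H as [H1 H2]; f_equal; auto using tcode_inj.
Qed.

(** A chosen preimage under the injection [code], arbitrary on numbers that code nothing; so every
    formula occurs among the values [decode n]. *)
Definition decode (n : nat) : form := epsilon (inhabits Bot) (fun p => code p = n).

Lemma decode_code p : decode (code p) = p.
Proof. apply code_inj. unfold decode. apply epsilon_spec. now exists p. Qed.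

Definition consistent (G : list form) : Prop := ~ derivable T G Bot.

(** A negated universal formula is accompanied by a counterexample. Free variables serve as the
    Henkin constants: every stage is finite and leaves fresh ones. *)
Definition witness (c : nat) (p : form) : list form :=
  match p with
  | Imp (AllN q) Bot => [Neg (instN (Var c) q)]
  | Imp (AllS q) Bot => [Neg (instS c q)]
  | _ => []
  end.

Definition extend (p : form) (G : list form) : list form :=
  if excluded_middle_informative (consistent (p :: G))
  then witness (fresh (p :: G)) p ++ p :: G else G.

Lemma cut_Neg G p q : derivable T G q -> In (Neg q) G -> derivable T G p.
Proof.
  intros D H. apply d_raa. eapply weakening; [|apply incl_tl, incl_refl].
  eapply d_impE; [apply d_hyp, H | exact D].
Qed.

(** If the counterexample at a fresh variable were refutable, that instance would be derivable,
    hence by generalization the universal formula that [p] denies. *)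
Lemma witness_consistent p G : consistent (p :: G) ->
  consistent (witness (fresh (p :: G)) p ++ p :: G).
Proof.
  intros C.
  destruct p as [| | | |p1 p2| |]; auto.
  destruct p1, p2; auto; simpl witness; intro D; apply C;
    apply d_raa in D; (eapply cut_Neg; [|left; reflexivity]).
  - eapply generalizeN; [apply le_n | | exact D].
    pose proof (fresh_In (Imp (AllN p1) Bot :: G) _ (or_introl eq_refl)) as [H _].
    simpl nbound in *; lia.
  - eapply generalizeS; [apply le_n | | exact D].
    pose proof (fresh_In (Imp (AllS p1) Bot :: G) _ (or_introl eq_refl)) as [_ H].
    simpl sbound in *; lia.
Qed.

Variable G0 : list form.
Hypothesis G0_consistent : consistent G0.

Fixpoint stage (n : nat) : list form :=
  match n with O => G0 | S n => extend (decode n) (stage n) end.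

Lemma stage_consistent n : consistent (stage n).
Proof.
  induction n; simpl; auto. unfold extend.
  destruct excluded_middle_informative; auto using witness_consistent.
Qed.

Lemma stage_mono n m : n <= m -> incl (stage n) (stage m).
Proof.
  induction 1; [apply incl_refl|]. eapply incl_tran; [exact IHle|].
  simpl; unfold extend; destruct excluded_middle_informative; [|apply incl_refl].
  apply incl_appr, incl_tl, incl_refl.
Qed.

Definition Th (p : form) : Prop := exists n, derivable T (stage n) p.

Lemma Th_Bot : ~ Th Bot.
Proof. intros [n D]; exact (stage_consistent n D). Qed.

Lemma Th_MP p q : Th (Imp p q) -> Th p -> Th q.
Proof.
  intros [n D] [m E]. exists (max n m).
  eapply d_impE; [eapply weakening; [exact D|] | eapply weakening; [exact E|]];
    apply stage_mono; lia.
Qed.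

Lemma Th_derivable p : derivable T [] p -> Th p.
Proof. intro D; exists 0; eapply weakening; [exact D | intros x []]. Qed.

(** The formula is treated at stage [code p]. The left case keeps the witness in sight, which the
    quantifier clauses of the theory depend on. *)
Lemma Th_decide p : (exists n, incl (witness (fresh (p :: stage n)) p ++ [p]) (stage (S n))) \/ Th (Neg p).
Proof.
  pose (n := code p). assert (E : decode n = p) by apply decode_code.
  destruct (excluded_middle_informative (consistent (p :: stage n))) as [C|C].
  - left; exists n; change (stage (S n)) with (extend (decode n) (stage n)).
    rewrite E; unfold extend.
    destruct excluded_middle_informative; [|tauto].
    apply incl_app; [apply incl_appl, incl_refl | apply incl_appr].
    intros x [->|[]]; left; auto.
  - right; exists n; apply d_impI; now apply NNPP.
Qed.

Lemma Th_complete p : Th p \/ Th (Neg p).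
Proof.
  destruct (Th_decide p) as [[n H]|H]; auto. left; exists (S n); apply d_hyp, H, in_or_app.
  right; left; auto.
Qed.

Lemma Th_Imp p q : Th (Imp p q) <-> (Th p -> Th q).
Proof.
  split; [apply Th_MP|]. intro H.
  destruct (Th_complete p) as [Hp|[n D]].
  - destruct (H Hp) as [n D]. exists n. apply d_impI.
    eapply weakening; [exact D | apply incl_tl, incl_refl].
  - exists n; apply d_impI, d_raa.
    eapply d_impE; [eapply weakening; [exact D|] | apply d_hyp; simpl; auto].
    apply incl_tl, incl_tl, incl_refl.
Qed.

Lemma Th_AllN q : Th (AllN q) <-> forall t, Th (instN t q).
Proof.
  split; [intros [n D] t; exists n; now apply d_allNE|]. intro H.
  destruct (Th_decide (Neg (AllN q))) as [[n Hn]|[n D]].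
  (* The recorded counterexample contradicts [H] at the witness variable. *)
  - exfalso; apply Th_Bot. eapply Th_MP; [|apply H].
    exists (S n); apply d_hyp, Hn; left; reflexivity.
  - exists n; apply d_raa. eapply d_impE; [eapply weakening; [exact D|] | apply d_hyp; simpl; auto].
    apply incl_tl, incl_refl.
Qed.

Lemma Th_AllS q : Th (AllS q) <-> forall X, Th (instS X q).
Proof.
  split; [intros [n D] t; exists n; now apply d_allSE|]. intro H.
  destruct (Th_decide (Neg (AllS q))) as [[n Hn]|[n D]].
  - exfalso; apply Th_Bot. eapply Th_MP; [|apply H].
    exists (S n); apply d_hyp, Hn; left; reflexivity.
  - exists n; apply d_raa. eapply d_impE; [eapply weakening; [exact D|] | apply d_hyp; simpl; auto].
    apply incl_tl, incl_refl.
Qed.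

Lemma Th_leibniz p s t : Th (Eq s t) -> Th (instN s p) -> Th (instN t p).
Proof.
  intros [n D] [m E]. exists (max n m).
  eapply d_leibniz; [eapply weakening; [exact D|] | eapply weakening; [exact E|]];
    apply stage_mono; lia.
Qed.

Lemma Th_refl t : Th (Eq t t).
Proof. exists 0; apply d_refl. Qed.

Lemma tinst_tshift s t : tsubst (scons s Var) (tshift t) = t.
Proof. unfold tshift; rewrite tsubst_comp; apply tsubst_Var. Qed.

Lemma Th_sym s t : Th (Eq s t) -> Th (Eq t s).
Proof.
  intro H. pose proof (Th_leibniz (Eq (Var 0) (tshift s)) s t H) as L.
  unfold instN in L; simpl in L; rewrite tinst_tshift in L. rewrite tinst_tshift in L.
  apply L, Th_refl.
Qed.

Lemma Th_trans r s t : Th (Eq r s) -> Th (Eq s t) -> Th (Eq r t).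
Proof.
  intros H H'. pose proof (Th_leibniz (Eq (tshift r) (Var 0)) s t H') as L.
  unfold instN in L; simpl in L; rewrite !tinst_tshift in L. auto.
Qed.

(** Terms modulo provable equality, realized by representatives: the choice depends only on the
    class of [t], because provably equal terms give extensionally equal predicates to [epsilon]. *)
Definition canon (t : term) : term := epsilon (inhabits Zero) (fun s => Th (Eq t s)).

Lemma Th_canon t : Th (Eq t (canon t)).
Proof. unfold canon; apply epsilon_spec. exists t; apply Th_refl. Qed.

Lemma canon_eq s t : Th (Eq s t) <-> canon s = canon t.
Proof.
  split; intro H.
  - unfold canon; f_equal; apply functional_extensionality; intro r.
    apply propositional_extensionality; split; intro; eapply Th_trans; eauto using Th_sym.
  - eapply Th_trans; [apply Th_canon|]. rewrite H; apply Th_sym, Th_canon.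
Qed.

Lemma canon_canon t : canon (canon t) = canon t.
Proof. symmetry; apply canon_eq, Th_canon. Qed.

Definition tdom : Type := {t : term | canon t = t}.
Definition cl (t : term) : tdom := exist _ (canon t) (canon_canon t).

Lemma tdom_eq (x y : tdom) : proj1_sig x = proj1_sig y -> x = y.
Proof.
  destruct x as [x Hx], y as [y Hy]; simpl; intros ->. f_equal; apply proof_irrelevance.
Qed.

Lemma cl_eq s t : cl s = cl t <-> Th (Eq s t).
Proof.
  rewrite canon_eq; split; [intro H; exact (f_equal (@proj1_sig _ _) H) | intro H; now apply tdom_eq].
Qed.

Lemma cl_repr (x : tdom) : cl (proj1_sig x) = x.
Proof. apply tdom_eq; simpl; apply proj2_sig. Qed.

(** The sets are the set variables themselves: the language has no equation between sets that could
    force an identification. *)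
Definition term_model : model :=
  Model tdom nat (cl Zero) (cl One)
    (fun x y => cl (Add (proj1_sig x) (proj1_sig y)))
    (fun x y => cl (Mul (proj1_sig x) (proj1_sig y)))
    (fun x y => Th (Lt (proj1_sig x) (proj1_sig y)))
    (fun x X => Th (Mem (proj1_sig x) X)).

Lemma Th_Add s s' t t' : Th (Eq s s') -> Th (Eq t t') -> Th (Eq (Add s t) (Add s' t')).
Proof.
  intros H H'.
  pose proof (Th_leibniz (Eq (tshift (Add s t)) (Add (Var 0) (tshift t))) s s' H) as L.
  pose proof (Th_leibniz (Eq (tshift (Add s t)) (Add (tshift s') (Var 0))) t t' H') as L'.
  unfold instN in L, L'; simpl in L, L'; rewrite !tinst_tshift in L, L'.
  apply L', L, Th_refl.
Qed.

Lemma Th_Mul s s' t t' : Th (Eq s s') -> Th (Eq t t') -> Th (Eq (Mul s t) (Mul s' t')).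
Proof.
  intros H H'.
  pose proof (Th_leibniz (Eq (tshift (Mul s t)) (Mul (Var 0) (tshift t))) s s' H) as L.
  pose proof (Th_leibniz (Eq (tshift (Mul s t)) (Mul (tshift s') (Var 0))) t t' H') as L'.
  unfold instN in L, L'; simpl in L, L'; rewrite !tinst_tshift in L, L'.
  apply L', L, Th_refl.
Qed.

Lemma Th_Lt s s' t t' : Th (Eq s s') -> Th (Eq t t') -> Th (Lt s t) -> Th (Lt s' t').
Proof.
  intros H H'.
  pose proof (Th_leibniz (Lt (Var 0) (tshift t)) s s' H) as L.
  pose proof (Th_leibniz (Lt (tshift s') (Var 0)) t t' H') as L'.
  unfold instN in L, L'; simpl in L, L'; rewrite !tinst_tshift in L, L'. auto.
Qed.

Lemma Th_Mem t t' X : Th (Eq t t') -> Th (Mem t X) -> Th (Mem t' X).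
Proof. intros H; exact (Th_leibniz (Mem (Var 0) X) t t' H). Qed.

Lemma teval_term_model f t : teval term_model (fun i => cl (f i)) t = cl (tsubst f t).
Proof.
  induction t; simpl; auto; rewrite IHt1, IHt2; apply cl_eq; [apply Th_Add | apply Th_Mul];
    apply Th_sym, Th_canon.
Qed.

(** Stated for all substitutions at once, since a quantifier extends the environment by the class of
    an arbitrary term. *)
Lemma truth p : forall f g, sat term_model (fun i => cl (f i)) g p <-> Th (subst f g p).
Proof.
  induction p; intros f g; cbn [sat subst].
  - rewrite !teval_term_model; apply cl_eq.
  - rewrite !teval_term_model; split; apply Th_Lt; auto using Th_sym, Th_canon.
  - rewrite !teval_term_model; split; apply Th_Mem; auto using Th_sym, Th_canon.
  - split; [tauto | apply Th_Bot].
  - rewrite Th_Imp, IHp1, IHp2; tauto.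
  - rewrite Th_AllN.
    assert (E : forall t, instN t (subst (upN f) g p) = subst (scons t f) g p).
    { intro t; unfold instN; rewrite subst_comp; f_equal.
      apply functional_extensionality; intros [|i]; simpl; auto; apply tinst_tshift. }
    assert (E' : forall t, scons (cl t) (fun i => cl (f i)) = (fun i => cl (scons t f i))).
    { intro t; now apply functional_extensionality; intros [|i]. }
    split; intros H t.
    + fold (upN f); rewrite E; apply IHp; rewrite <- E'; apply H.
    + rewrite <- (cl_repr t), E'; apply IHp; rewrite <- E; apply H.
  - rewrite Th_AllS.
    assert (E : forall X, instS X (subst f (upS g) p) = subst f (scons X g) p).
    { intro X; unfold instS; rewrite subst_comp; f_equal.
      - apply functional_extensionality; intro i; apply tsubst_Var.
      - now apply functional_extensionality; intros [|i]. }
    split; intros H X.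
    + fold (upS g); rewrite E; apply IHp, H.
    + apply IHp; rewrite <- E; apply H.
Qed.

Lemma term_model_satisfies : satisfies term_model T.
Proof.
  intros p e g Hp.
  replace e with (fun i => cl (proj1_sig (e i)))
    by (apply functional_extensionality; intro i; apply cl_repr).
  apply truth, Th_derivable; auto.
Qed.

End Henkin.

Theorem completeness (T : form -> Prop) (p : form) :
  (forall f g p, T p -> derivable T [] (subst f g p)) ->
  (forall (M : model) e g, satisfies M T -> sat M e g p) ->
  proves T p.
Proof.
  intros HT H. apply NNPP; intro N.
  assert (C : consistent T [Neg p]) by (intro D; apply N; now apply d_raa).
  pose proof (truth T HT [Neg p] C p Var (fun X => X)) as Htr.
  rewrite subst_Var in Htr.
  apply (Th_Bot T HT [Neg p] C). eapply Th_MP.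
  - exists 0; apply d_hyp; left; reflexivity.
  - apply Htr, H, term_model_satisfies; auto.
Qed.

Lemma bounded_subst p : bounded p -> forall f g, bounded (subst f g p).
Proof.
  induction 1; intros; simpl; try constructor; auto.
  change (scons (Var 0) (fun i => tshift (f i))) with (upN f).
  replace (tsubst (upN f) (tshift t)) with (tshift (tsubst f t))
    by (unfold tshift; rewrite !tsubst_comp; reflexivity).
  now constructor.
Qed.

(** The basic axioms contain at most the variables 0 and 1. Generalizing twice, then putting [t] for
    variable 1 and [s] for variable 0, yields every substitution instance of them. *)
Lemma RCA0_inst2 s t p :
  RCA0 p ->
  derivable RCA0 []
    (instN s (subst (scons (Var 0) (scons (tshift t) (fun i => Var (S i)))) (fun X => X) p)).
Proof.
  intro H. apply d_ax with (G := []) in H.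
  apply d_allNE. apply (d_allNI RCA0 []) in H. apply (d_allNI RCA0 []) in H.
  apply (d_allNE RCA0 []) with (t := t) in H. unfold instN in H; simpl in H.
  replace (scons (Var 0) (scons (tshift t) (fun i => Var (S i)))) with
    (scons (Var 0) (fun i => tshift (scons t Var i))); auto.
  apply functional_extensionality; intros [|[|i]]; auto.
Qed.

Lemma RCA0_subst f g p : RCA0 p -> derivable RCA0 [] (subst f g p).
Proof.
  intro H; pose proof (RCA0_inst2 (f 0) (f 1) p H) as D.
  destruct H;
    try (unfold instN in D; simpl in D |- *; rewrite ?tinst_tshift in D; exact D).
  (* The two schemes are closed under substitution: the result is the same scheme for the
     substituted matrix, which is again bounded. *)
  - clear D. change (subst f g (Imp (And (instN Zero p) (AllN (Imp p (succ_inst p)))) (AllN p)))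
      with (Imp (And (subst f g (instN Zero p)) (AllN (Imp (subst (upN f) g p) (subst (upN f) g (succ_inst p)))))
              (AllN (subst (upN f) g p))).
    rewrite subst_instN.
    replace (subst (upN f) g (succ_inst p)) with (succ_inst (subst (upN f) g p)).
    2:{ unfold succ_inst; rewrite !subst_comp; f_equal.
        apply functional_extensionality; intros [|i]; simpl; auto.
        unfold tshift; rewrite !tsubst_comp; reflexivity. }
    apply d_ax. apply (ax_ind (subst (upN (upN f)) g r)). now apply bounded_subst.
  - clear D. change (subst f g _) with
      (Imp (AllN (Iff (subst (upN f) g p) (subst (upN f) g q)))
         (ExS (AllN (Iff (Mem (Var 0) 0) (subst (upN f) (upS g) (shiftS p)))))).
    replace (subst (upN f) (upS g) (shiftS p)) with (shiftS (subst (upN f) g p)).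
    2:{ unfold shiftS; rewrite !subst_comp; f_equal.
        apply functional_extensionality; intro i; apply tsubst_Var. }
    apply d_ax, (ax_comp (subst (upN (upN f)) g r) (subst (upN (upN f)) g s));
      now apply bounded_subst.
Qed.

End Completeness.

(** * Definability, arithmetic, comprehension and choice inside a model of RCA0 *)

Module Definability.
Import Arith Lia Classical ClassicalEpsilon FunctionalExtensionality Ring.
Import Defs Completeness.

Declare Scope m_scope.
Delimit Scope m_scope with m.

Section Model.

Variable M : model.
Hypothesis HM : satisfies M RCA0.
(** Makes set environments total where a formula has no set parameter. *)
Variable X0 : sdom M.

Notation N := (dom M).
Notation env := (nat -> dom M).
Local Notation "0" := (mzero M) : m_scope.
Local Notation "1" := (mone M) : m_scope.
Local Notation "x + y" := (madd M x y) : m_scope.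
Local Notation "x * y" := (mmul M x y) : m_scope.
Local Notation "x < y" := (mlt M x y) : m_scope.
Local Notation "x \in X" := (mmem M x X) : m_scope.
Local Open Scope m_scope.

Definition tl (e : env) : env := fun i => e (S i).

Lemma teval_tsubst e f t : teval M e (tsubst f t) = teval M (fun i => teval M e (f i)) t.
Proof. induction t; simpl; congruence. Qed.

Lemma sat_subst p : forall e g f g',
  sat M e g (subst f g' p) <-> sat M (fun i => teval M e (f i)) (fun i => g (g' i)) p.
Proof.
  induction p as [s t|s t|t X| |p1 IH1 p2 IH2|p IH|p IH]; intros; cbn [subst sat];
    rewrite ?teval_tsubst; try tauto.
  - rewrite IH1, IH2; tauto.
  - split; intros H x; specialize (H x); rewrite IH in *;
      [replace (scons x _) with (fun i => teval M (scons x e) (scons (Var 0) (fun i => tshift (f i)) i));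
        [exact H|] |
       replace (fun i => teval M (scons x e) _) with (scons x (fun i => teval M e (f i))); [exact H|]];
      apply functional_extensionality; intros [|i]; simpl; auto;
      unfold tshift; now rewrite teval_tsubst.
  - split; intros H X; specialize (H X); rewrite IH in *;
      [replace (scons X _) with (fun i => scons X g (scons 0%nat (fun i => S (g' i)) i));
        [exact H|] |
       replace (fun i => scons X g _) with (scons X (fun i => g (g' i))); [exact H|]];
      now apply functional_extensionality; intros [|i].
Qed.

Fixpoint mix {T : Type} (e h : nat -> T) (i : nat) : T :=
  match i with
  | O => e O
  | S O => h O
  | S (S i) => mix (fun j => e (S j)) (fun j => h (S j)) i
  end.

Lemma even_succ_double i : Nat.even (S (2 * i)) = false.
Proof. rewrite <- Nat.add_1_r; apply Nat.even_odd. Qed.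

Lemma mix_even {T} i : forall e h : nat -> T, mix e h (2 * i)%nat = e i.
Proof.
  induction i; intros; auto. replace (2 * S i)%nat with (S (S (2 * i))) by lia.
  apply (IHi (fun j => e (S j)) (fun j => h (S j))).
Qed.

Lemma mix_odd {T} i : forall e h : nat -> T, mix e h (S (2 * i))%nat = h i.
Proof.
  induction i; intros; auto. replace (S (2 * S i))%nat with (S (S (S (2 * i)))) by lia.
  apply (IHi (fun j => e (S j)) (fun j => h (S j))).
Qed.

Lemma mix_ext {T} (e h f : nat -> T) :
  (forall i, f (2 * i)%nat = e i) -> (forall i, f (S (2 * i)) = h i) -> mix e h = f.
Proof.
  intros He Hh; apply functional_extensionality; intro i.
  destruct (Nat.Even_or_Odd i) as [[j ->]|[j ->]].
  - now rewrite mix_even.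
  - replace (2 * j + 1)%nat with (S (2 * j)) by lia; now rewrite mix_odd.
Qed.

(* [Tm], [Bd] and [Sg]: terms, Sigma^0_0 formulas and Sigma^0_1 formulas, seen as functions of
   the values of their variables.  Parameters are allowed: [mix] interleaves the variables with
   the number parameters [h], and [g] supplies the set parameters. *)
Definition Tm (t : env -> N) : Prop :=
  exists r h, forall e, t e = teval M (mix e h) r.
Definition Bd (P : env -> Prop) : Prop :=
  exists r h g, bounded r /\ forall e, P e <-> sat M (mix e h) g r.

(** To combine two formulas, their parameters [h1] and [h2] are merged into [mix h1 h2]. The
    renamings fix the even indices, which are the variables, and send the j-th parameter to slot 2j
    or 2j+1 of the merged list. *)
Definition left_param (i : nat) : nat := if Nat.even i then i else (2 * i - 1)%nat.
Definition right_param (i : nat) : nat := if Nat.even i then i else (2 * i + 1)%nat.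

Lemma mix_left (e h1 h2 : env) : (fun i => mix e (mix h1 h2) (left_param i)) = mix e h1.
Proof.
  symmetry; apply mix_ext; intro i; unfold left_param.
  - rewrite Nat.even_even; apply mix_even.
  - rewrite even_succ_double.
    replace (2 * S (2 * i) - 1)%nat with (S (2 * (2 * i))) by lia.
    now rewrite mix_odd, mix_even.
Qed.

Lemma mix_right (e h1 h2 : env) : (fun i => mix e (mix h1 h2) (right_param i)) = mix e h2.
Proof.
  symmetry; apply mix_ext; intro i; unfold right_param.
  - rewrite Nat.even_even; apply mix_even.
  - rewrite even_succ_double.
    replace (2 * S (2 * i) + 1)%nat with (S (2 * (S (2 * i)))) by lia.
    now rewrite !mix_odd.
Qed.

Lemma Tm_var i : Tm (fun e => e i).
Proof. exists (Var (2 * i)), (fun _ => 0); intro e; symmetry; apply mix_even. Qed.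

Lemma Tm_const c : Tm (fun _ => c).
Proof. exists (Var 1), (fun _ => c); reflexivity. Qed.

Lemma Tm_pair s t : Tm s -> Tm t ->
  exists r r' h, forall e, s e = teval M (mix e h) r /\ t e = teval M (mix e h) r'.
Proof.
  intros [r [h H]] [r' [h' H']].
  exists (tsubst (fun i => Var (left_param i)) r), (tsubst (fun i => Var (right_param i)) r'), (mix h h').
  intro e; rewrite !teval_tsubst; simpl; rewrite mix_left, mix_right; auto.
Qed.

Lemma Tm_add s t : Tm s -> Tm t -> Tm (fun e => s e + t e).
Proof.
  intros Hs Ht; destruct (Tm_pair s t Hs Ht) as [r [r' [h H]]].
  exists (Add r r'), h; intro e; destruct (H e) as [-> ->]; reflexivity.
Qed.

Lemma Tm_mul s t : Tm s -> Tm t -> Tm (fun e => s e * t e).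
Proof.
  intros Hs Ht; destruct (Tm_pair s t Hs Ht) as [r [r' [h H]]].
  exists (Mul r r'), h; intro e; destruct (H e) as [-> ->]; reflexivity.
Qed.

Lemma Tm_ren (s : env -> N) (f : nat -> nat) : Tm s -> Tm (fun e => s (fun i => e (f i))).
Proof.
  intros [r [h H]].
  exists (tsubst (fun i => Var (if Nat.even i then 2 * f (Nat.div2 i) else i)) r), h.
  intro e; rewrite H, teval_tsubst; f_equal; simpl.
  apply mix_ext; intro i.
  - rewrite Nat.even_even, Nat.div2_double; apply mix_even.
  - rewrite even_succ_double; apply mix_odd.
Qed.

Lemma Tm_tl s : Tm s -> Tm (fun e => s (tl e)).
Proof. apply Tm_ren. Qed.

Lemma Bd_eq s t : Tm s -> Tm t -> Bd (fun e => s e = t e).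
Proof.
  intros Hs Ht; destruct (Tm_pair s t Hs Ht) as [r [r' [h H]]].
  exists (Eq r r'), h, (fun _ => X0); split; [constructor|].
  intro e; destruct (H e) as [-> ->]; reflexivity.
Qed.

Lemma Bd_lt s t : Tm s -> Tm t -> Bd (fun e => s e < t e).
Proof.
  intros Hs Ht; destruct (Tm_pair s t Hs Ht) as [r [r' [h H]]].
  exists (Lt r r'), h, (fun _ => X0); split; [constructor|].
  intro e; destruct (H e) as [-> ->]; reflexivity.
Qed.

Lemma Bd_mem t X : Tm t -> Bd (fun e => t e \in X).
Proof.
  intros [r [h H]]; exists (Mem r O), h, (fun _ => X); split; [constructor|].
  intro e; rewrite H; reflexivity.
Qed.

Lemma Bd_False : Bd (fun _ => False).
Proof. exists Bot, (fun _ => 0), (fun _ => X0); split; [constructor | reflexivity]. Qed.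

Lemma Bd_iff P Q : (forall e, P e <-> Q e) -> Bd P -> Bd Q.
Proof. intros E [r [h [g [B H]]]]; exists r, h, g; split; auto. intro e; now rewrite <- E. Qed.

Lemma Bd_imp P Q : Bd P -> Bd Q -> Bd (fun e => P e -> Q e).
Proof.
  intros [r [h [g [B H]]]] [r' [h' [g' [B' H']]]].
  exists (Imp (subst (fun i => Var (left_param i)) (fun i => 2 * i)%nat r)
              (subst (fun i => Var (right_param i)) (fun i => S (2 * i)) r')), (mix h h'), (mix g g').
  split; [constructor; now apply bounded_subst|].
  intro e; cbn [sat]; rewrite !sat_subst; simpl teval; rewrite mix_left, mix_right, H, H'.
  replace (fun i => mix g g' (2 * i)) with g
    by (apply functional_extensionality; intro i; symmetry; exact (mix_even i g g')).
  replace (fun i => mix g g' (S (2 * i))) with g'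
    by (apply functional_extensionality; intro i; symmetry; exact (mix_odd i g g')).
  reflexivity.
Qed.

Lemma Bd_not P : Bd P -> Bd (fun e => ~ P e).
Proof. intro H; apply Bd_imp; auto using Bd_False. Qed.

Lemma Bd_or P Q : Bd P -> Bd Q -> Bd (fun e => P e \/ Q e).
Proof.
  intros HP HQ; apply (Bd_iff (fun e => ~ P e -> Q e)); [|auto using Bd_imp, Bd_not].
  intro e; destruct (classic (P e)); tauto.
Qed.

Lemma Bd_and P Q : Bd P -> Bd Q -> Bd (fun e => P e /\ Q e).
Proof.
  intros HP HQ; apply (Bd_iff (fun e => ~ (P e -> ~ Q e))); [|auto using Bd_imp, Bd_not].
  intro e; destruct (classic (P e)), (classic (Q e)); tauto.
Qed.

(** The terms [f i] may refer to [k], so this is the way to turn variables into parameters. *)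
Lemma Bd_tsub P (f : nat -> term) (k : env) :
  Bd P -> Bd (fun e => P (fun i => teval M (mix e k) (f i))).
Proof.
  intros [r [h [g [B H]]]].
  exists (subst (fun i => if Nat.even i then tsubst (fun j => Var (left_param j)) (f (Nat.div2 i))
    else Var (right_param i)) (fun X => X) r), (mix k h), g.
  split; [now apply bounded_subst|].
  intro e; rewrite H, sat_subst.
  erewrite mix_ext; [reflexivity| |]; intro i; cbv beta.
  - rewrite Nat.even_even, Nat.div2_double, teval_tsubst; cbn [teval]; now rewrite mix_left.
  - rewrite even_succ_double; cbn [teval].
    change (mix e (mix k h) (right_param (S (2 * i)))) with
      ((fun j => mix e (mix k h) (right_param j)) (S (2 * i))).
    now rewrite mix_right, mix_odd.
Qed.

Lemma Bd_ren P (f : nat -> nat) : Bd P -> Bd (fun e => P (fun i => e (f i))).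
Proof.
  intro H; apply (Bd_iff (fun e => P (fun i => teval M (mix e (fun _ => 0)) (Var (2 * f i))))).
  - intro e; cbn [teval].
    replace (fun i => mix e _ _) with (fun i => e (f i)); [reflexivity|].
    apply functional_extensionality; intro i; symmetry; apply mix_even.
  - now apply Bd_tsub.
Qed.

(** A quantifier pushes its value in front of the interleaved list, while the body expects it in
    front of the variables only; this renaming corrects the positions. *)
Definition bind_param (i : nat) : nat :=
  if Nat.even i then match Nat.div2 i with O => O | S k => S (2 * k) end
  else S (right_param i).

Lemma mix_bind x (e h1 h2 : env) :
  (fun i => scons x (mix e (mix h1 h2)) (bind_param i)) = mix (scons x e) h2.
Proof.
  symmetry; apply mix_ext; intro i; unfold bind_param.
  - rewrite Nat.even_even, Nat.div2_double; destruct i; simpl scons; auto; apply mix_even.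
  - rewrite even_succ_double; cbn [scons].
    change (mix e (mix h1 h2) (right_param (S (2 * i)))) with
      ((fun j => mix e (mix h1 h2) (right_param j)) (S (2 * i))).
    now rewrite mix_right, mix_odd.
Qed.

(** The form [Q (tl e) (e O)] is the convention throughout: it presents a family [Q e x] as a
    predicate of one environment with [x] at index 0. *)
Lemma Bd_all t Q : Tm t -> Bd (fun e => Q (tl e) (e O)) -> Bd (fun e => forall x, x < t e -> Q e x).
Proof.
  intros [r [h H]] [r' [h' [g [B H']]]].
  exists (AllN (Imp (Lt (Var 0) (tshift (tsubst (fun i => Var (left_param i)) r)))
     (subst (fun i => Var (bind_param i)) (fun X => X) r'))), (mix h h'), g.
  split; [constructor; now apply bounded_subst|].
  intro e; cbn [sat]; unfold tshift.
  assert (E : forall x, Q e x <-> sat M (scons x (mix e (mix h h'))) g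
    (subst (fun i => Var (bind_param i)) (fun X => X) r')).
  { intro x; rewrite sat_subst; simpl teval; rewrite mix_bind, <- H'; reflexivity. }
  assert (E' : forall x, teval M (scons x (mix e (mix h h')))
    (tsubst (fun i => Var (S i)) (tsubst (fun i => Var (left_param i)) r)) = t e).
  { intro x; rewrite !teval_tsubst; simpl; rewrite mix_left; auto. }
  split; intros HQ x; specialize (HQ x); rewrite E' in *; cbn [teval scons] in *;
    rewrite E in *; auto.
Qed.

Lemma Bd_ex t Q : Tm t -> Bd (fun e => Q (tl e) (e O)) ->
  Bd (fun e => exists x, x < t e /\ Q e x).
Proof.
  intros Ht HQ; apply (Bd_iff (fun e => ~ forall x, x < t e -> ~ Q e x)).
  - intro e; split.
    + intro H; apply NNPP; intro K; apply H; intros x Hx Hq; apply K; eauto.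
    + intros [x [Hx Hq]] H; exact (H x Hx Hq).
  - apply Bd_not, (Bd_all t (fun e x => ~ Q e x)); auto using Bd_not.
Qed.

Lemma ax0 (p : form) x y : RCA0 p -> sat M (scons x (scons y (fun _ => 0))) (fun _ => X0) p.
Proof. intro H; now apply HM. Qed.

Lemma succ_neq0 x : x + 1 <> 0.
Proof. exact (ax0 _ x x ax_succ_neq0). Qed.

Lemma succ_inj x y : x + 1 = y + 1 -> x = y.
Proof. exact (ax0 _ x y ax_succ_inj). Qed.

Lemma add_0_r x : x + 0 = x.
Proof. exact (ax0 _ x x ax_add0). Qed.

Lemma add_succ_r x y : x + (y + 1) = (x + y) + 1.
Proof. exact (ax0 _ x y ax_addS). Qed.

Lemma mul_0_r x : x * 0 = 0.
Proof. exact (ax0 _ x x ax_mul0). Qed.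

Lemma mul_succ_r x y : x * (y + 1) = x * y + x.
Proof. exact (ax0 _ x y ax_mulS). Qed.

Lemma nlt_0_r x : ~ x < 0.
Proof. exact (ax0 _ x x ax_lt0). Qed.

Lemma lt_succ_r x y : x < y + 1 <-> x < y \/ x = y.
Proof.
  pose proof (ax0 _ x y ax_ltS) as H; cbn in H.
  destruct (classic (x < y)), (classic (x = y)), (classic (x < y + 1)); tauto.
Qed.

Definition Sg (P : env -> Prop) : Prop :=
  exists R : env -> N -> Prop, Bd (fun e => R (tl e) (e O)) /\ forall e, P e <-> exists x, R e x.

Lemma Sg_iff P Q : (forall e, P e <-> Q e) -> Sg P -> Sg Q.
Proof. intros E [R [B H]]; exists R; split; auto. intro e; now rewrite <- E. Qed.

Lemma Sg_Bd P : Bd P -> Sg P.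
Proof.
  intro H; exists (fun e _ => P e); split; [exact (Bd_ren P S H)|].
  intro e; split; [intro; now exists 0 | now intros [_ K]].
Qed.

(** The schemes of [RCA0] are evaluated in plain environments. Here the interleaving is undone: two
    variables in front, the parameters behind them. *)
Lemma Bd_rep2 (R : env -> Prop) : Bd R ->
  exists r h g, bounded r /\
    forall x n, R (scons x (scons n (fun _ => 0))) <-> sat M (scons x (scons n h)) g r.
Proof.
  intros [r [h [g [B H]]]].
  exists (subst (fun i => if Nat.even i then
     match Nat.div2 i with O => Var 0 | S O => Var 1 | _ => Zero end
     else Var (S (S (Nat.div2 i)))) (fun X => X) r), h, g.
  split; [now apply bounded_subst|]. intros x n. rewrite sat_subst, H.
  erewrite mix_ext; [reflexivity| |]; intro i; cbv beta.
  - rewrite Nat.even_even, Nat.div2_double; destruct i as [|[|i]]; reflexivity.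
  - rewrite even_succ_double, Nat.div2_succ_double; reflexivity.
Qed.

Lemma sat_ExN e g p : sat M e g (ExN p) <-> exists x, sat M (scons x e) g p.
Proof.
  cbn [sat ExN Neg]; split.
  - intro K; apply NNPP; intro L; apply K; intros x Hx; eauto.
  - intros [x Hx] K; exact (K x Hx).
Qed.

Lemma sat_ExS e g p : sat M e g (ExS p) <-> exists X, sat M e (scons X g) p.
Proof.
  cbn [sat ExS Neg]; split.
  - intro K; apply NNPP; intro L; apply K; intros x Hx; eauto.
  - intros [x Hx] K; exact (K x Hx).
Qed.

Lemma sat_Iff e g p q : sat M e g (Iff p q) <-> (sat M e g p <-> sat M e g q).
Proof. cbn; split; [intro H; split; apply NNPP; tauto | tauto]. Qed.

Lemma ind_Sg P : Sg (fun e => P (e O)) -> P 0 -> (forall n, P n -> P (n + 1)) -> forall n, P n.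
Proof.
  intros [R [B HR]] P0 PS. destruct (Bd_rep2 _ B) as [r' [h [g [B' E]]]].
  assert (E' : forall n, sat M (scons n h) g (ExN r') <-> P n).
  { intro n. rewrite (HR (scons n (fun _ => 0))), sat_ExN.
    split; intros [x Hx]; exists x; now apply E. }
  pose proof (HM _ h g (ax_ind r' B')) as I; cbv zeta in I.
  assert (I' : forall n, sat M (scons n h) g (ExN r')).
  { change (sat M h g (And (instN Zero (ExN r')) (AllN (Imp (ExN r') (succ_inst (ExN r')))))
            -> forall n, sat M (scons n h) g (ExN r')) in I.
    apply I; clear I. intro K; apply K; clear K.
    - unfold instN; rewrite sat_subst.
      match goal with |- sat M ?e _ _ => replace e with (scons 0 h); [now apply E'|] end.
      apply functional_extensionality; intros [|i]; reflexivity.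
    - intros n Hn; unfold succ_inst; rewrite sat_subst.
      match goal with |- sat M ?e _ _ => replace e with (scons (n + 1) h) end.
      + apply E', PS, E', Hn.
      + apply functional_extensionality; intros [|i]; reflexivity. }
  intro n; apply E', I'.
Qed.

Lemma ind_Bd P : Bd (fun e => P (e O)) -> P 0 -> (forall n, P n -> P (n + 1)) -> forall n, P n.
Proof. intro H; apply ind_Sg; now apply Sg_Bd. Qed.

Ltac tm := repeat first
  [ apply Tm_var | apply Tm_const | apply Tm_add | apply Tm_mul
  | match goal with |- Tm (fun e => ?t (tl e)) => apply (Tm_tl t) end | assumption ].

Lemma add_0_l x : 0 + x = x.
Proof.
  apply (ind_Bd (fun x => 0 + x = x)); [apply Bd_eq; tm | apply add_0_r |].
  intros n H; now rewrite add_succ_r, H.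
Qed.

Lemma add_assoc x y z : x + (y + z) = (x + y) + z.
Proof.
  apply (ind_Bd (fun z => x + (y + z) = (x + y) + z)); [apply Bd_eq; tm | now rewrite !add_0_r |].
  intros n H; now rewrite !add_succ_r, H.
Qed.

Lemma add_1_comm x : 1 + x = x + 1.
Proof.
  apply (ind_Bd (fun x => 1 + x = x + 1)); [apply Bd_eq; tm | now rewrite add_0_r, add_0_l |].
  intros n H; now rewrite add_succ_r, H.
Qed.

Lemma add_comm x y : x + y = y + x.
Proof.
  apply (ind_Bd (fun y => x + y = y + x)); [apply Bd_eq; tm | now rewrite add_0_r, add_0_l |].
  intros n H; now rewrite add_succ_r, H, <- !add_assoc, add_1_comm.
Qed.

Lemma mul_add_distr_l x y z : x * (y + z) = x * y + x * z.
Proof.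
  apply (ind_Bd (fun z => x * (y + z) = x * y + x * z)); [apply Bd_eq; tm | |].
  - now rewrite mul_0_r, !add_0_r.
  - intros n H; now rewrite add_succ_r, !mul_succ_r, H, add_assoc.
Qed.

Lemma mul_0_l x : 0 * x = 0.
Proof.
  apply (ind_Bd (fun x => 0 * x = 0)); [apply Bd_eq; tm | apply mul_0_r |].
  intros n H; now rewrite mul_succ_r, H, add_0_r.
Qed.

Lemma mul_1_l x : 1 * x = x.
Proof.
  apply (ind_Bd (fun x => 1 * x = x)); [apply Bd_eq; tm | apply mul_0_r |].
  intros n H; now rewrite mul_succ_r, H.
Qed.

Lemma mul_succ_l x y : (x + 1) * y = x * y + y.
Proof.
  apply (ind_Bd (fun y => (x + 1) * y = x * y + y)); [apply Bd_eq; tm | now rewrite !mul_0_r, add_0_r |].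
  intros n H; rewrite !mul_succ_r, H, <- !add_assoc. f_equal.
  now rewrite !add_assoc, (add_comm n x).
Qed.

Lemma mul_comm x y : x * y = y * x.
Proof.
  apply (ind_Bd (fun y => x * y = y * x)); [apply Bd_eq; tm | now rewrite mul_0_r, mul_0_l |].
  intros n H; now rewrite mul_succ_r, mul_succ_l, H.
Qed.

Lemma mul_assoc x y z : x * (y * z) = (x * y) * z.
Proof.
  apply (ind_Bd (fun z => x * (y * z) = (x * y) * z)); [apply Bd_eq; tm | now rewrite !mul_0_r |].
  intros n H; now rewrite !mul_succ_r, mul_add_distr_l, H.
Qed.

Lemma dom_semiring : semi_ring_theory 0 1 (madd M) (mmul M) eq.
Proof.
  constructor; auto using add_0_l, add_comm, add_assoc, mul_1_l, mul_0_l, mul_comm, mul_assoc.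
  intros n m p; now rewrite !(mul_comm _ p), mul_add_distr_l.
Qed.

Add Ring dom_ring : dom_semiring.

Lemma add_cancel_r x y z : x + z = y + z -> x = y.
Proof.
  apply (ind_Bd (fun z => x + z = y + z -> x = y)); [apply Bd_imp; apply Bd_eq; tm | |].
  - now rewrite !add_0_r.
  - intros n H K; apply H, succ_inj. now rewrite <- !add_succ_r.
Qed.

Lemma zero_or_succ x : x = 0 \/ exists y, x = y + 1.
Proof.
  destruct (classic (x = 0)) as [|H]; auto. right.
  (* The bound on [y] keeps the induction formula Sigma^0_0. *)
  assert (K : x <> 0 -> exists y, y < x + 1 /\ x = y + 1).
  { apply (ind_Bd (fun x => x <> 0 -> exists y, y < x + 1 /\ x = y + 1)).
    - apply Bd_imp; [apply Bd_not, Bd_eq; tm|].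
      apply (Bd_ex (fun e => e O + 1) (fun e y => e O = y + 1)); [tm | apply Bd_eq; tm].
    - tauto.
    - intros n _ _; exists n; split; auto. apply lt_succ_r; left; apply lt_succ_r; auto. }
  destruct (K H) as [y [_ Hy]]; eauto.
Qed.

Lemma add_eq_0 x y : x + y = 0 -> x = 0.
Proof.
  destruct (zero_or_succ y) as [->|[z ->]]; [now rewrite add_0_r|].
  rewrite add_succ_r; intro H; now apply succ_neq0 in H.
Qed.

Lemma lt_add_succ x k : x < x + k + 1.
Proof.
  apply (ind_Bd (fun k => x < x + k + 1)); [apply Bd_lt; tm | |].
  - rewrite add_0_r; apply lt_succ_r; auto.
  - intros n H; apply lt_succ_r; left; now rewrite add_succ_r.
Qed.

Lemma lt_iff x y : x < y <-> exists k, y = x + k + 1.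
Proof.
  split; [|intros [k ->]; apply lt_add_succ]. intro H.
  assert (K : x < y -> exists k, k < y /\ y = x + k + 1).
  { apply (ind_Bd (fun y => x < y -> exists k, k < y /\ y = x + k + 1)).
    - apply Bd_imp; [apply Bd_lt; tm|].
      apply (Bd_ex (fun e => e O) (fun e k => e O = x + k + 1)); [tm | apply Bd_eq; tm].
    - intro K; now apply nlt_0_r in K.
    - intros n IH K; apply lt_succ_r in K as [K| ->].
      + destruct (IH K) as [k [Hk Hn]]. exists (k + 1); split.
        * rewrite Hn at 1. replace (x + k + 1 + 1) with (k + 1 + x + 1) by ring. apply lt_add_succ.
        * rewrite Hn at 1; ring.
      + exists 0; split; [|now rewrite add_0_r].
        replace (n + 1) with (0 + n + 1) by ring. apply lt_add_succ. }
  destruct (K H) as [k [_ Hk]]; eauto.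
Qed.

Lemma lt_irrefl x : ~ x < x.
Proof.
  intro H; apply lt_iff in H as [k H].
  apply (succ_neq0 k), (add_cancel_r _ _ x). rewrite add_0_l. rewrite H at 2; ring.
Qed.

Lemma lt_trans x y z : x < y -> y < z -> x < z.
Proof.
  rewrite !lt_iff; intros [k ->] [l ->]. exists (k + l + 1); ring.
Qed.

Lemma lt_total x y : x < y \/ x = y \/ y < x.
Proof.
  apply (ind_Bd (fun x => x < y \/ x = y \/ y < x)).
  - repeat apply Bd_or; (apply Bd_lt || apply Bd_eq); tm.
  - destruct (zero_or_succ y) as [->|[z ->]]; auto. left.
    replace (z + 1) with (0 + z + 1) by ring. apply lt_add_succ.
  - intros n [H|[-> |H]].
    + apply lt_iff in H as [k ->]. destruct (zero_or_succ k) as [->|[l ->]].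
      * right; left; ring.
      * left; apply lt_iff; exists l; ring.
    + right; right; apply lt_succ_r; auto.
    + right; right; apply lt_succ_r; auto.
Qed.

Lemma lt_add_r x y : x < x + y + 1.
Proof. apply lt_add_succ. Qed.

Lemma lt_add_l x y : x < y + x + 1.
Proof. rewrite (add_comm y); apply lt_add_succ. Qed.

(** A single number bounding both witnesses contracts the two unbounded quantifiers. *)
Lemma Sg_and P Q : Sg P -> Sg Q -> Sg (fun e => P e /\ Q e).
Proof.
  intros [R [B H]] [R' [B' H']].
  exists (fun e b => (exists x, x < b /\ R e x) /\ (exists y, y < b /\ R' e y)); split.
  - apply Bd_and.
    + apply (Bd_ex (fun e => e O) (fun e x => R (tl e) x)); [tm|].
      exact (Bd_ren _ (fun i => match i with O => O | S i => S (S i) end) B).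
    + apply (Bd_ex (fun e => e O) (fun e x => R' (tl e) x)); [tm|].
      exact (Bd_ren _ (fun i => match i with O => O | S i => S (S i) end) B').
  - intro e; rewrite H, H'; split.
    + intros [[x Hx] [y Hy]]; exists (x + y + 1); split;
        [exists x | exists y]; auto using lt_add_r, lt_add_l.
    + intros [b [[x [_ Hx]] [y [_ Hy]]]]; eauto.
Qed.

Lemma Sg_or P Q : Sg P -> Sg Q -> Sg (fun e => P e \/ Q e).
Proof.
  intros [R [B H]] [R' [B' H']].
  exists (fun e b => R e b \/ R' e b); split; [now apply Bd_or|].
  intro e; rewrite H, H'; split; [intros [[x Hx]|[x Hx]]; eauto | intros [x [Hx|Hx]]; eauto].
Qed.

Lemma Sg_ex (Q : env -> N -> Prop) :
  Sg (fun e => Q (tl e) (e O)) -> Sg (fun e => exists y, Q e y).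
Proof.
  intros [R [B H]].
  exists (fun e b => exists y, y < b /\ exists x, x < b /\ R (scons y e) x); split.
  - apply (Bd_ex (fun e => e O) (fun e y => exists x, x < e O /\ R (scons y (tl e)) x)); [tm|].
    apply (Bd_ex (fun e => e 1%nat) (fun e x => R (scons (e O) (tl (tl e))) x)); [tm|].
    apply (Bd_iff (fun e => R (tl (fun i => e (match i with O => O | S O => 1%nat | S (S i) => S (S (S i)) end)))
       ((fun i => e (match i with O => O | S O => 1%nat | S (S i) => S (S (S i)) end)) O))).
    + intro e. match goal with |- R ?a _ <-> R ?b _ => replace b with a; [reflexivity|] end.
      apply functional_extensionality; intros [|i]; reflexivity.
    + exact (Bd_ren _ (fun i => match i with O => O | S O => 1%nat | S (S i) => S (S (S i)) end) B).
  - intro e; split.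
    + intros [y Hy]. apply (H (scons y e)) in Hy as [x Hx].
      exists (y + x + 1); exists y; split; [apply lt_add_r|]. exists x; split; [apply lt_add_l | exact Hx].
    + intros [b [y [_ [x [_ Hx]]]]]. exists y; apply (H (scons y e)); eauto.
Qed.

Lemma collection (R : N -> N -> Prop) t :
  Bd (fun e => R (e O) (e 1%nat)) -> (forall y, y < t -> exists x, R y x) ->
  exists b, forall y, y < t -> exists x, x < b /\ R y x.
Proof.
  intros B H.
  (* The guard [y < t] lets the induction run over all [n], although witnesses are promised only
     below [t]. *)
  assert (K : forall n, exists b, forall y, y < n -> exists x, x < b /\ (y < t -> R y x)).
  { apply ind_Sg.
    - apply Sg_ex, Sg_Bd.
      apply (Bd_all (fun e => e 1%nat) (fun e y => exists x, x < e O /\ (y < t -> R y x))); [tm|].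
      apply (Bd_ex (fun e => e 1%nat) (fun e x => e O < t -> R (e O) x)); [tm|].
      apply Bd_imp; [apply Bd_lt; tm |].
      exact (Bd_ren _ (fun i => match i with O => 1%nat | S _ => O end) B).
    - exists 0; intros y Hy; now apply nlt_0_r in Hy.
    - intros n [b Hb].
      assert (exists x0, n < t -> R n x0) as [x0 Hx0].
      { destruct (classic (n < t)) as [L|L]; [|exists 0; tauto].
        destruct (H n L) as [x Hx]; eauto. }
      exists (b + x0 + 1); intros y Hy. apply lt_succ_r in Hy as [Hy| ->].
      + destruct (Hb y Hy) as [x [Hx HR]]; exists x; split; auto.
        eapply lt_trans; [exact Hx | apply lt_add_r].
      + exists x0; split; auto using lt_add_l. }
  destruct (K t) as [b Hb]; exists b; intros y Hy.
  destruct (Hb y Hy) as [x [Hx HR]]; eauto.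
Qed.

Lemma Bd_fix2 (R : env -> N -> N -> Prop) e0 :
  Bd (fun e => R (tl (tl e)) (e 1%nat) (e O)) -> Bd (fun e => R e0 (e O) (e 1%nat)).
Proof.
  intro H.
  apply (Bd_iff (fun e => (fun e => R (tl (tl e)) (e 1%nat) (e O)) (fun i => teval M (mix e e0)
    (match i with O => Var 2 | S O => Var 0 | S (S i) => Var (S (2 * i)) end)))).
  - intro e; cbv beta. unfold tl at 1 2; cbn [teval].
    replace (fun i => mix e e0 _) with e0; [reflexivity|].
    apply functional_extensionality; intro i; symmetry; apply (mix_odd i e e0).
  - exact (Bd_tsub _ _ _ H).
Qed.

(** By collection the witnesses for all [y < t e] have a common bound, so the unbounded quantifier
    moves to the front. *)
Lemma Sg_all t (Q : env -> N -> Prop) : Tm t ->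
  Sg (fun e => Q (tl e) (e O)) -> Sg (fun e => forall y, y < t e -> Q e y).
Proof.
  intros Ht [R [B H]].
  assert (B' : Bd (fun e => R (scons (e 1%nat) (tl (tl e))) (e O))).
  { apply (Bd_iff (fun e => R (tl e) (e O))); auto.
    intro e. match goal with |- R ?a _ <-> R ?b _ => replace b with a; [reflexivity|] end.
    apply functional_extensionality; intros [|i]; reflexivity. }
  exists (fun e b => forall y, y < t e -> exists x, x < b /\ R (scons y e) x); split.
  - apply (Bd_all (fun e => t (tl e)) (fun e y => exists x, x < e O /\ R (scons y (tl e)) x)); [tm|].
    apply (Bd_ex (fun e => e 1%nat) (fun e x => R (scons (e O) (tl (tl e))) x)); [tm|].
    exact (Bd_ren _ (fun i => match i with O => O | S O => 1%nat | S (S i) => S (S (S i)) end) B').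
  - intro e; split.
    + intro K. apply (collection (fun y x => R (scons y e) x)).
      * apply (Bd_fix2 (fun e y x => R (scons y e) x)); exact B'.
      * intros y Hy; apply (H (scons y e)), K, Hy.
    + intros [b Hb] y Hy. destruct (Hb y Hy) as [x [_ Hx]]. apply (H (scons y e)); eauto.
Qed.

Lemma Sg_ren P (f : nat -> nat) : Sg P -> Sg (fun e => P (fun i => e (f i))).
Proof.
  intros [R [B H]]; exists (fun e => R (fun i => e (f i))); split.
  - exact (Bd_ren _ (fun i => match i with O => O | S i => S (f i) end) B).
  - intro e; apply H.
Qed.

Lemma comprehension (P : N -> Prop) :
  Sg (fun e => P (e O)) -> Sg (fun e => ~ P (e O)) -> exists X, forall n, n \in X <-> P n.
Proof.
  intros [R [B H]] [R' [B' H']].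
  destruct (Bd_rep2 _ B) as [r [h [g [Br E]]]].
  destruct (Bd_rep2 _ (Bd_not _ B')) as [r' [h' [g' [Br' E']]]].
  pose (ren f i := Var (match i with O => O | S O => 1%nat | S (S i) => S (S (f i)) end)).
  pose (s := subst (ren (fun i => 2 * i)%nat) (fun i => 2 * i)%nat r).
  pose (s' := subst (ren (fun i => S (2 * i))) (fun i => S (2 * i)) r').
  assert (Es : forall x n, sat M (scons x (scons n (mix h h'))) (mix g g') s <-> R (scons n (fun _ => 0)) x).
  { intros x n; rewrite (E x n); unfold s; rewrite sat_subst.
    match goal with |- sat M ?e1 ?g1 _ <-> sat M ?e2 ?g2 _ =>
      replace e1 with e2; [replace g1 with g2; [reflexivity|]|] end.
    - apply functional_extensionality; intro i; now rewrite mix_even.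
    - apply functional_extensionality; intros [|[|i]]; auto. symmetry; exact (mix_even i h h'). }
  assert (Es' : forall x n, sat M (scons x (scons n (mix h h'))) (mix g g') s' <-> ~ R' (scons n (fun _ => 0)) x).
  { intros x n; rewrite (E' x n); unfold s'; rewrite sat_subst.
    match goal with |- sat M ?e1 ?g1 _ <-> sat M ?e2 ?g2 _ =>
      replace e1 with e2; [replace g1 with g2; [reflexivity|]|] end.
    - apply functional_extensionality; intro i; now rewrite mix_odd.
    - apply functional_extensionality; intros [|[|i]]; auto. symmetry; exact (mix_odd i h h'). }
  assert (Ep : forall n, sat M (scons n (mix h h')) (mix g g') (ExN s) <-> P n).
  { intro n; rewrite sat_ExN, (H (scons n (fun _ => 0))).
    split; intros [x Hx]; exists x; now apply Es. }
  assert (Eq : forall n, sat M (scons n (mix h h')) (mix g g') (AllN s') <-> P n).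
  { intro n; cbn [sat]. specialize (H' (scons n (fun _ => 0))); cbn [scons] in H'.
    setoid_rewrite Es'. split.
    - intro K; apply NNPP; intro L; apply H' in L as [x Hx]; exact (K x Hx).
    - intros K x Hx; apply H'; eauto. }
  assert (Bs : bounded s) by now apply bounded_subst.
  assert (Bs' : bounded s') by now apply bounded_subst.
  pose proof (HM _ (mix h h') (mix g g') (ax_comp s s' Bs Bs')) as C; cbv zeta in C.
  change (sat M (mix h h') (mix g g') (AllN (Iff (ExN s) (AllN s'))) ->
    sat M (mix h h') (mix g g') (ExS (AllN (Iff (Mem (Var 0) 0) (shiftS (ExN s)))))) in C.
  rewrite sat_ExS in C. destruct C as [X HX].
  - intro n; rewrite sat_Iff, Ep, Eq; reflexivity.
  - exists X; intro n. specialize (HX n); rewrite sat_Iff in HX.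
    cbn [sat teval scons] in HX. rewrite HX. unfold shiftS; rewrite sat_subst. apply Ep.
Qed.

(** Total functions with Sigma^0_1 graph. By totality the graph is Delta^0_1, so these are the
    functions that the model can code by sets. *)
Definition Fnc (t : env -> N) : Prop := Sg (fun e => e O = t (tl e)).
Definition computable (f : N -> N) : Prop := Sg (fun e => e O = f (e 1%nat)).

Lemma Fnc_Tm t : Tm t -> Fnc t.
Proof. intro H; apply Sg_Bd, Bd_eq; tm. Qed.

Lemma Sg_sub (Q : env -> N -> Prop) t :
  Fnc t -> Sg (fun e => Q (tl e) (e O)) -> Sg (fun e => Q e (t e)).
Proof.
  intros Ht HQ. apply (Sg_iff (fun e => exists x, x = t e /\ Q e x)).
  - intro e; split; [intros [x [-> Hx]]; auto | eauto].
  - apply (Sg_ex (fun e x => x = t e /\ Q e x)), Sg_and; auto.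
Qed.

Lemma Sg_sub1 (P : N -> Prop) t :
  Fnc t -> Sg (fun e => P (e O)) -> Sg (fun e => P (t e)).
Proof. intros Ht; exact (Sg_sub (fun _ => P) t Ht). Qed.

Lemma Fnc_tl t : Fnc t -> Fnc (fun e => t (tl e)).
Proof.
  intro H; exact (Sg_ren _ (fun i => match i with O => O | S i => S (S i) end) H).
Qed.

Lemma Sg_sub2 (P : N -> N -> Prop) s t : Fnc s -> Fnc t ->
  Sg (fun e => P (e O) (e 1%nat)) -> Sg (fun e => P (s e) (t e)).
Proof.
  intros Hs Ht HP.
  apply (Sg_sub (fun e x => P x (t e)) s Hs).
  apply (Sg_sub (fun e x => P (e O) x) (fun e => t (tl e)) (Fnc_tl t Ht)).
  exact (Sg_ren _ (fun i => match i with O => 1%nat | _ => O end) HP).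
Qed.

Lemma Sg_sub5 (P : N -> N -> N -> N -> N -> Prop) a b c d g :
  Sg (fun e => P (e O) (e 1%nat) (e 2%nat) (e 3%nat) (e 4%nat)) ->
  Fnc a -> Fnc b -> Fnc c -> Fnc d -> Fnc g ->
  Sg (fun e => P (a e) (b e) (c e) (d e) (g e)).
Proof.
  intros HP Ha Hb Hc Hd Hg.
  apply (Sg_sub (fun e x => P x (b e) (c e) (d e) (g e)) a Ha).
  apply (Sg_sub (fun e x => P (e O) x (c (tl e)) (d (tl e)) (g (tl e))) (fun e => b (tl e))).
  { now apply Fnc_tl. }
  apply (Sg_sub (fun e x => P (e 1%nat) (e O) x (d (tl (tl e))) (g (tl (tl e)))) (fun e => c (tl (tl e)))).
  { apply (Fnc_tl (fun e => c (tl e))), Fnc_tl, Hc. }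
  apply (Sg_sub (fun e x => P (e 2%nat) (e 1%nat) (e O) x (g (tl (tl (tl e))))) (fun e => d (tl (tl (tl e))))).
  { apply (Fnc_tl (fun e => d (tl (tl e)))), (Fnc_tl (fun e => d (tl e))), Fnc_tl, Hd. }
  apply (Sg_sub (fun e x => P (e 3%nat) (e 2%nat) (e 1%nat) (e O) x) (fun e => g (tl (tl (tl (tl e)))))).
  { apply (Fnc_tl (fun e => g (tl (tl (tl e))))), (Fnc_tl (fun e => g (tl (tl e)))),
      (Fnc_tl (fun e => g (tl e))), Fnc_tl, Hg. }
  exact (Sg_ren _ (fun i => match i with
    O => 4 | 1 => 3 | 2 => 2 | 3 => 1 | _ => 0 end)%nat HP).
Qed.

Lemma Fnc_comp f t : computable f -> Fnc t -> Fnc (fun e => f (t e)).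
Proof.
  intros Hf Ht. apply (Sg_sub2 (fun x y => x = f y)); auto using Fnc_tl.
  apply Fnc_Tm; tm.
Qed.

Lemma Fnc_sub2 (op : N -> N -> N) s t : Tm (fun e => op (e O) (e 1%nat)) ->
  Fnc s -> Fnc t -> Fnc (fun e => op (s e) (t e)).
Proof.
  intros Hop Hs Ht.
  apply (Sg_sub (fun e x => e O = op x (t (tl e))) (fun e => s (tl e))); auto using Fnc_tl.
  apply (Sg_sub (fun e x => e 1%nat = op (e O) x) (fun e => t (tl (tl e)))).
  - exact (Fnc_tl _ (Fnc_tl _ Ht)).
  - apply Sg_Bd, Bd_eq; tm.
    exact (Tm_ren _ (fun i => match i with O => 1%nat | _ => O end) Hop).
Qed.

Lemma Fnc_add s t : Fnc s -> Fnc t -> Fnc (fun e => s e + t e).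
Proof. apply Fnc_sub2; tm. Qed.

Lemma Fnc_mul s t : Fnc s -> Fnc t -> Fnc (fun e => s e * t e).
Proof. apply Fnc_sub2; tm. Qed.

Lemma Sg_eq s t : Fnc s -> Fnc t -> Sg (fun e => s e = t e).
Proof. intros; apply (Sg_sub2 eq); auto. apply Sg_Bd, Bd_eq; tm. Qed.

Lemma Sg_neq s t : Fnc s -> Fnc t -> Sg (fun e => s e <> t e).
Proof. intros; apply (Sg_sub2 (fun x y => x <> y)); auto. apply Sg_Bd, Bd_not, Bd_eq; tm. Qed.

Lemma Sg_lt s t : Fnc s -> Fnc t -> Sg (fun e => s e < t e).
Proof. intros; apply (Sg_sub2 (mlt M)); auto. apply Sg_Bd, Bd_lt; tm. Qed.

Lemma Sg_mem t X : Fnc t -> Sg (fun e => t e \in X).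
Proof. intros; apply (Sg_sub1 (fun x => x \in X)); auto. apply Sg_Bd, Bd_mem; tm. Qed.

Lemma Sg_nmem t X : Fnc t -> Sg (fun e => ~ t e \in X).
Proof. intros; apply (Sg_sub1 (fun x => ~ x \in X)); auto. apply Sg_Bd, Bd_not, Bd_mem; tm. Qed.

Lemma Sg_ball t (Q : env -> N -> Prop) : Fnc t ->
  Sg (fun e => Q (tl e) (e O)) -> Sg (fun e => forall y, y < t e -> Q e y).
Proof.
  intros Ht HQ. apply (Sg_sub (fun e b => forall y, y < b -> Q e y) t Ht).
  apply (Sg_all (fun e => e O) (fun e y => Q (tl e) y)); [tm|].
  exact (Sg_ren _ (fun i => match i with O => O | S i => S (S i) end) HQ).
Qed.

Lemma least P n : Bd (fun e => P (e O)) -> P n -> exists m, P m /\ forall k, k < m -> ~ P k.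
Proof.
  intros B Hn. apply NNPP; intro K.
  assert (A : forall n m, m < n -> ~ P m).
  { apply (ind_Bd (fun n => forall m, m < n -> ~ P m)).
    - apply (Bd_all (fun e => e O) (fun e m => ~ P m)); [tm|]. now apply Bd_not.
    - intros m Hm; now apply nlt_0_r in Hm.
    - intros k Hk m Hm; apply lt_succ_r in Hm as [Hm| ->]; auto.
      intro Pk; apply K; eauto. }
  apply (A (n + 1) n); auto. apply lt_succ_r; auto.
Qed.

Definition pair (i j : N) : N := (i + j) * (i + j) + i.

Lemma lt_le_pair_1 i j : i < pair i j + 1.
Proof. apply lt_add_l. Qed.

Lemma lt_le_pair_2 i j : j < pair i j + 1.
Proof.
  unfold pair. destruct (zero_or_succ (i + j)) as [E|[k E]].
  - rewrite E. rewrite add_comm in E; apply add_eq_0 in E as ->.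
    replace (0 * 0 + i + 1) with (0 + i + 1) by ring. apply lt_add_r.
  - apply lt_iff; exists (k * (i + j) + i + i). rewrite E at 1. ring.
Qed.

(** With [s = i + j] the code is s^2 + i, which lies below (s + 1)^2 because i <= s. Codes with
    different sums thus lie in disjoint ranges. *)
Lemma pair_lt i j i' j' : i + j < i' + j' -> pair i j < pair i' j'.
Proof.
  rewrite !lt_iff; intros [k E]. unfold pair; rewrite E.
  exists (j + (i + j) + (1 + 1) * (i + j) * k + k * k + (1 + 1) * k + i'); ring.
Qed.

Lemma pair_inj i j i' j' : pair i j = pair i' j' -> i = i' /\ j = j'.
Proof.
  intro E. destruct (lt_total (i + j) (i' + j')) as [L|[L|L]].
  - apply pair_lt in L; rewrite E in L; now apply lt_irrefl in L.
  - unfold pair in E; rewrite L, !(add_comm _ i), !(add_comm _ i') in E.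
    assert (i = i') as <-.
    { rewrite (add_comm i), (add_comm i') in E. rewrite (add_comm _ i), (add_comm _ i') in E.
      now apply add_cancel_r in E. }
    split; auto. rewrite !(add_comm i) in L. now apply add_cancel_r in L.
  - apply pair_lt in L; rewrite E in L; now apply lt_irrefl in L.
Qed.

Lemma Fnc_pair s t : Fnc s -> Fnc t -> Fnc (fun e => pair (s e) (t e)).
Proof. apply Fnc_sub2; unfold pair; tm. Qed.

(** Sigma^0_1 uniformization: [f k] is the first component of the least [pair w x] such that [x]
    witnesses [R k w]. Minimality is a bounded condition, so the graph of [f] stays Sigma^0_1. *)
Lemma choice (R : N -> N -> Prop) : Sg (fun e => R (e O) (e 1%nat)) ->
  (forall k, exists w, R k w) -> exists f, computable f /\ forall k, R k (f k).
Proof.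
  intros [B [HB HR]] H.
  pose (B' k w x := B (fun i => match i with O => k | S O => w | _ => 0 end) x).
  assert (HB' : Bd (fun e => B' (e 1%nat) (e 2%nat) (e O))).
  { apply (Bd_iff (fun e => (fun e => B (tl e) (e O)) (fun i => teval M (mix e (fun _ => 0))
      (match i with O => Var 0 | S O => Var 2 | S (S O) => Var 4 | _ => Zero end)))).
    - intro e; unfold B'; cbv beta. unfold tl at 1; cbn [teval].
      match goal with |- B ?a _ <-> B ?b _ => replace a with b; [reflexivity|] end.
      apply functional_extensionality; intros [|[|i]]; reflexivity.
    - exact (Bd_tsub _ _ _ HB). }
  assert (HR' : forall k w, R k w <-> exists x, B' k w x)
    by (intros k w; exact (HR (fun i => match i with O => k | S O => w | _ => 0 end))).
  pose (G k u := exists w, w < u + 1 /\ exists x, x < u + 1 /\ u = pair w x /\ B' k w x).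
  assert (HG : Bd (fun e => G (e 1%nat) (e O))).
  { apply (Bd_ex (fun e => e O + 1)
      (fun e w => exists x, x < e O + 1 /\ e O = pair w x /\ B' (e 1%nat) w x)); [tm|].
    apply (Bd_ex (fun e => e 1%nat + 1) (fun e x => e 1%nat = pair (e O) x /\ B' (e 2%nat) (e O) x)); [tm|].
    apply Bd_and.
    - apply Bd_eq; unfold pair; tm.
    - exact (Bd_ren _ (fun i => match i with O => O | S O => 3%nat | _ => 1%nat end) HB'). }
  assert (GE : forall k u, G k u <-> exists w x, u = pair w x /\ B' k w x).
  { intros k u; split; [intros [w [_ [x [_ Hx]]]]; eauto|].
    intros [w [x [-> Hx]]]; exists w; split; [apply lt_le_pair_1|].
    exists x; split; [apply lt_le_pair_2 | auto]. }
  pose (Min k w := exists x, B' k w x /\ forall u, u < pair w x -> ~ G k u).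
  assert (MinE : forall k, exists w, Min k w).
  { intro k. destruct (H k) as [w Hw]; apply HR' in Hw as [x Hx].
    destruct (least (G k) (pair w x)) as [u [Hu Hmin]].
    - apply (Bd_iff (fun e => (fun e => G (e 1%nat) (e O)) (fun i => teval M (mix e (fun _ => k))
        (match i with O => Var 0 | _ => Var 1 end)))); [reflexivity|].
      exact (Bd_tsub _ _ _ HG).
    - apply GE; eauto.
    - apply GE in Hu as [w' [x' [-> Hx']]]. exists w', x'; auto. }
  assert (MinU : forall k w w', Min k w -> Min k w' -> w = w').
  { intros k w w' [x [Hx Hm]] [x' [Hx' Hm']].
    destruct (lt_total (pair w x) (pair w' x')) as [L|[L|L]].
    - exfalso; apply (Hm' _ L), GE; eauto.
    - apply pair_inj in L; tauto.
    - exfalso; apply (Hm _ L), GE; eauto. }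
  assert (MinS : Sg (fun e => Min (e 1%nat) (e O))).
  { apply (Sg_ex (fun e x => B' (e 1%nat) (e O) x /\ forall u, u < pair (e O) x -> ~ G (e 1%nat) u)).
    apply Sg_Bd, Bd_and.
    - exact (Bd_ren _ (fun i => match i with O => O | S O => 2%nat | _ => 1%nat end) HB').
    - apply (Bd_all (fun e => pair (e 1%nat) (e O)) (fun e u => ~ G (e 2%nat) u)); [unfold pair; tm|].
      apply Bd_not. exact (Bd_ren _ (fun i => match i with O => O | _ => 3%nat end) HG). }
  pose (f k := proj1_sig (constructive_indefinite_description _ (MinE k))).
  assert (Hf : forall k, Min k (f k)) by (intro k; apply proj2_sig).
  exists f; split.
  - unfold computable. apply (Sg_iff (fun e => Min (e 1%nat) (e O))); auto.
    intro e; split; [intro K; eapply MinU; eauto | intros ->; auto].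
  - intro k; apply HR'. destruct (Hf k) as [x [Hx _]]; eauto.
Qed.

Lemma unpairing : exists p1 p2, computable p1 /\ computable p2 /\
  forall i j, p1 (pair i j) = i /\ p2 (pair i j) = j.
Proof.
  assert (C : forall Q : N -> N -> N -> Prop, Bd (fun e => Q (e O) (e 1%nat) (e 2%nat)) ->
    (forall i j i' j', pair i j = pair i' j' -> forall w, Q i j w -> Q i' j' w) ->
    (forall i j, exists w, Q i j w) ->
    exists p, computable p /\ forall i j, Q i j (p (pair i j))).
  { intros Q HQ HP HE.
    (* The pairing is not onto. The second disjunct makes the relation total by admitting any value
       at a number that is no pair; its bounds make it Sigma^0_0. *)
    destruct (choice (fun t w => (exists i j, t = pair i j /\ Q i j w) \/
       forall i, i < t + 1 -> forall j, j < t + 1 -> t <> pair i j)) as [p [Hp Kp]].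
    - apply Sg_or.
      + apply (Sg_ex (fun e i => exists j, e O = pair i j /\ Q i j (e 1%nat))).
        apply (Sg_ex (fun e j => e 1%nat = pair (e O) j /\ Q (e O) j (e 2%nat))).
        apply Sg_Bd, Bd_and; [apply Bd_eq; unfold pair; tm|].
        exact (Bd_ren _ (fun i => match i with O => 1%nat | S O => O | _ => 3%nat end) HQ).
      + apply (Sg_all (fun e => e O + 1) (fun e i => forall j, j < e O + 1 -> e O <> pair i j)); [tm|].
        apply (Sg_all (fun e => e 1%nat + 1) (fun e j => e 1%nat <> pair (e O) j)); [tm|].
        apply Sg_Bd, Bd_not, Bd_eq; unfold pair; tm.
    - intro t. destruct (classic (exists i j, t = pair i j)) as [[i [j ->]]|E].
      + destruct (HE i j) as [w Hw]. exists w; left; eauto.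
      + exists 0; right; intros i _ j _ ->; apply E; eauto.
    - exists p; split; auto. intros i j.
      destruct (Kp (pair i j)) as [[i' [j' [E Hq]]]|E].
      + eapply HP; [symmetry; exact E | exact Hq].
      + exfalso; exact (E i (lt_le_pair_1 i j) j (lt_le_pair_2 i j) eq_refl). }
  destruct (C (fun i j w => w = i)) as [p1 [H1 E1]].
  - apply Bd_eq; tm.
  - intros i j i' j' E w ->; apply pair_inj in E; tauto.
  - intros i _; now exists i.
  - destruct (C (fun i j w => w = j)) as [p2 [H2 E2]].
    + apply Bd_eq; tm.
    + intros i j i' j' E w ->; apply pair_inj in E; tauto.
    + intros _ j; now exists j.
    + exists p1, p2; auto.
Qed.

(** Argument [pair w x] yields [w] if [x] witnesses [P w]; all other arguments yield the default
    [w0]. *)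
Lemma enumeration (P : N -> Prop) w0 : Sg (fun e => P (e O)) -> P w0 ->
  exists f, computable f /\ (forall k, P (f k)) /\ (forall w, P w -> exists k, f k = w).
Proof.
  intros [B [HB HP]] P0.
  pose (B' w x := B (fun i => match i with O => w | _ => 0 end) x).
  assert (HB' : Bd (fun e => B' (e 1%nat) (e O))).
  { apply (Bd_iff (fun e => (fun e => B (tl e) (e O)) (fun i => teval M (mix e (fun _ => 0))
      (match i with O => Var 0 | S O => Var 2 | _ => Zero end)))).
    - intro e; unfold B'; cbv beta. unfold tl at 1; cbn [teval].
      match goal with |- B ?a _ <-> B ?b _ => replace a with b; [reflexivity|] end.
      apply functional_extensionality; intros [|i]; reflexivity.
    - exact (Bd_tsub _ _ _ HB). }
  assert (HP' : forall w, P w <-> exists x, B' w x)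
    by (intro w; exact (HP (fun i => match i with O => w | _ => 0 end))).
  pose (G k w := exists x, x < k + 1 /\ k = pair w x /\ B' w x).
  assert (HG : Bd (fun e => G (e O) (e 1%nat))).
  { apply (Bd_ex (fun e => e O + 1) (fun e x => e O = pair (e 1%nat) x /\ B' (e 1%nat) x)); [tm|].
    apply Bd_and; [apply Bd_eq; unfold pair; tm|].
    exact (Bd_ren _ (fun i => match i with O => O | _ => 2%nat end) HB'). }
  destruct (choice (fun k w => G k w \/ (w = w0 /\ forall v, v < k + 1 -> ~ G k v))) as [f [Hf Kf]].
  - apply Sg_Bd, Bd_or; [exact HG|]. apply Bd_and; [apply Bd_eq; tm|].
    apply (Bd_all (fun e => e O + 1) (fun e v => ~ G (e O) v)); [tm|].
    apply Bd_not. exact (Bd_ren _ (fun i => match i with O => 1%nat | _ => O end) HG).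
  - intro k. destruct (classic (exists w, G k w)) as [[w Hw]|N]; [exists w; auto|].
    exists w0; right; split; auto. intros v _ Hv; apply N; eauto.
  - exists f; split; [exact Hf|split].
    + intro k; destruct (Kf k) as [[x [_ [_ Hx]]]|[-> _]]; [apply HP'; eauto | exact P0].
    + intros w Hw; apply HP' in Hw as [x Hx]. exists (pair w x).
      destruct (Kf (pair w x)) as [[y [_ [E _]]]|[_ K]].
      * apply pair_inj in E as [E _]; now symmetry.
      * exfalso; apply (K w (lt_le_pair_1 w x)). exists x; auto using lt_le_pair_2.
Qed.

Lemma bounded_image f K : computable f -> exists L, forall m, m < K -> f m < L.
Proof.
  intro Hf. apply (ind_Sg (fun K => exists L, forall m, m < K -> f m < L)).
  - apply (Sg_ex (fun e L => forall m, m < e O -> f m < L)).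
    apply (Sg_all (fun e => e 1%nat) (fun e m => f m < e O)); [tm|].
    apply Sg_lt; [apply Fnc_comp; auto|]; apply Fnc_Tm; tm.
  - exists 0; intros m Hm; now apply nlt_0_r in Hm.
  - intros n [L HL]. exists (L + f n + 1). intros m Hm; apply lt_succ_r in Hm as [Hm| ->].
    + eapply lt_trans; [apply HL, Hm | apply lt_add_r].
    + apply lt_add_l.
Qed.

End Model.
End Definability.

(** * The ordered field of fractions of the numbers of a model *)

Module Fractions.
Import Ring.

(** The order is expressed through addition, so that [ring] can treat all side conditions as
    equations. *)
Record arith : Type := Arith {
  arith_sort :> Type;
  azero : arith_sort; aone : arith_sort;
  aadd : arith_sort -> arith_sort -> arith_sort;
  amul : arith_sort -> arith_sort -> arith_sort;
  arith_semiring : semi_ring_theory azero aone aadd amul eq;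
  aadd_cancel : forall x y z, aadd x z = aadd y z -> x = y;
  aadd_eq0 : forall x y, aadd x y = azero -> x = azero;
  aone_neq0 : aone <> azero;
  azero_or_succ : forall x, x = azero \/ exists y, x = aadd y aone;
  ale_total : forall x y, (exists k, y = aadd x k) \/ (exists k, x = aadd y k) }.

Section Triples.

Variable K : arith.
Local Notation "0" := (azero K).
Local Notation "1" := (aone K).
Local Infix "+" := (aadd K).
Local Infix "*" := (amul K).

Add Ring arith_ring : (arith_semiring K).

Lemma amul_cancel x y d : x * (d + 1) = y * (d + 1) -> x = y.
Proof.
  assert (W : forall x k, x * (d + 1) = (x + k) * (d + 1) -> k = 0).
  { intros a k H.
    assert (E : k * (d + 1) = 0).
    { apply (aadd_cancel K _ _ (a * (d + 1))). rewrite H at 2; ring. }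
    apply (aadd_eq0 K k (k * d)). rewrite <- E; ring. }
  intro H. destruct (ale_total K x y) as [[k ->]|[k ->]].
  - apply W in H as ->; ring.
  - symmetry in H; apply W in H as ->; ring.
Qed.

(* [(a, b, d)] stands for [(a - b) / (d + 1)]. *)
Definition triple : Type := (K * K * K)%type.

Definition eqv (x y : triple) : Prop :=
  let '(a, b, d) := x in let '(a', b', d') := y in
  a * (d' + 1) + b' * (d + 1) = a' * (d + 1) + b * (d' + 1).

Lemma eqv_refl x : eqv x x.
Proof. destruct x as [[a b] d]; simpl; ring. Qed.

Lemma eqv_sym x y : eqv x y -> eqv y x.
Proof.
  destruct x as [[a b] d], y as [[a' b'] d']; simpl; intro H; symmetry; exact H.
Qed.

Lemma eqv_trans x y z : eqv x y -> eqv y z -> eqv x z.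
Proof.
  destruct x as [[a b] d], y as [[a' b'] d'], z as [[a'' b''] d'']; simpl; intros H H'.
  apply (amul_cancel _ _ d').
  apply (aadd_cancel K _ _ ((b' * (d + 1)) * (d'' + 1) + (a' * (d + 1)) * (d'' + 1))).
  transitivity ((a * (d' + 1) + b' * (d + 1)) * (d'' + 1)
    + (d + 1) * (a' * (d'' + 1) + b'' * (d' + 1))); [ring|].
  rewrite H, H'; ring.
Qed.

Definition tadd (x y : triple) : triple :=
  let '(a, b, d) := x in let '(a', b', d') := y in
  (a * (d' + 1) + a' * (d + 1), b * (d' + 1) + b' * (d + 1), d * d' + d + d').
Definition tmul (x y : triple) : triple :=
  let '(a, b, d) := x in let '(a', b', d') := y in
  (a * a' + b * b', a * b' + b * a', d * d' + d + d').
Definition topp (x : triple) : triple := let '(a, b, d) := x in (b, a, d).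

Lemma tadd_eqv x x' y : eqv x x' -> eqv (tadd x y) (tadd x' y).
Proof.
  destruct x as [[a b] d], x' as [[a' b'] d'], y as [[c e] f]; simpl; intro H.
  transitivity ((a * (d' + 1) + b' * (d + 1)) * (f + 1) * (f + 1)
    + (c * (d + 1) * (d' + 1) + e * (d + 1) * (d' + 1)) * (f + 1)); [ring|].
  rewrite H; ring.
Qed.

Lemma tmul_eqv x x' y : eqv x x' -> eqv (tmul x y) (tmul x' y).
Proof.
  destruct x as [[a b] d], x' as [[a' b'] d'], y as [[c e] f]; simpl; intro H.
  transitivity ((f + 1) * (c * (a * (d' + 1) + b' * (d + 1)) + e * (a' * (d + 1) + b * (d' + 1)))); [ring|].
  transitivity ((f + 1) * (c * (a' * (d + 1) + b * (d' + 1)) + e * (a * (d' + 1) + b' * (d + 1)))); [|ring].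
  now rewrite H.
Qed.

Lemma topp_eqv x x' : eqv x x' -> eqv (topp x) (topp x').
Proof.
  destruct x as [[a b] d], x' as [[a' b'] d']; simpl; intro H.
  transitivity (a' * (d + 1) + b * (d' + 1)); [ring|]. rewrite <- H; ring.
Qed.

Lemma tadd_comm x y : eqv (tadd x y) (tadd y x).
Proof. destruct x as [[a b] d], y as [[a' b'] d']; simpl; ring. Qed.
Lemma tadd_assoc x y z : eqv (tadd x (tadd y z)) (tadd (tadd x y) z).
Proof. destruct x as [[a b] d], y as [[a' b'] d'], z as [[a'' b''] d'']; simpl; ring. Qed.
Lemma tadd_0_l x : eqv (tadd (0, 0, 0) x) x.
Proof. destruct x as [[a b] d]; simpl; ring. Qed.
Lemma tadd_opp x : eqv (tadd (topp x) x) (0, 0, 0).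
Proof. destruct x as [[a b] d]; simpl; ring. Qed.
Lemma tmul_comm x y : eqv (tmul x y) (tmul y x).
Proof. destruct x as [[a b] d], y as [[a' b'] d']; simpl; ring. Qed.
Lemma tmul_assoc x y z : eqv (tmul x (tmul y z)) (tmul (tmul x y) z).
Proof. destruct x as [[a b] d], y as [[a' b'] d'], z as [[a'' b''] d'']; simpl; ring. Qed.
Lemma tmul_0_r x : eqv (tmul x (0, 0, 0)) (0, 0, 0).
Proof. destruct x as [[a b] d]; simpl; ring. Qed.
Lemma tmul_1_l x : eqv (tmul (1, 0, 0) x) x.
Proof. destruct x as [[a b] d]; simpl; ring. Qed.
Lemma tmul_add_l x y z : eqv (tmul (tadd x y) z) (tadd (tmul x z) (tmul y z)).
Proof. destruct x as [[a b] d], y as [[a' b'] d'], z as [[a'' b''] d'']; simpl; ring. Qed.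
Lemma t1_neq0 : ~ eqv (1, 0, 0) (0, 0, 0).
Proof.
  simpl; intro H; apply (aone_neq0 K).
  transitivity (1 * (0 + 1) + 0 * (0 + 1)); [ring|]. rewrite H; ring.
Qed.

Definition tge0 (x : triple) : Prop := let '(a, b, d) := x in exists k, a = b + k.

Lemma tge0_eqv x x' : eqv x x' -> tge0 x -> tge0 x'.
Proof.
  destruct x as [[a b] d], x' as [[a' b'] d']; simpl; intros H [k ->].
  destruct (ale_total K b' a') as [[l ->]|[l ->]]; [eauto|].
  (* Here [x] is k / (d + 1) and [x'] is - l / (d' + 1); being equal they both vanish. *)
  exists 0.
  assert (E : k * (d' + 1) + l * (d + 1) = 0).
  { apply (aadd_cancel K _ _ (b * (d' + 1) + a' * (d + 1))).
    transitivity ((b + k) * (d' + 1) + (a' + l) * (d + 1)); [ring|]. rewrite H; ring. }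
  assert (l = 0) as ->; [|ring].
  apply (aadd_eq0 K l (l * d + k * (d' + 1))). rewrite <- E; ring.
Qed.

Lemma tge0_add x y : tge0 x -> tge0 y -> tge0 (tadd x y).
Proof.
  destruct x as [[a b] d], y as [[a' b'] d']; simpl; intros [k ->] [l ->].
  exists (k * (d' + 1) + l * (d + 1)); ring.
Qed.

Lemma tge0_mul x y : tge0 x -> tge0 y -> tge0 (tmul x y).
Proof.
  destruct x as [[a b] d], y as [[a' b'] d']; simpl; intros [k ->] [l ->].
  exists (k * l); ring.
Qed.

Lemma tge0_anti x : tge0 x -> tge0 (topp x) -> eqv x (0, 0, 0).
Proof.
  destruct x as [[a b] d]; simpl; intros [k ->] [l H].
  assert (k = 0) as ->; [|ring].
  apply (aadd_eq0 K k l), (aadd_cancel K _ _ b). transitivity (b + k + l); [ring|].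
  rewrite <- H; ring.
Qed.

Lemma tge0_total x : tge0 x \/ tge0 (topp x).
Proof. destruct x as [[a b] d]; simpl; destruct (ale_total K a b); auto. Qed.

Lemma tinv_ge0 x : tge0 x -> ~ eqv x (0, 0, 0) -> exists y, eqv (tmul y x) (1, 0, 0).
Proof.
  destruct x as [[a b] d]; intros [k ->] H.
  destruct (azero_or_succ K k) as [->|[l ->]].
  - exfalso; apply H; simpl; ring.
  (* Now [x] equals (l + 1) / (d + 1). *)
  - exists (d + 1, 0, l); simpl; ring.
Qed.

Lemma tinv x : ~ eqv x (0, 0, 0) -> exists y, eqv (tmul y x) (1, 0, 0).
Proof.
  intro H; destruct (tge0_total x) as [G|G]; [now apply tinv_ge0|].
  destruct (tinv_ge0 _ G) as [y Hy].
  - intro E; apply H. destruct x as [[a b] d]; simpl in *.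
    transitivity (a * (0 + 1) + 0 * (d + 1)); [ring|].
    transitivity (0 * (d + 1) + a * (0 + 1)); [ring|]. rewrite <- E; ring.
  - exists (topp y). eapply eqv_trans; [|exact Hy].
    destruct x as [[a b] d], y as [[a' b'] d']; simpl; ring.
Qed.

Lemma tadd_inj m n : eqv (m + n, 0, 0) (tadd (m, 0, 0) (n, 0, 0)).
Proof. simpl; ring. Qed.
Lemma tmul_inj m n : eqv (m * n, 0, 0) (tmul (m, 0, 0) (n, 0, 0)).
Proof. simpl; ring. Qed.
Lemma tge0_inj n : tge0 (n, 0, 0).
Proof. exists n; ring. Qed.
Lemma teqv_inj m n : eqv (m, 0, 0) (n, 0, 0) -> m = n.
Proof.
  simpl; intro H. transitivity (m * (0 + 1) + 0 * (0 + 1)); [ring|]. rewrite H; ring.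
Qed.

Lemma tge0_sub a b d : tge0 (tadd (a, 0, 0) (topp (a, b, d))).
Proof. simpl; exists (a * d + b); ring. Qed.

End Triples.

Import ClassicalEpsilon FunctionalExtensionality PropExtensionality ProofIrrelevance.

Section Quotient.

Variable K : arith.

Definition canonical (x : triple K) : triple K :=
  epsilon (inhabits (azero K, azero K, azero K)) (eqv K x).

Lemma canonical_eqv x : eqv K x (canonical x).
Proof. unfold canonical; apply epsilon_spec; exists x; apply eqv_refl. Qed.

Lemma canonical_eq x y : canonical x = canonical y <-> eqv K x y.
Proof.
  split; intro H.
  - eapply eqv_trans; [apply canonical_eqv|]. rewrite H; apply eqv_sym, canonical_eqv.
  - unfold canonical; f_equal; apply functional_extensionality; intro z.
    apply propositional_extensionality; split; intro; eapply eqv_trans; eauto using eqv_sym.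
Qed.

Definition frac : Type := {x : triple K | canonical x = x}.

Definition mk (x : triple K) : frac :=
  exist _ (canonical x) (eq_sym (proj2 (canonical_eq _ _) (canonical_eqv x))).

Lemma frac_eq (x y : frac) : proj1_sig x = proj1_sig y -> x = y.
Proof.
  destruct x as [x Hx], y as [y Hy]; simpl; intro E; subst y. f_equal; apply proof_irrelevance.
Qed.

Lemma mk_eq x y : mk x = mk y <-> eqv K x y.
Proof.
  rewrite <- canonical_eq; split; [intro H; exact (f_equal (@proj1_sig _ _) H)|].
  intro H; now apply frac_eq.
Qed.

Lemma mk_surj (x : frac) : mk (proj1_sig x) = x.
Proof. apply frac_eq; exact (proj2_sig x). Qed.

Lemma eqv_repr x : eqv K (proj1_sig (mk x)) x.
Proof. apply eqv_sym, canonical_eqv. Qed.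

Definition frac_add (x y : frac) : frac := mk (tadd K (proj1_sig x) (proj1_sig y)).
Definition frac_mul (x y : frac) : frac := mk (tmul K (proj1_sig x) (proj1_sig y)).
Definition frac_opp (x : frac) : frac := mk (topp K (proj1_sig x)).
Definition frac_zero : frac := mk (azero K, azero K, azero K).
Definition frac_one : frac := mk (aone K, azero K, azero K).
(** The field interface wants a total inverse with value 0 at 0, which the second disjunct fixes. *)
Definition frac_inv (x : frac) : frac :=
  epsilon (inhabits frac_zero) (fun y => frac_mul y x = frac_one \/ x = frac_zero /\ y = frac_zero).
Definition frac_ge0 (x : frac) : Prop := tge0 K (proj1_sig x).

Lemma frac_add_mk x y : frac_add (mk x) (mk y) = mk (tadd K x y).
Proof.
  apply mk_eq. eapply eqv_trans; [apply tadd_eqv, eqv_repr|].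
  eapply eqv_trans; [apply tadd_comm|]. eapply eqv_trans; [apply tadd_eqv, eqv_repr|].
  apply tadd_comm.
Qed.

Lemma frac_mul_mk x y : frac_mul (mk x) (mk y) = mk (tmul K x y).
Proof.
  apply mk_eq. eapply eqv_trans; [apply tmul_eqv, eqv_repr|].
  eapply eqv_trans; [apply tmul_comm|]. eapply eqv_trans; [apply tmul_eqv, eqv_repr|].
  apply tmul_comm.
Qed.

Lemma frac_opp_mk x : frac_opp (mk x) = mk (topp K x).
Proof. apply mk_eq, topp_eqv, eqv_repr. Qed.

Lemma frac_ge0_mk x : frac_ge0 (mk x) <-> tge0 K x.
Proof. split; apply tge0_eqv; [apply eqv_repr | apply eqv_sym, eqv_repr]. Qed.

Local Ltac lift :=
  intros;
  repeat match goal with x : frac |- _ =>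
    rewrite <- (mk_surj x); generalize (proj1_sig x); clear x; intro x end;
  unfold frac_zero, frac_one; rewrite ?frac_opp_mk, ?frac_add_mk, ?frac_mul_mk, ?frac_add_mk; apply mk_eq.

Lemma frac_add_assoc x y z : frac_add x (frac_add y z) = frac_add (frac_add x y) z.
Proof. lift; apply tadd_assoc. Qed.
Lemma frac_add_comm x y : frac_add x y = frac_add y x.
Proof. lift; apply tadd_comm. Qed.
Lemma frac_add_0_l x : frac_add frac_zero x = x.
Proof. lift; apply tadd_0_l. Qed.
Lemma frac_add_opp x : frac_add (frac_opp x) x = frac_zero.
Proof. lift; apply tadd_opp. Qed.
Lemma frac_mul_assoc x y z : frac_mul x (frac_mul y z) = frac_mul (frac_mul x y) z.
Proof. lift; apply tmul_assoc. Qed.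
Lemma frac_mul_comm x y : frac_mul x y = frac_mul y x.
Proof. lift; apply tmul_comm. Qed.
Lemma frac_mul_1_l x : frac_mul frac_one x = x.
Proof. lift; apply tmul_1_l. Qed.
Lemma frac_mul_add_l x y z : frac_mul (frac_add x y) z = frac_add (frac_mul x z) (frac_mul y z).
Proof. lift; apply tmul_add_l. Qed.
Lemma frac_one_neq0 : frac_one <> frac_zero.
Proof. intro H; apply mk_eq in H; exact (t1_neq0 K H). Qed.

Lemma frac_inv_spec x : x <> frac_zero -> frac_mul (frac_inv x) x = frac_one.
Proof.
  intro H. assert (E : exists y, frac_mul y x = frac_one \/ x = frac_zero /\ y = frac_zero).
  { rewrite <- (mk_surj x) in H |- *. destruct (tinv K (proj1_sig x)) as [y Hy].
    - intro E; apply H, mk_eq, E.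
    - exists (mk y); left. rewrite frac_mul_mk; apply mk_eq, Hy. }
  apply (epsilon_spec (inhabits frac_zero)) in E as [E|[E _]]; [exact E | contradiction].
Qed.

Lemma frac_inv_0 : frac_inv frac_zero = frac_zero.
Proof.
  assert (E : exists y, frac_mul y frac_zero = frac_one \/ frac_zero = frac_zero /\ y = frac_zero) by eauto.
  apply (epsilon_spec (inhabits frac_zero)) in E as [E|[_ E]]; [|exact E].
  exfalso; apply frac_one_neq0. rewrite <- E.
  match goal with |- context [epsilon ?i ?P] => generalize (epsilon i P) end.
  intro x; lift; apply tmul_0_r.
Qed.

Lemma frac_ge0_add x y : frac_ge0 x -> frac_ge0 y -> frac_ge0 (frac_add x y).
Proof. intros Hx Hy; apply frac_ge0_mk, tge0_add; auto. Qed.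
Lemma frac_ge0_mul x y : frac_ge0 x -> frac_ge0 y -> frac_ge0 (frac_mul x y).
Proof. intros Hx Hy; apply frac_ge0_mk, tge0_mul; auto. Qed.
Lemma frac_ge0_anti x : frac_ge0 x -> frac_ge0 (frac_opp x) -> x = frac_zero.
Proof.
  rewrite <- (mk_surj x), frac_opp_mk, !frac_ge0_mk; intros; apply mk_eq; now apply tge0_anti.
Qed.
Lemma frac_ge0_total x : frac_ge0 x \/ frac_ge0 (frac_opp x).
Proof. rewrite <- (mk_surj x), frac_opp_mk, !frac_ge0_mk; apply tge0_total. Qed.

End Quotient.

Import structures all_boot order ssralg ssrnum boolp.
Import Order.TTheory GRing.Theory Num.Theory.

Section Field.

Variable K : arith.

HB.instance Definition _ := gen_eqMixin (frac K).
HB.instance Definition _ := gen_choiceMixin (frac K).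
HB.instance Definition _ := GRing.isZmodule.Build (frac K)
  (frac_add_assoc K) (frac_add_comm K) (frac_add_0_l K) (frac_add_opp K).

Fact frac_one_neq0b : frac_one K != frac_zero K.
Proof. by apply/eqP/frac_one_neq0. Qed.

HB.instance Definition _ := GRing.Zmodule_isComNzRing.Build (frac K)
  (frac_mul_assoc K) (frac_mul_comm K) (frac_mul_1_l K) (frac_mul_add_l K) frac_one_neq0b.

Fact frac_inv_mul (x : frac K) : x != 0%R -> (frac_inv K x * x = 1)%R.
Proof. by move/eqP; apply: frac_inv_spec. Qed.

HB.instance Definition _ := GRing.ComNzRing_isField.Build (frac K) frac_inv_mul (frac_inv_0 K).

Definition frac_le (x y : frac K) : bool := `[< frac_ge0 K (y - x)%R >].
Definition frac_lt (x y : frac K) : bool := (y != x) && frac_le x y.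
Definition frac_norm (x : frac K) : frac K := if frac_le 0%R x then x else (- x)%R.

Fact frac_le0 (x : frac K) : frac_le 0%R x = `[< frac_ge0 K x >].
Proof. by rewrite /frac_le subr0. Qed.

Fact frac_le0_add (x y : frac K) : frac_le 0%R x -> frac_le 0%R y -> frac_le 0%R (x + y)%R.
Proof. rewrite !frac_le0 => /asboolP hx /asboolP hy; apply/asboolP; exact: frac_ge0_add. Qed.

Fact frac_le0_mul (x y : frac K) : frac_le 0%R x -> frac_le 0%R y -> frac_le 0%R (x * y)%R.
Proof. rewrite !frac_le0 => /asboolP hx /asboolP hy; apply/asboolP; exact: frac_ge0_mul. Qed.

Fact frac_le0_anti (x : frac K) : frac_le 0%R x -> frac_le x 0%R -> x = 0%R.
Proof.
rewrite frac_le0 /frac_le sub0r => /asboolP hx /asboolP hy; exact: frac_ge0_anti.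
Qed.

Fact frac_sub_ge0 (x y : frac K) : frac_le 0%R (y - x)%R = frac_le x y.
Proof. by rewrite frac_le0. Qed.

Fact frac_le0_total (x : frac K) : frac_le 0%R x || frac_le x 0%R.
Proof.
rewrite frac_le0 /frac_le sub0r; case: (frac_ge0_total K x) => h; apply/orP; [left|right]; exact/asboolP.
Qed.

Fact frac_normN (x : frac K) : frac_norm (- x)%R = frac_norm x.
Proof.
rewrite /frac_norm opprK; case: ifP => h1; case: ifP => h2 //.
- have h : frac_le x 0%R by rewrite /frac_le sub0r -frac_le0.
  by rewrite (frac_le0_anti _ h2 h) oppr0.
- by move: (frac_le0_total x); rewrite h2 /frac_le sub0r -frac_le0 h1.
Qed.

Fact frac_ge0_norm (x : frac K) : frac_le 0%R x -> frac_norm x = x.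
Proof. by rewrite /frac_norm => ->. Qed.

Fact frac_lt_def (x y : frac K) : frac_lt x y = (y != x) && frac_le x y.
Proof. by []. Qed.

HB.instance Definition _ := Num.IntegralDomain_isLeReal.Build (frac K)
  frac_le0_add frac_le0_mul frac_le0_anti frac_sub_ge0 frac_le0_total frac_normN frac_ge0_norm frac_lt_def.

Definition fracF : realFieldType := frac K.

Definition inj (n : K) : fracF := mk K (n, azero K, azero K).

Lemma inj0 : inj (azero K) = 0%R.
Proof. by []. Qed.

Lemma inj1 : inj (aone K) = 1%R.
Proof. by []. Qed.

Lemma injD (m n : K) : inj (aadd K m n) = (inj m + inj n)%R.
Proof. by rewrite [RHS]frac_add_mk; apply/mk_eq; exact: tadd_inj. Qed.

Lemma injM (m n : K) : inj (amul K m n) = (inj m * inj n)%R.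
Proof. by rewrite [RHS]frac_mul_mk; apply/mk_eq; exact: tmul_inj. Qed.

Lemma inj_ge0 (n : K) : (0 <= inj n)%R.
Proof. by rewrite /Order.le /= frac_le0; apply/asboolP/frac_ge0_mk; exact: tge0_inj. Qed.

Lemma inj_inj (m n : K) : inj m = inj n -> m = n.
Proof. by move/mk_eq/teqv_inj. Qed.

Lemma inj_leP (m n : K) : reflect (exists k, n = aadd K m k) (inj m <= inj n)%R.
Proof.
apply: (iffP idP) => [h|[k ->]]; last by rewrite injD lerDl inj_ge0.
have [//|[k e]] := ale_total K m n.
exists (azero K); apply: inj_inj; apply/eqP; rewrite injD inj0 addr0 eq_le h.
by rewrite e injD lerDl inj_ge0.
Qed.

Lemma inj_ltP (m n : K) : reflect (exists k, n = aadd K (aadd K m k) (aone K)) (inj m < inj n)%R.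
Proof.
apply: (iffP idP) => [h|[k ->]].
- have /inj_leP [k e] := ltW h; case: (azero_or_succ K k) => [e0|[l el]].
    by move: h; rewrite e e0 injD inj0 addr0 ltxx.
  by exists l; rewrite e el; exact: (SRadd_assoc (arith_semiring K)).
- by rewrite !injD inj1 -addrA ltrDl ltr_wpDl ?inj_ge0 ?ltr01.
Qed.

(** The field is Archimedean relative to the numbers of the model, which may be nonstandard: (a - b)
    / (d + 1) <= a < a + 1. *)
Lemma inj_bound (x : fracF) : exists n, (x < inj n)%R.
Proof.
rewrite -(mk_surj K x); case: (sval x) => [[a b] d]; exists (aadd K a (aone K)).
apply: (@le_lt_trans _ _ (inj a)); last by rewrite injD inj1 ltrDl ltr01.
rewrite /Order.le /= /frac_le; apply/asboolP.
rewrite [X in frac_ge0 K (_ + X)%R]frac_opp_mk [X in frac_ge0 K X]frac_add_mk.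
by apply/frac_ge0_mk; exact: tge0_sub.
Qed.

End Field.
End Fractions.

(** * The defined notions, read in a model *)

Module Semantics.
Import Classical.
Import Completeness Definability.

Record qrat (M : model) : Type := QRat { qp : dom M; qn : dom M; qd : dom M }.
Arguments QRat {M}. Arguments qp {M}. Arguments qn {M}. Arguments qd {M}.

Section Semantics.

Variable M : model.
Notation N := (dom M).
Notation S := (sdom M).
Local Notation "0" := (mzero M) : m_scope.
Local Notation "1" := (mone M) : m_scope.
Local Notation "x + y" := (madd M x y) : m_scope.
Local Notation "x * y" := (mmul M x y) : m_scope.
Local Notation "x < y" := (mlt M x y) : m_scope.
Local Notation "x <= y" := (mlt M x y \/ x = y) : m_scope.
Local Notation "x \in X" := (mmem M x X) (at level 70) : m_scope.
Local Notation pair := (pair M).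
Local Open Scope m_scope.

(** From here on each definition copies its syntactic namesake clause by clause, so that after
    evaluation the two have the same shape. *)
Definition elts (X : S) : N -> Prop := fun t => t \in X.
Definition section (X : S) (i : N) : N -> Prop := fun t => pair t i \in X.

Definition seq_in (P F : N -> Prop) : Prop :=
  (forall z, F z -> exists n m, z = pair n m /\ P m)
  /\ (forall n, exists m, F (pair n m))
  /\ (forall n m m', F (pair n m) -> F (pair n m') -> m = m').

Definition const_seq (c : N) : N -> Prop := fun t => exists n, t = pair n c.

Definition pow2 (k m : N) : Prop :=
  exists Z, seq_in (fun _ => True) (elts Z)
    /\ pair 0 1 \in Z
    /\ (forall i z, pair i z \in Z -> pair (i + 1) ((1 + 1) * z) \in Z)
    /\ pair k m \in Z.

Definition rcode (q : qrat M) : N := pair (pair (qp q) (qn q)) (qd q).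

Definition allq (P : qrat M -> Prop) : Prop := forall a b c, 0 < c -> P (QRat a b c).
Definition exq (P : qrat M -> Prop) : Prop := exists a b c, 0 < c /\ P (QRat a b c).

Definition is_rat (z : N) : Prop := exq (fun q => z = rcode q).

Definition qfrac (a b : N) : qrat M := QRat a 0 b.
Definition qadd (p q : qrat M) : qrat M :=
  QRat (qp p * qd q + qp q * qd p) (qn p * qd q + qn q * qd p) (qd p * qd q).
Definition qle (p q : qrat M) : Prop :=
  qp p * qd q + qn q * qd p <= qp q * qd p + qn p * qd q.
Definition qpos (q : qrat M) : Prop := qn q < qp q.
Definition qnear (p q e : qrat M) : Prop := qle p (qadd q e) /\ qle q (qadd p e).

Definition is_real (x : N -> Prop) : Prop :=
  seq_in is_rat x
  /\ (forall k i m, pow2 k m ->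
      allq (fun p => allq (fun q => x (pair k (rcode p)) -> x (pair (k + i) (rcode q)) ->
        qnear p q (qfrac 1 m)))).

Definition rle (x y : N -> Prop) : Prop :=
  forall k m, pow2 k m ->
    allq (fun p => allq (fun q => x (pair k (rcode p)) -> y (pair k (rcode q)) ->
      qle p (qadd q (qfrac (1 + 1) m)))).
Definition req (x y : N -> Prop) : Prop :=
  forall k m, pow2 k m ->
    allq (fun p => allq (fun q => x (pair k (rcode p)) -> y (pair k (rcode q)) ->
      qnear p q (qfrac (1 + 1) m))).
Definition rlt (x y : N -> Prop) : Prop := ~ rle y x.
Definition radd (x y : N -> Prop) : N -> Prop := fun t =>
  exists k, exq (fun p => exq (fun q => x (pair (k + 1) (rcode p)) /\ y (pair (k + 1) (rcode q))
                  /\ t = pair k (rcode (qadd p q)))).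

Definition of_rat (q : qrat M) : N -> Prop := const_seq (rcode q).
Definition rzero : N -> Prop := of_rat (qfrac 0 1).

Variables A D : S.

Definition dA (a b : N) : N -> Prop := section D (pair a b).

Definition is_space : Prop :=
  (forall a b, a \in A -> b \in A -> is_real (dA a b))
  /\ (forall a, a \in A -> req (dA a a) rzero)
  /\ (forall a b, a \in A -> b \in A -> req (dA a b) (dA b a) /\ rle rzero (dA a b))
  /\ (forall a b c, a \in A -> b \in A -> c \in A ->
        rle (dA a b) (radd (dA a c) (dA c b))).

Definition is_point (x : N -> Prop) : Prop :=
  seq_in (elts A) x
  /\ (forall n m a b, pow2 n m -> x (pair n a) -> x (pair (n + 1) b) ->
        rlt (dA a b) (of_rat (qfrac 1 m))).

Definition dist (x y : N -> Prop) : N -> Prop := fun t =>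
  exists k a b, exq (fun q => x (pair (k + (1 + 1 + 1)) a) /\ y (pair (k + (1 + 1 + 1)) b)
    /\ dA a b (pair (k + (1 + 1 + 1)) (rcode q)) /\ t = pair k (rcode q)).

Definition is_open (U : N -> Prop) : Prop :=
  seq_in (fun z => exists a, exq (fun q => a \in A /\ qpos q /\ z = pair a (rcode q))) U.

Definition in_open (x U : N -> Prop) : Prop :=
  exists n a, exq (fun q => U (pair n (pair a (rcode q)))
    /\ rlt (dist x (const_seq a)) (of_rat q)).

Definition is_covering (U : S) : Prop :=
  (forall n, is_open (section U n))
  /\ (forall x, is_point (elts x) -> exists n, in_open (elts x) (section U n)).

Definition isolated (x : N -> Prop) : Prop :=
  exists q, is_real (elts q) /\ rlt rzero (elts q)
    /\ ~ (exists y, is_point (elts y)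
            /\ rlt rzero (dist x (elts y))
            /\ rlt (dist x (elts y)) (elts q)).

Definition perfect : Prop := ~ (exists x, is_point (elts x) /\ isolated (elts x)).

Definition ball_sub (x q U : N -> Prop) : Prop :=
  forall y, is_point (elts y) -> rlt (dist x (elts y)) q -> in_open (elts y) U.

Definition lebesgue : Prop :=
  forall U, is_covering U ->
    exists q, is_real (elts q) /\ rlt rzero (elts q)
      /\ (forall x, is_point (elts x) ->
            exists n, ball_sub (elts x) (elts q) (section U n)).

Definition heine_borel : Prop :=
  forall U, is_covering U ->
    exists F, (exists k, forall n, n \in F -> n < k)
      /\ (forall x, is_point (elts x) ->
            exists n, n \in F /\ in_open (elts x) (section U n)).

End Semantics.

(** The left-hand sides of these congruences are what [sat] makes of the abbreviated connectives. *)
Lemma and_congr (P Q P' Q' : Prop) :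
  (P <-> P') -> (Q <-> Q') -> (((P -> (Q -> False)) -> False) <-> P' /\ Q').
Proof. intros E E'; rewrite E, E'; split; [intro H; split; apply NNPP; tauto | tauto]. Qed.

Lemma or_congr (P Q P' Q' : Prop) :
  (P <-> P') -> (Q <-> Q') -> (((P -> False) -> Q) <-> P' \/ Q').
Proof. intros E E'; rewrite E, E'; split; [intro H; destruct (classic P'); tauto | tauto]. Qed.

Lemma not_congr (P P' : Prop) : (P <-> P') -> ((P -> False) <-> ~ P').
Proof. intro E; rewrite E; tauto. Qed.

Lemma imp_congr (P Q P' Q' : Prop) :
  (P <-> P') -> (Q <-> Q') -> ((P -> Q) <-> (P' -> Q')).
Proof. intros E E'; rewrite E, E'; tauto. Qed.

Lemma all_congr (T : Type) (P Q : T -> Prop) :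
  (forall x, P x <-> Q x) -> ((forall x, P x) <-> (forall x, Q x)).
Proof. intro E; split; intros H x; apply E, H. Qed.

Lemma ex_congr (T : Type) (P Q : T -> Prop) :
  (forall x, P x <-> Q x) -> (((forall x, P x -> False) -> False) <-> exists x, Q x).
Proof.
  intro E; split.
  - intro H; apply NNPP; intro K; apply H; intros x Hx; apply K; exists x; now apply E.
  - intros [x Hx] H; apply (H x); now apply E.
Qed.

Lemma true_congr : (False -> False) <-> True.
Proof. tauto. Qed.

Ltac congr_step :=
  lazymatch goal with
  | |- _ <-> True => exact true_congr
  | |- _ <-> (_ /\ _) => apply and_congr
  | |- _ <-> (_ \/ _) => apply or_congr
  | |- _ <-> (~ _) => apply not_congr
  | |- _ <-> (exists x, @?Q x) => apply ex_congr; intro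
  | |- _ <-> (forall x : ?T, @?Q x) =>
      lazymatch type of T with Prop => apply imp_congr | _ => apply all_congr; intro end
  | |- _ <-> _ => reflexivity
  end.

End Semantics.

(** * From the truth of the sentence to its mathematical meaning *)

Module Transfer.
Import Defs Completeness.

Lemma sat_theorem (M : model) (e : nat -> dom M) (g : nat -> sdom M) :
  (forall A D, Semantics.is_space M A D /\ Semantics.perfect M A D /\ Semantics.lebesgue M A D ->
     Semantics.heine_borel M A D) ->
  sat M e g (sentence (alls A d,
          let M := Space A d in
          is_space M /\ perfect M /\ lebesgue M ==> heine_borel M)%l2).
Proof.
  match goal with |- ?P -> ?Q => enough (Q <-> P) by tauto end.
  (* With [M] destructed, evaluation eliminates projections, substitutions and de Bruijn
     environments. Both sides then differ in their connectives only; [not] stays folded for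
     [congr_step] to recognize it. *)
  destruct M as [dom0 sdom0 zero0 one0 add0 mul0 lt0 mem0]. cbv -[iff not].
  repeat Semantics.congr_step.
Qed.

End Transfer.

(** * Reals and metric spaces in a model with powers of 2 *)

Module Reals.
Import Completeness Definability Fractions Semantics.
Import all_boot order ssralg ssrnum boolp ring lra.
Import Order.TTheory GRing.Theory Num.Theory.
Set Implicit Arguments.
Unset Strict Implicit.
Local Open Scope ring_scope.

Section Reals.

Variable M : model.
Hypothesis HM : satisfies M Defs.RCA0.
Variable X0 : sdom M.

Local Notation N := (dom M).
Local Notation "x ⊕ y" := (madd M x y) (at level 50, left associativity).
Local Notation "x ⊗ y" := (mmul M x y) (at level 40, left associativity).
Local Notation "x ≺ y" := (mlt M x y) (at level 70).
Local Notation "x ∈ X" := (mmem M x X) (at level 70).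
Local Notation "𝟎" := (mzero M).
Local Notation "𝟏" := (mone M).
Local Notation pr := (pair M).

(** The field of fractions enters through the following properties only. *)
Variable F : realFieldType.
Variable iN : N -> F.
Hypothesis iN0 : iN 𝟎 = 0.
Hypothesis iN1 : iN 𝟏 = 1.
Hypothesis iND : forall m n, iN (m ⊕ n) = iN m + iN n.
Hypothesis iNM : forall m n, iN (m ⊗ n) = iN m * iN n.
Hypothesis iN_ge0 : forall n, 0 <= iN n.
Hypothesis iN_inj : forall m n, iN m = iN n -> m = n.
Hypothesis iN_lt : forall m n, m ≺ n <-> iN m < iN n.
Hypothesis F_bound : forall x : F, exists n, x < iN n.

Let iNE := (iN0, iN1, iND, iNM).

Lemma iN_le m n : (m ≺ n \/ m = n) <-> iN m <= iN n.
Proof.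
rewrite iN_lt le_eqVlt; split => [[->|->]|/orP [/eqP /iN_inj ->|->]]; rewrite ?eqxx ?orbT //; by [left|right].
Qed.
Lemma iN_gt0 n : 𝟎 ≺ n <-> 0 < iN n. Proof. by rewrite iN_lt iN0. Qed.

Definition qval (q : qrat M) : F := (iN (qp q) - iN (qn q)) / iN (qd q).

Lemma qle_qval p q : 𝟎 ≺ qd p -> 𝟎 ≺ qd q -> qle M p q <-> qval p <= qval q.
Proof.
move=> /iN_gt0 hp /iN_gt0 hq; rewrite /qle iN_le !iNE /qval.
rewrite ler_pdivrMr // mulrAC ler_pdivlMr //.
split=> h; lra.
Qed.

Lemma qval_qadd p q : 𝟎 ≺ qd p -> 𝟎 ≺ qd q -> qval (qadd M p q) = qval p + qval q.
Proof.
move=> /iN_gt0 hp /iN_gt0 hq; rewrite /qval /= !iNE; field.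
by rewrite !gt_eqF.
Qed.

Lemma qadd_gt0 p q : 𝟎 ≺ qd p -> 𝟎 ≺ qd q -> 𝟎 ≺ qd (qadd M p q).
Proof. by rewrite !iN_gt0 iNM => hp hq; apply: mulr_gt0. Qed.

Lemma qval_qfrac a b : qval (qfrac M a b) = iN a / iN b.
Proof. by rewrite /qval /= iN0 subr0. Qed.

Lemma rcode_inj p q : rcode M p = rcode M q -> p = q.
Proof.
case: p => a b c; case: q => a' b' c' /(pair_inj _ HM X0) /= [/(pair_inj _ HM X0) [-> ->] ->] //.
Qed.

(** Definability is read off from the shape of the goal. At a function variable, or at a predicate
    such as [DL] in [sg], [assumption] looks for its definability; lines like [have cl := Sg_DL] put
    it there. *)
Ltac fnc := cbv beta delta [tl]; lazymatch goal with
  | |- Fnc _ (fun e => e ?i) => exact (Fnc_Tm M X0 _ (Tm_var M i))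
  | |- Fnc _ (fun _ => ?c) => exact (Fnc_Tm M X0 _ (Tm_const M c))
  | |- Fnc _ (fun e => madd _ (@?s e) (@?t e)) => apply (Fnc_add M HM X0 s t); fnc
  | |- Fnc _ (fun e => mmul _ (@?s e) (@?t e)) => apply (Fnc_mul M HM X0 s t); fnc
  | |- Fnc _ (fun e => pair _ (@?s e) (@?t e)) => apply (Fnc_pair M HM X0 s t); fnc
  | |- Fnc _ (fun e => ?f (@?t e)) => apply (Fnc_comp M HM X0 f t); [assumption | fnc]
  end.

Ltac sg := cbv beta delta [tl]; lazymatch goal with
  | |- Sg _ (fun e => @?P e /\ @?Q e) => apply (Sg_and M HM X0 P Q); sg
  | |- Sg _ (fun e => @?P e \/ @?Q e) => apply (Sg_or M X0 P Q); sg
  | |- Sg _ (fun e => exists x, @?Q e x) => apply (Sg_ex M HM X0 Q); sg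
  | |- Sg _ (fun e => forall x, mlt _ x (@?t e) -> @?Q e x) => apply (Sg_ball M HM X0 t Q); [fnc | sg]
  | |- Sg _ (fun e => @?s e = @?t e) => apply (Sg_eq M HM X0 s t); fnc
  | |- Sg _ (fun e => @?s e <> @?t e) => apply (Sg_neq M HM X0 s t); fnc
  | |- Sg _ (fun e => mlt _ (@?s e) (@?t e)) => apply (Sg_lt M HM X0 s t); fnc
  | |- Sg _ (fun e => mmem _ (@?t e) ?X) => apply (Sg_mem M HM X0 t X); fnc
  | |- Sg _ (fun e => ~ mmem _ (@?t e) ?X) => apply (Sg_nmem M HM X0 t X); fnc
  | |- Sg _ (fun e => ?P (@?a e) (@?b e) (@?c e) (@?d e) (@?g e)) =>
      apply (Sg_sub5 M HM X0 P a b c d g); [assumption | fnc | fnc | fnc | fnc | fnc]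
  end.

(** * Powers of 2 and the terms of reals *)

Section Power.

Variable Z : sdom M.
Hypothesis Z_seq : seq_in M (fun _ => True) (elts M Z).
Hypothesis Z_0 : pr 𝟎 𝟏 ∈ Z.
Hypothesis Z_S : forall i z, pr i z ∈ Z -> pr (i ⊕ 𝟏) ((𝟏 ⊕ 𝟏) ⊗ z) ∈ Z.

Definition pow : N -> N := projT1 (boolp.choice (proj1 (proj2 Z_seq))).

Lemma powP n m : pr n m ∈ Z <-> m = pow n.
Proof.
have h : forall n, pr n (pow n) ∈ Z := projT2 (boolp.choice (proj1 (proj2 Z_seq))).
split => [hm|->]; last exact: h.
by have [_ [_ u]] := Z_seq; apply: u hm (h n).
Qed.

Lemma pow_0 : pow 𝟎 = 𝟏. Proof. by symmetry; apply/powP. Qed.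
Lemma pow_S n : pow (n ⊕ 𝟏) = (𝟏 ⊕ 𝟏) ⊗ pow n.
Proof. by symmetry; apply/powP/Z_S/powP. Qed.

Lemma computable_pow : computable M pow.
Proof. by apply: (Sg_iff _ (fun e => pr (e 1%N) (e 0%N) ∈ Z)) => [e|]; [exact: powP | sg]. Qed.
Let cpow := computable_pow.

(** Two sets obeying the recursion equations agree, by Sigma^0_1 induction; hence the given [Z]
    decides [pow2] for all sets. *)
Lemma pow2P k m : pow2 M k m <-> m = pow k.
Proof.
split=> [[Z' [[_ [tot uniq]] [z0 [zS kZ]]]]|->]; last first.
  by exists Z; do 3!split => //; exact/powP.
suff h n : pr n (pow n) ∈ Z' by exact: uniq kZ (h k).
have c := cpow.
apply: (ind_Sg M HM (fun n => pr n (pow n) ∈ Z')); [sg | by rewrite pow_0 |].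
by move=> i hi; rewrite pow_S; exact: zS.
Qed.

Lemma iN_powS n : iN (pow (n ⊕ 𝟏)) = 2 * iN (pow n).
Proof. by rewrite pow_S !iNE. Qed.

Lemma pow_gt n : iN n < iN (pow n).
Proof.
have c := cpow.
apply/iN_lt; apply: (ind_Sg M HM (fun n => n ≺ pow n)); [sg | by rewrite pow_0 iN_lt !iNE ltr01 |].
move=> i /(lt_iff _ HM X0) [k e]; rewrite iN_lt iN_powS e !iNE.
have := iN_ge0 k; have := iN_ge0 i; lra.
Qed.

Lemma pow_gt0 n : 0 < iN (pow n).
Proof. exact: le_lt_trans (iN_ge0 n) (pow_gt n). Qed.

Definition eps (n : N) : F := (iN (pow n))^-1.

Lemma eps_gt0 n : 0 < eps n.
Proof. by rewrite invr_gt0 pow_gt0. Qed.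

Lemma epsS n : eps (n ⊕ 𝟏) = eps n / 2.
Proof. by rewrite /eps iN_powS invfM mulrC. Qed.

Lemma eps_le n i : eps (n ⊕ i) <= eps n.
Proof.
have c := cpow.
rewrite /eps lef_pV2 ?posrE ?pow_gt0 //; apply/iN_le.
rewrite -(lt_succ_r _ HM X0).
apply: (ind_Sg M HM (fun i => pow n ≺ pow (n ⊕ i) ⊕ 𝟏)); [sg | |].
  by rewrite (add_0_r M HM X0) iN_lt !iNE ltrDl ltr01.
move=> j; rewrite (add_assoc M HM X0) !iN_lt !iNE iN_powS.
have := pow_gt0 (n ⊕ j); lra.
Qed.

Lemma eps_small (x : F) : 0 < x -> exists n, eps n < x.
Proof.
move=> x0; have [n hn] := F_bound x^-1; exists n.
by rewrite /eps invf_plt ?posrE ?pow_gt0 //; exact: lt_trans hn (pow_gt n).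
Qed.

Definition ev (P : N -> Prop) : Prop := exists K, forall i, P (K ⊕ i).

Lemma ev_and P Q : ev P -> ev Q -> ev (fun k => P k /\ Q k).
Proof.
move=> [K hP] [L hQ]; exists (K ⊕ L) => i; split.
  by rewrite -(add_assoc M HM X0).
by rewrite (add_comm M HM X0 K) -(add_assoc M HM X0).
Qed.

Lemma ev_ex P : ev P -> exists k, P k.
Proof. by move=> [K hP]; exists (K ⊕ 𝟎). Qed.

Lemma ev_eps (x : F) : 0 < x -> ev (fun k => eps k < x).
Proof. by move=> /eps_small [n hn]; exists n => i; exact: le_lt_trans (eps_le _ _) hn. Qed.

(* Junk value 0 if the k-th term is not a code of a rational. *)
Definition rv (x : N -> Prop) (k : N) : F :=
  if pselect (exists q, 𝟎 ≺ qd q /\ x (pr k (rcode M q))) is left h then qval (sval (cid h)) else 0.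

Lemma rv_ex x k : seq_in M (is_rat M) x ->
  exists q, 𝟎 ≺ qd q /\ x (pr k (rcode M q)) /\ rv x k = qval q.
Proof.
move=> [rat [tot _]]; rewrite /rv; case: pselect => [h|[]].
  by exists (sval (cid h)); have [? ?] := svalP (cid h).
have [m hm] := tot k; have [_ [_ [/(pair_inj _ HM X0) [_ <-]]]] := rat _ hm.
by move=> [a [b [c [c0 e]]]]; exists (QRat a b c); rewrite -e.
Qed.

Lemma rv_eq x k q : seq_in M (is_rat M) x -> x (pr k (rcode M q)) -> rv x k = qval q.
Proof.
move=> sx xq; have [q' [_ [xq' ->]]] := rv_ex k sx.
have [_ [_ uniq]] := sx; congr qval; apply: rcode_inj; exact: uniq xq' xq.
Qed.

Lemma qval_div_pow a k : qval (qfrac M a (pow k)) = iN a * eps k.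
Proof. by rewrite qval_qfrac. Qed.

Lemma pow_pos k : 𝟎 ≺ pow k.
Proof. exact/iN_gt0/pow_gt0. Qed.

Lemma rle_rv x y : seq_in M (is_rat M) x -> seq_in M (is_rat M) y ->
  rle M x y <-> forall k, rv x k <= rv y k + 2 * eps k.
Proof.
move=> sx sy; split => [h k|h k m /pow2P -> a b c c0 a' b' c' c0' xp yq].
  have [p [p0 [xp ->]]] := rv_ex k sx; have [q [q0 [yq ->]]] := rv_ex k sy.
  case: p p0 xp => a b c /= c0 xp; case: q q0 yq => a' b' c' /= c0' yq.
  have /(_ _ _ _ c0 _ _ _ c0' xp yq) := h k (pow k) (proj2 (pow2P _ _) erefl).
  rewrite qle_qval ?qval_qadd ?qval_div_pow ?iNE //; [exact: pow_pos|].
  by apply: qadd_gt0 => //; exact: pow_pos.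
rewrite qle_qval //; last by apply: qadd_gt0 => //; exact: pow_pos.
rewrite qval_qadd ?qval_div_pow ?iNE //; last exact: pow_pos.
by rewrite -(rv_eq sx xp) -(rv_eq sy yq).
Qed.

Lemma qnear_qval p q a k : 𝟎 ≺ qd p -> 𝟎 ≺ qd q ->
  qnear M p q (qfrac M a (pow k)) <-> qval p <= qval q + iN a * eps k /\ qval q <= qval p + iN a * eps k.
Proof.
move=> p0 q0; rewrite /qnear !qle_qval ?qval_qadd ?qval_div_pow //; try exact: pow_pos;
by apply: qadd_gt0 => //; exact: pow_pos.
Qed.

Lemma req_rv x y k : seq_in M (is_rat M) x -> seq_in M (is_rat M) y -> req M x y ->
  rv x k <= rv y k + 2 * eps k /\ rv y k <= rv x k + 2 * eps k.
Proof.
move=> sx sy h.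
have [p [p0 [xp ->]]] := rv_ex k sx; have [q [q0 [yq ->]]] := rv_ex k sy.
case: p p0 xp => a b c /= c0 xp; case: q q0 yq => a' b' c' /= c0' yq.
have /(_ _ _ _ c0 _ _ _ c0' xp yq) := h k (pow k) (proj2 (pow2P _ _) erefl).
by rewrite qnear_qval // !iNE.
Qed.

Lemma is_real_rv x k i : is_real M x ->
  rv x k <= rv x (k ⊕ i) + eps k /\ rv x (k ⊕ i) <= rv x k + eps k.
Proof.
move=> [sx h].
have [p [p0 [xp ->]]] := rv_ex k sx; have [q [q0 [yq ->]]] := rv_ex (k ⊕ i) sx.
case: p p0 xp => a b c /= c0 xp; case: q q0 yq => a' b' c' /= c0' yq.
have /(_ _ _ _ c0 _ _ _ c0' xp yq) := h k i (pow k) (proj2 (pow2P _ _) erefl).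
by rewrite qnear_qval // !iNE mul1r.
Qed.

Lemma is_realI x : seq_in M (is_rat M) x ->
  (forall k i, rv x k <= rv x (k ⊕ i) + eps k /\ rv x (k ⊕ i) <= rv x k + eps k) -> is_real M x.
Proof.
move=> sx h; split=> // k i m /pow2P -> a b c c0 a' b' c' c0' xp xq.
rewrite qnear_qval // iNE mul1r -(rv_eq sx xp) -(rv_eq sx xq); exact: h.
Qed.

Lemma of_rat_seq q : 𝟎 ≺ qd q -> seq_in M (is_rat M) (of_rat M q).
Proof.
move=> q0; split=> [z [n ->]|].
  by exists n, (rcode M q); split=> //; case: q q0 => a b c c0; exists a, b, c.
split=> [n|n m m' [i /(pair_inj _ HM X0) [_ ->]] [j /(pair_inj _ HM X0) [_ ->]] //].
by exists (rcode M q), n.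
Qed.

Lemma of_rat_rv q k : 𝟎 ≺ qd q -> rv (of_rat M q) k = qval q.
Proof. by move=> q0; apply: rv_eq; [exact: of_rat_seq | exists k]. Qed.

Lemma radd_seq x y : seq_in M (is_rat M) x -> seq_in M (is_rat M) y ->
  seq_in M (is_rat M) (radd M x y).
Proof.
move=> sx sy; split.
  move=> z [k [a [b [c [c0 [a' [b' [c' [c0' [_ [_ ->]]]]]]]]]]].
  exists k, (rcode M (qadd M (QRat a b c) (QRat a' b' c'))); split=> //.
  do 3!eexists; split; last reflexivity.
  exact: (@qadd_gt0 (QRat a b c) (QRat a' b' c')).
split=> [n|n m m'].
  have [[a b c] /= [p0 [xp _]]] := rv_ex (n ⊕ 𝟏) sx.
  have [[a' b' c'] /= [q0 [yq _]]] := rv_ex (n ⊕ 𝟏) sy.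
  by eexists; exists n, a, b, c; split=> //; exists a', b', c'.
have [_ [_ ux]] := sx; have [_ [_ uy]] := sy.
move=> [k [a [b [c [c0 [a' [b' [c' [c0' [xp [yp /(pair_inj _ HM X0) [e ->]]]]]]]]]]]].
move=> [k1 [a1 [b1 [c1 [c01 [a1' [b1' [c1' [c01' [xp1 [yp1 /(pair_inj _ HM X0) [e1 ->]]]]]]]]]]]].
subst k k1; congr (rcode M (qadd M _ _)); apply: rcode_inj; [exact: ux xp xp1 | exact: uy yp yp1].
Qed.

Lemma radd_rv x y k : seq_in M (is_rat M) x -> seq_in M (is_rat M) y ->
  rv (radd M x y) k = rv x (k ⊕ 𝟏) + rv y (k ⊕ 𝟏).
Proof.
move=> sx sy.
have [[a b c] /= [p0 [xp ->]]] := rv_ex (k ⊕ 𝟏) sx.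
have [[a' b' c'] /= [q0 [yq ->]]] := rv_ex (k ⊕ 𝟏) sy.
rewrite -qval_qadd //; apply: rv_eq; first exact: radd_seq.
by exists k, a, b, c; split=> //; exists a', b', c'.
Qed.

(** Applied twice: to elements of [A] with the terms of [d], as [dq], and to points with the terms
    of [dist], as [pq]. *)
Section Premetric.

Variables (T : Type) (q : T -> T -> N -> F).

(* [q x y k] is meant to approximate a distance within [eps k].  The distance itself is never
   formed; only the relations [d(x, y) < r] and [d(x, y) > r] for [r] in [F] are used. *)
Definition dlt (x y : T) (r : F) : Prop := exists k, q x y k + eps k < r.
Definition dgt (x y : T) (r : F) : Prop := exists k, r < q x y k - eps k.

Variable S : T -> Prop.
(** The slack [4 * eps k] below is the price of the triangle inequality: [rle] grants [2 * eps k],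
    and passing from the index k + 1 used by [radd] to k costs [eps k] for each summand. *)
Hypothesis q_cauchy : forall x y k i, S x -> S y ->
  q x y k <= q x y (k ⊕ i) + eps k /\ q x y (k ⊕ i) <= q x y k + eps k.
Hypothesis q_refl : forall x k, S x -> q x x k <= 4 * eps k.
Hypothesis q_sym : forall x y k, S x -> S y -> q x y k <= q y x k + 4 * eps k.
Hypothesis q_tri : forall x y z k, S x -> S y -> S z -> q x y k <= q x z k + q z y k + 4 * eps k.

(** A strict inequality at one index leaves a fixed gap at all later ones. Several inequalities can
    thus be compared at a common late index, where [eps k < g / 8] makes the slack [4 * eps k] less
    than half the gap. *)
Lemma dlt_ev x y r : S x -> S y ->
  dlt x y r -> exists2 g, 0 < g & ev (fun k => q x y k + g < r).
Proof.
move=> Sx Sy [k h]; exists ((r - q x y k - eps k) / 2); first lra.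
by exists k => i; have [_] := q_cauchy k i Sx Sy; lra.
Qed.

Lemma ev_dlt x y r g : 0 < g -> ev (fun k => q x y k + g < r) -> dlt x y r.
Proof.
by move=> g0 h; have [k [h1 h2]] := ev_ex (ev_and h (ev_eps g0)); exists k; lra.
Qed.

Lemma dgt_ev x y r : S x -> S y ->
  dgt x y r -> exists2 g, 0 < g & ev (fun k => r + g < q x y k).
Proof.
move=> Sx Sy [k h]; exists ((q x y k - eps k - r) / 2); first lra.
by exists k => i; have [] := q_cauchy k i Sx Sy; lra.
Qed.

Lemma ev_dgt x y r g : 0 < g -> ev (fun k => r + g < q x y k) -> dgt x y r.
Proof.
by move=> g0 h; have [k [h1 h2]] := ev_ex (ev_and h (ev_eps g0)); exists k; lra.
Qed.

Lemma ev_imp (P Q : N -> Prop) : (forall k, P k -> Q k) -> ev P -> ev Q.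
Proof. by move=> h [K hP]; exists K => i; exact: h. Qed.

Lemma dlt_mono x y r s : r <= s -> dlt x y r -> dlt x y s.
Proof. by move=> rs [k h]; exists k; lra. Qed.

Lemma dgt_mono x y r s : s <= r -> dgt x y r -> dgt x y s.
Proof. by move=> rs [k h]; exists k; lra. Qed.

Lemma dlt_open x y r : dlt x y r -> exists2 s, s < r & dlt x y s.
Proof. by move=> [k h]; exists ((r + (q x y k + eps k)) / 2); [lra | exists k; lra]. Qed.

Lemma dgt_open x y r : dgt x y r -> exists2 s, r < s & dgt x y s.
Proof. by move=> [k h]; exists ((r + (q x y k - eps k)) / 2); [lra | exists k; lra]. Qed.

Lemma dlt_refl x r : S x -> 0 < r -> dlt x x r.
Proof.
move=> Sx r0; have r8 : 0 < r / 8 by lra.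
have [k h] := ev_ex (ev_eps r8); exists k; have := q_refl k Sx; lra.
Qed.

Lemma dlt_sym x y r : S x -> S y -> dlt x y r -> dlt y x r.
Proof.
move=> Sx Sy /(dlt_ev Sx Sy) [g g0 h]; have g8 : 0 < g / 8 by lra.
apply: (@ev_dlt _ _ _ (g / 2)); first lra.
by apply: ev_imp (ev_and h (ev_eps g8)) => k [h1 h2]; have := q_sym k Sy Sx; lra.
Qed.

Lemma dlt_tri x y z r s : S x -> S y -> S z -> dlt x z r -> dlt z y s -> dlt x y (r + s).
Proof.
move=> Sx Sy Sz /(dlt_ev Sx Sz) [g g0 h] /(dlt_ev Sz Sy) [g' g0' h'].
have g8 : 0 < g / 8 by lra.
apply: (@ev_dlt _ _ _ (g / 2)); first lra.
by apply: ev_imp (ev_and h (ev_and h' (ev_eps g8))) => k [h1 [h2 h3]]; have := q_tri k Sx Sy Sz; lra.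
Qed.

Lemma dgt_tri x y z r s : S x -> S y -> S z -> dgt x y r -> dlt x z s -> dgt z y (r - s).
Proof.
move=> Sx Sy Sz /(dgt_ev Sx Sy) [g g0 h] /(dlt_ev Sx Sz) [g' g0' h'].
have g8 : 0 < g / 8 by lra.
apply: (@ev_dgt _ _ _ (g / 2)); first lra.
by apply: ev_imp (ev_and h (ev_and h' (ev_eps g8))) => k [h1 [h2 h3]]; have := q_tri k Sx Sy Sz; lra.
Qed.

Lemma dgt_sym x y r : S x -> S y -> dgt x y r -> dgt y x r.
Proof.
move=> Sx Sy /(dgt_ev Sx Sy) [g g0 h]; have g8 : 0 < g / 8 by lra.
apply: (@ev_dgt _ _ _ (g / 2)); first lra.
by apply: ev_imp (ev_and h (ev_eps g8)) => k [h1 h2]; have := q_sym k Sx Sy; lra.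
Qed.

Lemma dlt_dgt x y r s : S x -> S y -> dlt x y s -> dgt x y r -> r < s.
Proof.
move=> Sx Sy /(dlt_ev Sx Sy) [g g0 h] /(dgt_ev Sx Sy) [g' g0' h'].
by have [k [h1 h2]] := ev_ex (ev_and h h'); lra.
Qed.

(** Giving up a little of the bound turns negative information into the Sigma^0_1 relation [dgt]. *)
Lemma not_dlt x y r s : r < s -> ~ dlt x y s -> dgt x y r.
Proof.
move=> rs h; have g0 : 0 < (s - r) / 2 by lra.
have [k hk] := ev_ex (ev_eps g0); exists k.
have : s <= q x y k + eps k by rewrite leNgt; apply/negP => h'; apply: h; exists k.
by lra.
Qed.

End Premetric.

(** * Distances, points and open sets of a space *)

Section Space.

Variables A D : sdom M.
Hypothesis AD : is_space M A D.

Definition dq (a b k : N) : F := rv (dA M D a b) k.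

Local Notation inA := (fun a => a ∈ A).

Lemma dA_real a b : a ∈ A -> b ∈ A -> is_real M (dA M D a b).
Proof. by have [h _] := AD; exact: h. Qed.

Lemma dA_seq a b : a ∈ A -> b ∈ A -> seq_in M (is_rat M) (dA M D a b).
Proof. by move=> ha hb; have [] := dA_real ha hb. Qed.

Lemma dq_cauchy a b k i : a ∈ A -> b ∈ A ->
  dq a b k <= dq a b (k ⊕ i) + eps k /\ dq a b (k ⊕ i) <= dq a b k + eps k.
Proof. by move=> ha hb; exact: is_real_rv (dA_real ha hb). Qed.

Lemma one_pos : 𝟎 ≺ 𝟏. Proof. by apply/iN_gt0; rewrite iN1. Qed.

Lemma rzero_seq : seq_in M (is_rat M) (rzero M).
Proof. by apply: of_rat_seq; exact: one_pos. Qed.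

Lemma rzero_rv k : rv (rzero M) k = 0.
Proof. by rewrite /rzero of_rat_rv ?qval_qfrac ?iN0 ?mul0r //; exact: one_pos. Qed.

Lemma dq_refl a k : a ∈ A -> dq a a k <= 4 * eps k.
Proof.
move=> ha; have [_ [/(_ a ha) h _]] := AD.
have [] := req_rv k (dA_seq ha ha) rzero_seq h; rewrite rzero_rv -/(dq a a k).
have := eps_gt0 k; lra.
Qed.

Lemma dq_sym a b k : a ∈ A -> b ∈ A -> dq a b k <= dq b a k + 4 * eps k.
Proof.
move=> ha hb; have [_ [_ [/(_ a b ha hb) [h _] _]]] := AD.
have [] := req_rv k (dA_seq ha hb) (dA_seq hb ha) h.
rewrite -/(dq a b k) -/(dq b a k); have := eps_gt0 k; lra.
Qed.

Lemma dq_tri a b c k : a ∈ A -> b ∈ A -> c ∈ A -> dq a b k <= dq a c k + dq c b k + 4 * eps k.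
Proof.
move=> ha hb hc; have [_ [_ [_ /(_ a b c ha hb hc)]]] := AD.
rewrite rle_rv; [move=> /(_ k) | exact: dA_seq | by apply: radd_seq; exact: dA_seq].
rewrite radd_rv; [|exact: dA_seq..]; rewrite -!/(dq _ _ _).
have [_] := dq_cauchy k 𝟏 ha hc; have [_] := dq_cauchy k 𝟏 hc hb; lra.
Qed.

(* [d(a, b) < (p - m) / d] and [d(a, b) > (p - m) / d], cleared of denominators. *)
Definition DL (a b p m d : N) : Prop := exists k u v w,
  dA M D a b (pr k (rcode M (QRat u v w))) /\ 𝟎 ≺ w /\
  (u ⊗ pow k ⊕ w) ⊗ d ⊕ m ⊗ (w ⊗ pow k) ≺ p ⊗ (w ⊗ pow k) ⊕ v ⊗ pow k ⊗ d.
Definition DG (a b p m d : N) : Prop := exists k u v w,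
  dA M D a b (pr k (rcode M (QRat u v w))) /\ 𝟎 ≺ w /\
  p ⊗ (w ⊗ pow k) ⊕ (v ⊗ pow k ⊕ w) ⊗ d ≺ u ⊗ pow k ⊗ d ⊕ m ⊗ (w ⊗ pow k).

Lemma Sg_DL : Sg M (fun e => DL (e 0%N) (e 1%N) (e 2%N) (e 3%N) (e 4%N)).
Proof. by have c := cpow; rewrite /DL /dA /section /rcode /=; sg. Qed.

Lemma Sg_DG : Sg M (fun e => DG (e 0%N) (e 1%N) (e 2%N) (e 3%N) (e 4%N)).
Proof. by have c := cpow; rewrite /DG /dA /section /rcode /=; sg. Qed.

Lemma dlt_cross (u v w p m d P : F) : 0 < w -> 0 < P -> 0 < d ->
  ((u - v) / w + P^-1 < (p - m) / d) = ((u * P + w) * d + m * (w * P) < p * (w * P) + v * P * d).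
Proof.
move=> w0 P0 d0; have -> : (u - v) / w + P^-1 = (u * P - v * P + w) / (w * P).
  by field; rewrite !gt_eqF.
rewrite ltr_pdivrMr ?mulr_gt0 // mulrAC ltr_pdivlMr //; apply/idP/idP => h; lra.
Qed.

Lemma dgt_cross (u v w p m d P : F) : 0 < w -> 0 < P -> 0 < d ->
  ((p - m) / d < (u - v) / w - P^-1) = (p * (w * P) + (v * P + w) * d < u * P * d + m * (w * P)).
Proof.
move=> w0 P0 d0; have -> : (u - v) / w - P^-1 = (u * P - v * P - w) / (w * P).
  by field; rewrite !gt_eqF.
rewrite ltr_pdivrMr // mulrAC ltr_pdivlMr ?mulr_gt0 //; apply/idP/idP => h; lra.
Qed.

Lemma DL_dlt a b p m d : a ∈ A -> b ∈ A -> 𝟎 ≺ d ->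
  DL a b p m d <-> dlt dq a b ((iN p - iN m) / iN d).
Proof.
move=> ha hb /iN_gt0 d0; split.
  move=> [k [u [v [w [h [/iN_gt0 w0]]]]]]; rewrite iN_lt !iNE => lt; exists k.
  by rewrite /dq (rv_eq (dA_seq ha hb) h) /qval /= dlt_cross // pow_gt0.
move=> [k]; have [[u v w] /= [w0 [h]]] := rv_ex k (dA_seq ha hb).
rewrite /dq => ->; rewrite /qval /= dlt_cross ?pow_gt0 //; last exact/iN_gt0.
by move=> lt; exists k, u, v, w; do 2!split=> //; rewrite iN_lt !iNE.
Qed.

Lemma DG_dgt a b p m d : a ∈ A -> b ∈ A -> 𝟎 ≺ d ->
  DG a b p m d <-> dgt dq a b ((iN p - iN m) / iN d).
Proof.
move=> ha hb /iN_gt0 d0; split.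
  move=> [k [u [v [w [h [/iN_gt0 w0]]]]]]; rewrite iN_lt !iNE => lt; exists k.
  by rewrite /dq (rv_eq (dA_seq ha hb) h) /qval /= dgt_cross // pow_gt0.
move=> [k]; have [[u v w] /= [w0 [h]]] := rv_ex k (dA_seq ha hb).
rewrite /dq => ->; rewrite /qval /= dgt_cross ?pow_gt0 //; last exact/iN_gt0.
by move=> lt; exists k, u, v, w; do 2!split=> //; rewrite iN_lt !iNE.
Qed.

(** [rle] is refuted by one index, where the gap exceeds [2 * eps k]; so strict inequality is
    existential. Conversely, a gap beyond [eps k] persists and exceeds [2 * eps i] at a late [i]. *)
Lemma rlt_of_rat x q : is_real M x -> 𝟎 ≺ qd q ->
  rlt M x (of_rat M q) <-> exists k, rv x k + eps k < qval q.
Proof.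
move=> rx q0; have [sx _] := rx; rewrite /rlt rle_rv //; last exact: of_rat_seq.
split=> [/existsNP [k]|[k hk] h].
  rewrite of_rat_rv // => /negP; rewrite -ltNge => h; exists k; have := eps_gt0 k; lra.
have g0 : 0 < (qval q - (rv x k + eps k)) / 4 by lra.
have [i [h1 h2]] : exists i, eps i < (qval q - (rv x k + eps k)) / 4 /\ rv x i <= rv x k + eps k.
  apply: ev_ex; apply: ev_and; first exact: ev_eps.
  by exists k => i; have [] := is_real_rv k i rx.
by have := h i; rewrite of_rat_rv //; lra.
Qed.

Lemma rlt_rzero x : is_real M x -> rlt M (rzero M) x <-> exists k, 0 < rv x k - eps k.
Proof.
move=> rx; have [sx _] := rx; rewrite /rlt rle_rv //; last exact: rzero_seq.
split=> [/existsNP [k]|[k hk] h].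
  rewrite rzero_rv // => /negP; rewrite -ltNge => h; exists k; have := eps_gt0 k; lra.
have g0 : 0 < (rv x k - eps k) / 4 by lra.
have [i [h1 h2]] : exists i, eps i < (rv x k - eps k) / 4 /\ rv x k <= rv x i + eps k.
  apply: ev_ex; apply: ev_and; first exact: ev_eps.
  by exists k => i; have [] := is_real_rv k i rx.
by have := h i; rewrite rzero_rv //; lra.
Qed.

(** Points are treated as functions; computability amounts to the graph being a set of the model, by
    [gr_computable] and [gr_set]. *)
Definition point (f : N -> N) : Prop :=
  computable M f /\ (forall n, f n ∈ A) /\ (forall n, dlt dq (f n) (f (n ⊕ 𝟏)) (eps n)).

Definition gr (f : N -> N) : N -> Prop := fun t => exists n, t = pr n (f n).

Lemma grE f n m : gr f (pr n m) <-> m = f n.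
Proof. by split=> [[i /(pair_inj _ HM X0) [-> ->]] //|->]; exists n. Qed.

Lemma gr_seq (P : N -> Prop) f : (forall n, P (f n)) -> seq_in M P (gr f).
Proof.
move=> h; split=> [z [n ->]|]; first by exists n, (f n).
by split=> [n|n m m' /grE -> /grE ->]; first by exists (f n); apply/grE.
Qed.

Lemma seq_gr (P x : N -> Prop) : seq_in M P x -> exists2 f, x = gr f & forall n, P (f n).
Proof.
move=> [h1 [h2 h3]]; have [f hf] := boolp.choice h2; exists f.
  apply/funext => t; apply/propext; split=> [xt|[n ->]]; last exact: hf.
  by have [n [m [e _]]] := h1 _ xt; exists n; rewrite e; congr pr; apply: h3 (hf n); rewrite -e.
by move=> n; have [i [m [/(pair_inj _ HM X0) [_ ->]]]] := h1 _ (hf n).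
Qed.

Lemma step_dlt a b n : a ∈ A -> b ∈ A ->
  rlt M (dA M D a b) (of_rat M (qfrac M 𝟏 (pow n))) <-> dlt dq a b (eps n).
Proof.
move=> ha hb; rewrite rlt_of_rat; [|exact: dA_real|exact: pow_pos].
by rewrite qval_div_pow iN1 mul1r.
Qed.

Lemma gr_computable X f : elts M X = gr f -> computable M f.
Proof.
move=> e; apply: (Sg_iff _ (fun e => pr (e 1%N) (e 0%N) ∈ X)) => [v|]; last sg.
by rewrite -grE -e.
Qed.

Lemma is_pointP X : is_point M A D (elts M X) -> exists2 f, elts M X = gr f & point f.
Proof.
move=> [sX step]; have [f e fA] := seq_gr sX; exists f => //; split; first exact: gr_computable e.
split=> // n; apply/step_dlt; [exact: fA..|].
by apply: step; [exact/pow2P | rewrite e; exact/grE..].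
Qed.

(** Through the projection [p1] membership in the graph becomes an equation between computable
    functions, so that the graph and its complement are both Sigma^0_1. *)
Lemma gr_set f : computable M f -> exists X, elts M X = gr f.
Proof.
move=> cf; have [p1 [p2 [c1 [c2 e12]]]] := unpairing M HM X0.
have E n : gr f n <-> n = pr (p1 n) (f (p1 n)).
  by split=> [[i ->]|->]; [have [-> _] := e12 i (f i) | exists (p1 n)].
have [X hX] : exists X, forall n, n ∈ X <-> gr f n.
  apply: (comprehension M HM X0 (gr f)).
    by apply: (Sg_iff _ (fun e => e 0%N = pr (p1 (e 0%N)) (f (p1 (e 0%N))))) => [e|]; [rewrite E | sg].
  by apply: (Sg_iff _ (fun e => e 0%N <> pr (p1 (e 0%N)) (f (p1 (e 0%N))))) => [e|]; [rewrite E | sg].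
by exists X; apply/funext => t; apply/propext; exact: hX.
Qed.

Lemma point_is_point f : point f -> exists2 X, elts M X = gr f & is_point M A D (elts M X).
Proof.
move=> [cf [fA step]].
have [X e] := gr_set cf.
exists X => //; rewrite e; split; first exact: gr_seq.
by move=> n m a b /pow2P -> /grE -> /grE ->; apply/step_dlt.
Qed.

(** The induction proves the bound [3 * eps n - 2 * eps (n ⊕ j)]: the subtracted term pays for the
    next step, and 3 in place of 2 makes the case j = 0 strict. Writing the bound as a fraction with
    parts [p], [m], [d] makes the induction formula an instance of the Sigma^0_1 relation [DL]. *)
Lemma point_close f n i : point f -> dlt dq (f n) (f (n ⊕ i)) (3 * eps n).
Proof.
move=> [cf [fA step]]; have c := cpow; have cl := Sg_DL.
pose p i : N := (𝟏 ⊕ 𝟏 ⊕ 𝟏) ⊗ pow (n ⊕ i); pose m : N := (𝟏 ⊕ 𝟏) ⊗ pow n.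
pose d i := pow n ⊗ pow (n ⊕ i).
have dE j : (iN (p j) - iN m) / iN (d j) = 3 * eps n - 2 * eps (n ⊕ j).
  rewrite /p /m /d !iNE /eps; field; by rewrite !gt_eqF ?pow_gt0.
have d0 j : 𝟎 ≺ d j by rewrite iN_gt0 iNM mulr_gt0 ?pow_gt0.
suff h j : DL (f n) (f (n ⊕ j)) (p j) m (d j).
  have := h i; rewrite DL_dlt // dE; apply: dlt_mono; have := eps_gt0 (n ⊕ i); lra.
apply: (ind_Sg M HM (fun j => DL (f n) (f (n ⊕ j)) (p j) m (d j))) => [||{}j].
- by rewrite /p /m /d; sg.
- rewrite DL_dlt // dE (add_0_r M HM X0); apply: (dlt_refl dq_refl) => //.
  by have := eps_gt0 n; lra.
- rewrite !DL_dlt // !dE (add_assoc M HM X0) epsS => h.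
  have := dlt_tri dq_cauchy dq_tri (fA _) (fA _) (fA _) h (step _).
  apply: dlt_mono; lra.
Qed.

Definition cst (a : N) : N -> N := fun _ => a.

Lemma point_cst a : a ∈ A -> point (cst a).
Proof.
move=> ha; split; first by rewrite /computable /cst; sg.
by split=> // n; apply: (dlt_refl dq_refl) => //; exact: eps_gt0.
Qed.

Definition three : N := 𝟏 ⊕ 𝟏 ⊕ 𝟏.
(** The value of the k-th rational term of [dist]; see [dist_rv]. *)
Definition pq (f g : N -> N) (k : N) : F := dq (f (k ⊕ three)) (g (k ⊕ three)) (k ⊕ three).

Lemma eps3 k : eps (k ⊕ three) = eps k / 8.
Proof. by rewrite /three !(add_assoc M HM X0) !epsS; field. Qed.

Lemma pq_refl f k : point f -> pq f f k <= 4 * eps k.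
Proof.
move=> [_ [fA _]]; have := dq_refl (k ⊕ three) (fA (k ⊕ three)).
by rewrite eps3 /pq; have := eps_gt0 k; lra.
Qed.

Lemma pq_sym f g k : point f -> point g -> pq f g k <= pq g f k + 4 * eps k.
Proof.
move=> [_ [fA _]] [_ [gA _]]; have := dq_sym (k ⊕ three) (fA (k ⊕ three)) (gA (k ⊕ three)).
by rewrite eps3 /pq; have := eps_gt0 k; lra.
Qed.

Lemma pq_tri f g h k : point f -> point g -> point h -> pq f g k <= pq f h k + pq h g k + 4 * eps k.
Proof.
move=> [_ [fA _]] [_ [gA _]] [_ [hA _]].
have := dq_tri (k ⊕ three) (fA (k ⊕ three)) (gA (k ⊕ three)) (hA (k ⊕ three)).
by rewrite eps3 /pq; have := eps_gt0 k; lra.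
Qed.

Lemma dq_ev a b k : a ∈ A -> b ∈ A ->
  ev (fun j => dq a b k <= dq a b j + eps k /\ dq a b j <= dq a b k + eps k).
Proof. by move=> ha hb; exists k => i; exact: dq_cauchy. Qed.

(** In units of [eps K], an eighth of [eps k]: each point moves by less than 3 after its K-th term,
    which makes 6, and reading the two distances at finite indices costs 1 each. The total of 8 is
    why [dist] shifts its index by 3. *)
Lemma pq_cauchy f g k i : point f -> point g ->
  pq f g k <= pq f g (k ⊕ i) + eps k /\ pq f g (k ⊕ i) <= pq f g k + eps k.
Proof.
move=> pf pg; have [_ [fA _]] := pf; have [_ [gA _]] := pg.
have e : k ⊕ i ⊕ three = k ⊕ three ⊕ i.
  by rewrite -(add_assoc M HM X0) (add_comm M HM X0 i) (add_assoc M HM X0).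
rewrite /pq e; set K := k ⊕ three; have eK : eps K = eps k / 8 by rewrite /K eps3.
have [g1 g10 h1] := dlt_ev dq_cauchy (fA K) (fA (K ⊕ i)) (point_close K i pf).
have [g2 g20 h2] := dlt_ev dq_cauchy (gA K) (gA (K ⊕ i)) (point_close K i pg).
(* The slacks [4 * eps j] gathered at the common index [j] have to fit into the strict gap [g1] of
   [point_close]; 100 is a generous divisor. *)
have g0 : 0 < g1 / 100 by lra.
have [j [h1j [h2j [e3 [d1 d2]]]]] := ev_ex (ev_and h1 (ev_and h2 (ev_and (ev_eps g0)
  (ev_and (dq_ev K (fA K) (gA K)) (dq_ev (K ⊕ i) (fA (K ⊕ i)) (gA (K ⊕ i))))))).
have e4 := eps_le K i; have ej := eps_gt0 j.
have t1 := dq_tri j (fA K) (gA K) (fA (K ⊕ i)).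
have t2 := dq_tri j (fA (K ⊕ i)) (gA K) (gA (K ⊕ i)).
have t3 := dq_tri j (fA (K ⊕ i)) (gA (K ⊕ i)) (fA K).
have t4 := dq_tri j (fA K) (gA (K ⊕ i)) (gA K).
have s1 := dq_sym j (fA (K ⊕ i)) (fA K); have s2 := dq_sym j (gA (K ⊕ i)) (gA K).
by move: h1j h2j e3 d1 d2 => ? ? ? [? ?] [? ?]; split; lra.
Qed.

Local Notation L := (dlt pq).
Local Notation G := (dgt pq).

Lemma L_sym f g r : point f -> point g -> L f g r -> L g f r.
Proof. exact: (dlt_sym pq_cauchy pq_sym). Qed.
Lemma L_tri f g h r s : point f -> point g -> point h -> L f h r -> L h g s -> L f g (r + s).
Proof. exact: (dlt_tri pq_cauchy pq_tri). Qed.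
Lemma L_refl f r : point f -> 0 < r -> L f f r.
Proof. exact: (dlt_refl pq_refl). Qed.
Lemma G_sym f g r : point f -> point g -> G f g r -> G g f r.
Proof. exact: (dgt_sym pq_cauchy pq_sym). Qed.
Lemma G_tri f g h r s : point f -> point g -> point h -> G f g r -> L f h s -> G h g (r - s).
Proof. exact: (dgt_tri pq_cauchy pq_tri). Qed.
Lemma L_G f g r s : point f -> point g -> L f g s -> G f g r -> r < s.
Proof. exact: (dlt_dgt pq_cauchy). Qed.

Lemma L_cst a b r : a ∈ A -> b ∈ A -> L (cst a) (cst b) r <-> dlt dq a b r.
Proof.
move=> ha hb; split=> [[k h]|].
  by exists (k ⊕ three); move: h; rewrite eps3 /pq /cst; have := eps_gt0 k; lra.
move=> /(dlt_ev dq_cauchy ha hb) [g g0 [K h]]; apply: (ev_dlt g0); exists K => i.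
by rewrite /pq /cst -(add_assoc M HM X0).
Qed.

Lemma G_cst a b r : a ∈ A -> b ∈ A -> G (cst a) (cst b) r <-> dgt dq a b r.
Proof.
move=> ha hb; split=> [[k h]|].
  by exists (k ⊕ three); move: h; rewrite eps3 /pq /cst; have := eps_gt0 k; lra.
move=> /(dgt_ev dq_cauchy ha hb) [g g0 [K h]]; apply: (ev_dgt g0); exists K => i.
by rewrite /pq /cst -(add_assoc M HM X0).
Qed.

(** To the [3 * eps n] of [point_close], reading the distance at index n + 1 adds 1/2 + 1/4 + 1/16
    of [eps n]: the error of that index, symmetry, and the change of index. *)
Lemma L_term f n : point f -> L f (cst (f n)) (4 * eps n).
Proof.
move=> pf; have [_ [fA _]] := pf.
have E : n ⊕ 𝟏 ⊕ three = n ⊕ (𝟏 ⊕ three) by rewrite (add_assoc M HM X0).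
exists (n ⊕ 𝟏); rewrite /pq /cst E epsS.
have [k h] := point_close n (𝟏 ⊕ three) pf.
have eK : eps (n ⊕ (𝟏 ⊕ three)) = eps n / 16 by rewrite -E eps3 epsS; field.
move: (n ⊕ (𝟏 ⊕ three)) eK h => K eK h.
have s1 := dq_sym K (fA K) (fA n).
have [_ c1] := dq_cauchy k K (fA n) (fA K).
have [c2 _] := dq_cauchy K k (fA n) (fA K).
rewrite (add_comm M HM X0 K k) in c2.
by have := eps_gt0 n; lra.
Qed.

Lemma close_term f r : point f -> 0 < r -> exists n, L f (cst (f n)) r.
Proof.
move=> pf r0; have r4 : 0 < r / 4 by lra.
by have [n hn] := eps_small r4; exists n; apply: dlt_mono (L_term n pf); lra.
Qed.

Lemma dist_gr f g t : point f -> point g ->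
  dist M D (gr f) (gr g) t <-> exists k q, 𝟎 ≺ qd q /\
    dA M D (f (k ⊕ three)) (g (k ⊕ three)) (pr (k ⊕ three) (rcode M q)) /\ t = pr k (rcode M q).
Proof.
move=> pf pg; split.
  move=> [k [a [b [u [v [w [w0 [/grE -> [/grE -> [h ->]]]]]]]]]].
  by exists k, (QRat u v w).
move=> [k [[u v w] [w0 [h ->]]]].
exists k, (f (k ⊕ three)), (g (k ⊕ three)), u, v, w.
by split=> //; split; [exact/grE | split=> //; exact/grE].
Qed.

Lemma dist_seq f g : point f -> point g -> seq_in M (is_rat M) (dist M D (gr f) (gr g)).
Proof.
move=> pf pg; have [_ [fA _]] := pf; have [_ [gA _]] := pg; split.
  move=> z /(dist_gr _ pf pg) [k [[u v w] [w0 [_ ->]]]].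
  by exists k, (rcode M (QRat u v w)); split=> //; exists u, v, w.
split=> [n|n m m'].
  have [q [q0 [h _]]] := rv_ex (n ⊕ three) (dA_seq (fA (n ⊕ three)) (gA (n ⊕ three))).
  by exists (rcode M q); apply/dist_gr => //; exists n, q.
move=> /(dist_gr _ pf pg) [k [q [q0 [h /(pair_inj _ HM X0) [e ->]]]]].
move=> /(dist_gr _ pf pg) [k' [q' [q0' [h' /(pair_inj _ HM X0) [e' ->]]]]]; subst k k'.
have [_ [_ uniq]] := dA_seq (fA (n ⊕ three)) (gA (n ⊕ three)); exact: uniq h h'.
Qed.

Lemma dist_rv f g k : point f -> point g -> rv (dist M D (gr f) (gr g)) k = pq f g k.
Proof.
move=> pf pg; have [_ [fA _]] := pf; have [_ [gA _]] := pg.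
have [q [q0 [h]]] := rv_ex (k ⊕ three) (dA_seq (fA (k ⊕ three)) (gA (k ⊕ three))).
rewrite /pq /dq => ->; apply: rv_eq; first exact: dist_seq.
by apply/dist_gr => //; exists k, q.
Qed.

Lemma dist_real f g : point f -> point g -> is_real M (dist M D (gr f) (gr g)).
Proof.
move=> pf pg; apply: is_realI; first exact: dist_seq.
by move=> k i; rewrite !dist_rv //; exact: pq_cauchy.
Qed.

Lemma rlt_dist f g q : point f -> point g -> 𝟎 ≺ qd q ->
  rlt M (dist M D (gr f) (gr g)) (of_rat M q) <-> L f g (qval q).
Proof.
move=> pf pg q0; rewrite rlt_of_rat //; last exact: dist_real.
by split=> [] [k h]; exists k; move: h; rewrite dist_rv.
Qed.

Lemma rlt_dist0 f g : point f -> point g -> rlt M (rzero M) (dist M D (gr f) (gr g)) <-> G f g 0.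
Proof.
move=> pf pg; rewrite rlt_rzero //; last exact: dist_real.
by split=> [] [k h]; exists k; move: h; rewrite dist_rv.
Qed.

(** Replaces a positive real radius, whose value need not lie in the field, by a power of 2 below
    it. *)
Lemma rlt_dist_real q : is_real M q -> rlt M (rzero M) q ->
  exists k, forall f g, point f -> point g -> L f g (eps k) -> rlt M (dist M D (gr f) (gr g)) q.
Proof.
move=> rq /(rlt_rzero rq) [k h]; have [K hK] := eps_small h; exists K => f g pf pg.
move=> /(dlt_ev pq_cauchy pf pg) [e e0 he]; rewrite /rlt rle_rv; [|by case: rq|exact: dist_seq].
have e4 : 0 < e / 4 by lra.
have hq : ev (fun j => rv q k <= rv q j + eps k) by exists k => i; case: (is_real_rv k i rq).
have [j [h1 [h2 h3]]] := ev_ex (ev_and he (ev_and hq (ev_eps e4))).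
by move=> /(_ j); rewrite dist_rv //; lra.
Qed.

Lemma in_open_gr U n f : is_open M A (section M U n) -> point f ->
  in_open M D (gr f) (section M U n) <-> exists i a q, 𝟎 ≺ qd q /\ a ∈ A /\
    pr (pr i (pr a (rcode M q))) n ∈ U /\ L f (cst a) (qval q).
Proof.
move=> [oU _] pf; split.
  move=> [i [a [u [v [w [w0 [h]]]]]]].
  have [_ [_ [/(pair_inj _ HM X0) [_ <-]]]] := oU _ h.
  move=> [a' [u' [v' [w' [_ [aA [_ /(pair_inj _ HM X0) [ea _]]]]]]]]; subst a'.
  rewrite -[const_seq M a]/(gr (cst a)) rlt_dist //; last exact: point_cst.
  by exists i, a, (QRat u v w).
move=> [i [a [[u v w] [w0 [aA [h l]]]]]]; exists i, a, u, v, w; do 2!split=> //.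
by rewrite -[const_seq M a]/(gr (cst a)) rlt_dist //; exact: point_cst.
Qed.

(** Perfectness yields a point near [a] and apart from it. Both relations are open, so a late term
    of that point, an element of [A], satisfies them too. *)
Lemma perfect_near : perfect M A D -> forall a K, a ∈ A ->
  exists b, b ∈ A /\ dgt dq a b 0 /\ dlt dq a b (eps K).
Proof.
move=> pA a K aA; have pa := point_cst aA.
have [Y eY ptY] := point_is_point pa.
pose q : qrat M := qfrac M 𝟏 (pow K); have q0 : 𝟎 ≺ qd q := pow_pos K.
have vq : qval q = eps K by rewrite qval_div_pow iN1 mul1r.
(* Isolation asks for a radius coded by a set, so the constant sequence [eps K] is turned into
   one. *)
have [|Q eQ] := @gr_set (fun _ => rcode M q); first by rewrite /computable; sg.
have rQ : is_real M (of_rat M q).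
  apply: is_realI; first exact: of_rat_seq.
  by move=> k i; rewrite !of_rat_rv //; have := eps_gt0 k; split; lra.
have [f [pf [g0 l]]] : exists f, point f /\ G (cst a) f 0 /\ L (cst a) f (eps K).
  apply: contrapT => no; apply: pA; exists Y; split=> //; exists Q; rewrite eQ.
  rewrite -[gr _]/(of_rat M q) eY; split=> //; split.
    apply/rlt_rzero => //; have [k hk] := eps_small (eps_gt0 K); exists k.
    by rewrite of_rat_rv // vq; lra.
  move=> [y [/is_pointP [f ef pf] []]]; rewrite ef => /(rlt_dist0 pa pf) h.
  by move=> /(rlt_dist pa pf q0); rewrite vq => h'; apply: no; exists f.
have [r r0 hr] := dgt_open g0; have [s sK hs] := dlt_open l.
have m0 : 0 < Num.min r (eps K - s) by rewrite lt_min; apply/andP; split; lra.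
have [n hn] := close_term pf m0; have [_ [fA _]] := pf.
have m1 : Num.min r (eps K - s) <= r by rewrite ge_min lexx.
have m2 : Num.min r (eps K - s) <= eps K - s by rewrite ge_min lexx orbT.
have pc := point_cst (fA n).
exists (f n); split=> //; rewrite -L_cst // -G_cst //; split.
  apply: (G_sym pc pa); have := G_tri pf pa pc (G_sym pa pf hr) hn.
  by apply: dgt_mono; lra.
by have := L_tri pa pc pf hs hn; apply: dlt_mono; lra.
Qed.

(** * Construction of the covering without a Lebesgue number *)

Lemma open_center U n i a q : is_open M A (section M U n) ->
  pr (pr i (pr a (rcode M q))) n ∈ U -> a ∈ A.
Proof.
move=> [oU _] h; have [_ [_ [/(pair_inj _ HM X0) [_ <-]]]] := oU _ h.
by move=> [a' [u' [v' [w' [_ [aA [_ /(pair_inj _ HM X0) [-> _]]]]]]]].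
Qed.

Lemma eps_frac j : (iN 𝟏 - iN 𝟎) / iN (pow j) = eps j.
Proof. by rewrite iN1 iN0 subr0 div1r. Qed.

Lemma eps_add_le j i : eps (j ⊕ i) <= eps i.
Proof. by rewrite (add_comm M HM X0); exact: eps_le. Qed.

Lemma nlt_iff (m n : N) : ~ m ≺ n <-> n ≺ m ⊕ 𝟏.
Proof.
rewrite (lt_succ_r _ HM X0) iN_le iN_lt; split=> [/negP|h]; first by rewrite -leNgt.
by apply/negP; rewrite -leNgt.
Qed.

Lemma heine_borel_of_bound U : is_covering M A D U ->
  (exists K, forall f, point f -> exists n, n ≺ K /\ in_open M D (gr f) (section M U n)) ->
  exists F, (exists k, forall n, n ∈ F -> n ≺ k) /\
    forall x, is_point M A D (elts M x) ->
      exists n, n ∈ F /\ in_open M D (elts M x) (section M U n).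
Proof.
move=> cU [K hK]; have [X hX] : exists X, forall n, n ∈ X <-> n ≺ K.
  apply: (comprehension M HM X0 (fun n => n ≺ K)); first sg.
  by apply: (Sg_iff _ (fun e => K ≺ e 0%N ⊕ 𝟏)) => [e|]; [rewrite nlt_iff | sg].
exists X; split; first by exists K => n /hX.
move=> x /is_pointP [f ef pf]; have [n [nK h]] := hK f pf.
by exists n; rewrite ef; split=> //; exact/hX.
Qed.

Lemma covering_point U f : is_covering M A D U -> point f ->
  exists n, in_open M D (gr f) (section M U n).
Proof.
by move=> [_ cU] /point_is_point [X eX /cU [n hn]]; exists n; rewrite -eX.
Qed.

(** Reduces apartness of a point from [a] to relations between elements of [A], hence to [DG], which
    is Sigma^0_1. The summand [4 * eps i] is the error of the i-th term by [L_term]. *)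
Lemma G_term f a r : point f -> a ∈ A ->
  G f (cst a) r <-> exists i, dgt dq (f i) a (r + 4 * eps i).
Proof.
move=> pf aA; have [_ [fA _]] := pf; have pa := point_cst aA; split.
  move=> h0; have [s rs h] := dgt_open h0; have s0 : 0 < (s - r) / 8 by lra.
  have [i hi] := eps_small s0; exists i; rewrite -G_cst //.
  have := G_tri pf pa (point_cst (fA i)) h (L_term i pf); apply: dgt_mono; lra.
move=> [i]; rewrite -G_cst // => h; have pi := point_cst (fA i).
have := G_tri pi pa pf h (L_sym pf pi (L_term i pf)); apply: dgt_mono; lra.
Qed.

(* The balls [B(b, eps j)] with [d(b, a) + 2 eps j < r] for some ball [B(a, r)] of some [U_n];
   they cover the space and have a uniform margin in the cover [U]. *)
Lemma shrunken_balls U f0 : is_covering M A D U -> point f0 ->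
  exists n b j, computable M n /\ computable M b /\ computable M j /\
    (forall k, b k ∈ A) /\
    (forall k f, point f -> L f (cst (b k)) (2 * eps (j k)) -> in_open M D (gr f) (section M U (n k))) /\
    (forall f, point f -> exists k, L f (cst (b k)) (eps (j k))).
Proof.
move=> cU pf0; have [oU _] := cU.
have [p1 [p2 [c1 [c2 pE]]]] := unpairing M HM X0.
have p1E i j : p1 (pr i j) = i by have [] := pE i j.
have p2E i j : p2 (pr i j) = j by have [] := pE i j.
(* [w] codes the index n, the center b and the exponent j. The clause [DL] says d(b, a) < (u - v) /
   c - 2 eps j over a common denominator, as [goodE] computes. *)
pose good w := p1 (p2 w) ∈ A /\ exists i a u v c, 𝟎 ≺ c /\
  pr (pr i (pr a (pr (pr u v) c))) (p1 w) ∈ U /\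
  DL (p1 (p2 w)) a (u ⊗ pow (p2 (p2 w))) (v ⊗ pow (p2 (p2 w)) ⊕ (𝟏 ⊕ 𝟏) ⊗ c) (c ⊗ pow (p2 (p2 w))).
have goodE u v c j : 0 < iN c ->
    (iN (u ⊗ pow j) - iN (v ⊗ pow j ⊕ (𝟏 ⊕ 𝟏) ⊗ c)) / iN (c ⊗ pow j) = qval (QRat u v c) - 2 * eps j.
  move=> c0; rewrite !iNE /qval /eps /=; field.
  by rewrite !gt_eqF ?pow_gt0.
have good_d c j : 𝟎 ≺ c -> 𝟎 ≺ c ⊗ pow j.
  by rewrite !iN_gt0 iNM => c0; rewrite mulr_gt0 ?pow_gt0.
have cover f : point f -> exists w, good w /\ L f (cst (p1 (p2 w))) (eps (p2 (p2 w))).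
  move=> pf; have [_ [fA _]] := pf; have [n /(in_open_gr (oU n) pf)] := covering_point cU pf.
  move=> [i [a [[u v c] [c0 [aA [h l0]]]]]]; have [r rq l] := dlt_open l0.
  (* The margin has to pay [eps j] for replacing [f] by its term [f m], and [2 * eps j] for the
     doubled ball. *)
  have e0 : 0 < (qval (QRat u v c) - r) / 4 by lra.
  have [j hj] := eps_small e0; have [m hm] := close_term pf (eps_gt0 j).
  exists (pr n (pr (f m) j)); rewrite /good !p1E !p2E p1E; split=> //; split=> //.
  exists i, a, u, v, c; do 2!split=> //.
  rewrite DL_dlt //; last exact: good_d.
  rewrite goodE; last exact/iN_gt0.
  rewrite -L_cst //; have pm := point_cst (fA m).
  have := L_tri pm (point_cst aA) pf (L_sym pf pm hm) l; apply: dlt_mono; lra.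
have [w0 [gw0 _]] := cover _ pf0.
have sgood : Sg M (fun e => good (e 0%N)).
  by have c := cpow; have cl := Sg_DL; rewrite /good; sg.
have [g [cg [gg gsurj]]] := enumeration M HM X0 good w0 sgood gw0.
exists (fun k => p1 (g k)), (fun k => p1 (p2 (g k))), (fun k => p2 (p2 (g k))).
split; first by rewrite /computable; sg.
split; first by rewrite /computable; sg.
split; first by rewrite /computable; sg.
split; first by move=> k; case: (gg k).
split; last first.
  by move=> f /cover [w [/gsurj [k <-] h]]; exists k.
move=> k f pf l; have [bA [i [a [u [v [c [c0 [h]]]]]]]] := gg k.
have aA := open_center (q := QRat u v c) (oU _) h.
rewrite DL_dlt //; last exact: good_d.
rewrite goodE; last exact/iN_gt0.
rewrite -L_cst // => l'; apply/(in_open_gr (oU _) pf); exists i, a, (QRat u v c).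
do 3!split=> //; have := L_tri pf (point_cst aA) (point_cst bA) l l'; apply: dlt_mono; lra.
Qed.

(* If no [U_0, ..., U_(K-1)] cover, the points [y K] leave every shrunken ball eventually; each
   [z K] is a close companion of [y K], which exists as the space is perfect. *)
Lemma escaping_pairs U n b j : is_covering M A D U -> perfect M A D ->
  computable M n -> computable M b -> computable M j -> (forall k, b k ∈ A) ->
  (forall k f, point f -> L f (cst (b k)) (2 * eps (j k)) -> in_open M D (gr f) (section M U (n k))) ->
  (forall K, exists2 f, point f & forall n, n ≺ K -> ~ in_open M D (gr f) (section M U n)) ->
  exists y z, computable M y /\ computable M z /\ (forall k, y k ∈ A) /\ (forall k, z k ∈ A) /\
    (forall k m, m ≺ k -> G (cst (y k)) (cst (b m)) (eps (j m))) /\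
    (forall k, G (cst (y k)) (cst (z k)) 0) /\ (forall k, L (cst (y k)) (cst (z k)) (eps k)).
Proof.
move=> cU pA cn cb cj bA bU esc.
have [p1 [p2 [c1 [c2 pE]]]] := unpairing M HM X0.
pose R K w := p1 w ∈ A /\ p2 w ∈ A /\
  (forall m, m ≺ K -> DG (p1 w) (b m) 𝟏 𝟎 (pow (j m))) /\
  DG (p1 w) (p2 w) 𝟎 𝟎 𝟏 /\ DL (p1 w) (p2 w) 𝟏 𝟎 (pow K).
have sR : Sg M (fun e => R (e 0%N) (e 1%N)).
  by have c := cpow; have cl := Sg_DL; have cg := Sg_DG; rewrite /R; sg.
have exR K : exists w, R K w.
  (* A point outside [U_0, ..., U_(B1-1)] avoids all [U_(n m)] with [m < K]; and [B2] exceeds all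
     those [j m], so that [eps B2] is at most half of each [eps (j m)]. *)
  have [B1 hB1] := bounded_image M HM X0 n K cn.
  have [B2 hB2] := bounded_image M HM X0 j K cj.
  have [f pf hf] := esc B1; have [t ht] := close_term pf (eps_gt0 B2).
  have [_ [fA _]] := pf; have pt := point_cst (fA t).
  have [z [zA [g0 l]]] := perfect_near pA K (fA t).
  exists (pr (f t) z); have [e1 e2] := pE (f t) z; rewrite /R e1 e2.
  split=> //; split=> //; split; last first.
    rewrite DG_dgt //; last exact: one_pos.
    rewrite subrr mul0r; split=> //; rewrite DL_dlt //; last exact: pow_pos.
    by rewrite eps_frac.
  move=> m mK; rewrite DG_dgt //; last exact: pow_pos.
  rewrite eps_frac -G_cst //; have pb := point_cst (bA m).
  have nl : ~ L f (cst (b m)) (2 * eps (j m)) by move=> /(bU m f pf); apply: hf; exact: hB1.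
  have jm : eps B2 <= eps (j m) / 2.
    have [k ek] := proj1 (lt_iff M HM X0 (j m) B2) (hB2 m mK).
    by rewrite ek epsS; have := eps_le (j m) k; lra.
  have ej := eps_gt0 (j m).
  (* The bound 2 drops to 7/4 to obtain [dgt], then to at least 5/4 when [f] is replaced by [f t];
     more than 1 remains. *)
  have gf : G f (cst (b m)) (7 / 4 * eps (j m)) by apply: not_dlt nl; lra.
  have := G_tri pf pb pt gf ht; apply: dgt_mono; lra.
have [w [cw Rw]] := Definability.choice M HM X0 R sR exR.
exists (fun k => p1 (w k)), (fun k => p2 (w k)).
split; first by rewrite /computable; sg.
split; first by rewrite /computable; sg.
have yA k : p1 (w k) ∈ A by have [] := Rw k.
have zA k : p2 (w k) ∈ A by have [_ []] := Rw k.
do 2!split=> //; split.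
  move=> k m mk; have [_ [_ [/(_ m mk) h _]]] := Rw k.
  by move: h; rewrite DG_dgt // ?eps_frac ?G_cst //; exact: pow_pos.
split=> k; have [_ [_ [_ [h1 h2]]]] := Rw k.
  by move: h1; rewrite DG_dgt //; [rewrite subrr mul0r G_cst | exact: one_pos].
by move: h2; rewrite DL_dlt // ?eps_frac ?L_cst //; exact: pow_pos.
Qed.

Lemma eps_diff_frac i j : (iN (pow j) - iN (pow i)) / iN (pow i ⊗ pow j) = eps i - eps j.
Proof. by rewrite iNM /eps; field; rewrite !gt_eqF ?pow_gt0. Qed.

Lemma pow_mul_pos i j : 𝟎 ≺ pow i ⊗ pow j.
Proof. by rewrite iN_gt0 iNM mulr_gt0 ?pow_gt0. Qed.

(* No point is at distance 0 from both members of a pair; that one bound serves the first [n]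
   pairs is a Sigma^0_1 statement, so it can be proved by induction on [n]. *)
Lemma uniform_separation f y z n : point f -> computable M y -> computable M z ->
  (forall k, y k ∈ A) -> (forall k, z k ∈ A) -> (forall k, G (cst (y k)) (cst (z k)) 0) ->
  exists t, forall k, k ≺ n -> G f (cst (y k)) (eps t) \/ G f (cst (z k)) (eps t).
Proof.
move=> pf cy cz yA zA sep; have [cf [fA _]] := pf.
(* The numerator of [eps t + 4 * eps i], the bound that [G_term] requires. *)
pose p t i := pow i ⊕ (𝟏 ⊕ 𝟏 ⊕ 𝟏 ⊕ 𝟏) ⊗ pow t.
have pE t i : (iN (p t i) - iN 𝟎) / iN (pow t ⊗ pow i) = eps t + 4 * eps i.
  by rewrite /p !iNE /eps; field; rewrite !gt_eqF ?pow_gt0.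
pose Q t x := exists i, DG (f i) x (p t i) 𝟎 (pow t ⊗ pow i).
have QE t x : x ∈ A -> Q t x <-> G f (cst x) (eps t).
  move=> xA; rewrite G_term //; split=> [] [i h]; exists i; move: h;
    by rewrite DG_dgt ?pE //; exact: pow_mul_pos.
have [t ht] : exists t, forall k, k ≺ n -> Q t (y k) \/ Q t (z k).
  apply: (ind_Sg M HM (fun n => exists t, forall k, k ≺ n -> Q t (y k) \/ Q t (z k))).
  - by have c := cpow; have cg := Sg_DG; rewrite /Q /p; sg.
  - by exists 𝟎 => k /(nlt_0_r M HM X0).
  move=> m [t ht]; have py := point_cst (yA m); have pz := point_cst (zA m).
  have [r r0 hr] := dgt_open (sep m).
  have [t' ht'] : exists t', G f (cst (y m)) (eps t') \/ G f (cst (z m)) (eps t').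
    have r4 : 0 < r / 4 by lra.
    have [t' t'r] := eps_small r4; exists t'.
    (* Since [y m] and [z m] are more than [r] apart, a point within r/2 of [y m] is more than r/2
       away from [z m]. *)
    have [l|nl] := pselect (L f (cst (y m)) (r / 2)); [right|left].
      have := G_tri py pz pf hr (L_sym pf py l); apply: dgt_mono; lra.
    by apply: not_dlt nl; lra.
  exists (t ⊕ t') => k /(lt_succ_r M HM X0) [/ht h|->].
    case: h => /QE h; [left|right]; apply/QE => //; apply: dgt_mono (h _) => //; exact: eps_le.
  case: ht' => h; [left|right]; apply/QE => //; apply: dgt_mono h; exact: eps_add_le.
by exists t => k /ht [] /QE h; [left|right]; exact: h.
Qed.

(* The covering consists of the balls that lie in some [B(b m, eps (j m))], hence contain no
   [y k] with [k > m], and that miss [y k] or [z k] for each [k <= m]. *)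
Lemma separating_covering b j y z f0 :
  point f0 -> computable M b -> computable M j -> (forall k, b k ∈ A) ->
  (forall f, point f -> exists k, L f (cst (b k)) (eps (j k))) ->
  computable M y -> computable M z -> (forall k, y k ∈ A) -> (forall k, z k ∈ A) ->
  (forall k m, m ≺ k -> G (cst (y k)) (cst (b m)) (eps (j m))) ->
  (forall k, G (cst (y k)) (cst (z k)) 0) ->
  exists W, is_covering M A D W /\
    forall v k, in_open M D (gr (cst (y k))) (section M W v) ->
      in_open M D (gr (cst (z k))) (section M W v) -> False.
Proof.
move=> pf0 cb cj bA bcov cy cz yA zA far sep.
have [p1 [p2 [c1 [c2 pE]]]] := unpairing M HM X0.
have p1E i k : p1 (pr i k) = i by have [] := pE i k.
have p2E i k : p2 (pr i k) = k by have [] := pE i k.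
(* [w] codes a center c and an exponent i, for the ball of radius [eps i]. [DL] says d(c, b m) < eps
   (j m) - eps i, and [DG] puts [y k] or [z k] farther than [eps i] from c. *)
pose V w := p1 w ∈ A /\ exists m,
  DL (p1 w) (b m) (pow (p2 w)) (pow (j m)) (pow (j m) ⊗ pow (p2 w)) /\
  forall k, k ≺ m ⊕ 𝟏 -> DG (p1 w) (y k) 𝟏 𝟎 (pow (p2 w)) \/ DG (p1 w) (z k) 𝟏 𝟎 (pow (p2 w)).
have cover f : point f -> exists w, V w /\ L f (cst (p1 w)) (eps (p2 w)).
  move=> pf; have [_ [fA _]] := pf; have [m h0] := bcov f pf; have [r rm l] := dlt_open h0.
  have [t ht] := uniform_separation (m ⊕ 𝟏) pf cy cz yA zA sep.
  (* Halves, because [eps i] is spent twice: on replacing [f] by its term [f s], and as the radius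
     of the ball. *)
  have e0 : 0 < Num.min ((eps (j m) - r) / 2) (eps t / 2).
    by rewrite lt_min; apply/andP; split; have := eps_gt0 t; lra.
  have [i] := eps_small e0; rewrite lt_min => /andP [i1 i2].
  have [s hs] := close_term pf (eps_gt0 i); have ps := point_cst (fA s).
  exists (pr (f s) i); rewrite /V p1E p2E; split=> //; split=> //; exists m; split.
    rewrite DL_dlt //; last exact: pow_mul_pos.
    rewrite eps_diff_frac -L_cst //.
    have := L_tri ps (point_cst (bA m)) pf (L_sym pf ps hs) l; apply: dlt_mono; lra.
  move=> k /ht [] h; [left|right]; rewrite DG_dgt //; try exact: pow_pos.
    rewrite eps_frac -G_cst //; have := G_tri pf (point_cst (yA k)) ps h hs; apply: dgt_mono; lra.
  rewrite eps_frac -G_cst //; have := G_tri pf (point_cst (zA k)) ps h hs; apply: dgt_mono; lra.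
have [w0 [Vw0 _]] := cover _ pf0.
have sV : Sg M (fun e => V (e 0%N)).
  by have c := cpow; have cl := Sg_DL; have cg := Sg_DG; rewrite /V; sg.
have [h [ch [Vh hsurj]]] := enumeration M HM X0 V w0 sV Vw0.
pose q v : qrat M := qfrac M 𝟏 (pow (p2 (h v))).
have qE v : qval (q v) = eps (p2 (h v)) by rewrite qval_div_pow iN1 mul1r.
pose ball v := pr (p1 (h v)) (rcode M (q v)).
have cball : computable M ball.
  by have c := cpow; rewrite /computable /ball /rcode /q /=; sg.
(* The v-th open set is the constant sequence [ball v]. Decoding [t] makes membership an equation
   between computable functions, hence Delta^0_1. *)
have E t : (exists v i, t = pr (pr i (ball v)) v) <-> t = pr (pr (p1 (p1 t)) (ball (p2 t))) (p2 t).
  by split=> [[v [i ->]]|e]; [rewrite !p1E !p2E | exists (p2 t), (p1 (p1 t))].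
have [W hW] : exists W, forall t, t ∈ W <-> exists v i, t = pr (pr i (ball v)) v.
  apply: (comprehension M HM X0 (fun t => exists v i, t = pr (pr i (ball v)) v)).
    by apply: (Sg_iff _ (fun e => e 0%N = pr (pr (p1 (p1 (e 0%N))) (ball (p2 (e 0%N)))) (p2 (e 0%N))))
      => [e|]; [rewrite E | sg].
  by apply: (Sg_iff _ (fun e => e 0%N <> pr (pr (p1 (p1 (e 0%N))) (ball (p2 (e 0%N)))) (p2 (e 0%N))))
    => [e|]; [rewrite E | sg].
have Wv v : section M W v = gr (fun _ => ball v).
  apply/funext => t; apply/propext; rewrite /section hW; split=> [[v' [i]]|[i ->]].
    by move=> /(pair_inj _ HM X0) [-> <-]; exists i.
  by exists v, i.
have VA v : p1 (h v) ∈ A by have [] := Vh v.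
have oW v : is_open M A (section M W v).
  rewrite Wv; apply: gr_seq => _; exists (p1 (h v)), 𝟏, 𝟎, (pow (p2 (h v))).
  by split; [exact: pow_pos | split=> //; split=> //; exact: one_pos].
have inW v f : point f -> in_open M D (gr f) (section M W v) <-> L f (cst (p1 (h v))) (eps (p2 (h v))).
  move=> pf; rewrite (in_open_gr (oW v) pf); split.
    move=> [i [a [u [u0 [aA [/hW [v' [i' /(pair_inj _ HM X0) [/(pair_inj _ HM X0) [_ e] ev]]]]]]]]].
    by subst v'; move/(pair_inj _ HM X0): e => [-> /rcode_inj ->]; rewrite qE.
  move=> l; exists 𝟎, (p1 (h v)), (q v); split; first exact: pow_pos.
  by split=> //; split; [apply/hW; exists v, 𝟎 | rewrite qE].
exists W; split; first split=> //.
  move=> x /is_pointP [f -> pf]; have [w [/hsurj [v <-] l]] := cover f pf.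
  by exists v; apply/inW.
move=> v k /inW ly /inW lz.
have py := point_cst (yA k); have pz := point_cst (zA k); have pc := point_cst (VA v).
have [_ [m [lm gm]]] := Vh v; have pb := point_cst (bA m).
have {ly} ly := ly py; have {lz} lz := lz pz.
have [mk|mk] := pselect (m ≺ k).
  move: lm; rewrite DL_dlt //; last exact: pow_mul_pos.
  rewrite eps_diff_frac -L_cst // => lm.
  by have := L_G py pb (L_tri py pb pc ly lm) (far k m mk); lra.
move/nlt_iff: mk => /gm [].
  rewrite DG_dgt //; last exact: pow_pos.
  rewrite eps_frac -G_cst // => g; have := L_G py pc ly (G_sym pc py g); lra.
rewrite DG_dgt //; last exact: pow_pos.
rewrite eps_frac -G_cst // => g; have := L_G pz pc lz (G_sym pc pz g); lra.
Qed.

Lemma perfect_lebesgue_heine_borel : perfect M A D -> lebesgue M A D -> heine_borel M A D.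
Proof.
move=> pA lA U cU; apply: heine_borel_of_bound => //; apply: contrapT => no.
have esc K : exists2 f, point f & forall n, n ≺ K -> ~ in_open M D (gr f) (section M U n).
  apply: contrapT => no'; apply: no; exists K => f pf; apply: contrapT => h.
  by apply: no'; exists f => // n nK hn; apply: h; exists n.
(* For K = 0 the failure to cover just says that the space has a point; the enumerations of balls
   start from it. *)
have [f0 pf0 _] := esc 𝟎.
have [n [b [j [cn [cb [cj [bA [bU bcov]]]]]]]] := shrunken_balls cU pf0.
have [y [z [cy [cz [yA [zA [far [sep near]]]]]]]] := escaping_pairs cU pA cn cb cj bA bU esc.
have [W [cW disj]] := separating_covering pf0 cb cj bA bcov cy cz yA zA far sep.
have [q [rq [q0 hq]]] := lA W cW.
(* At this [k] the ball of radius [q] about [y k] contains [z k] as well, and it lies in one member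
   of [W]. *)
have [k hk] := rlt_dist_real rq q0.
have py := point_cst (yA k); have pz := point_cst (zA k).
have [Y eY ptY] := point_is_point py; have [Z' eZ ptZ] := point_is_point pz.
have [v hv] := hq Y ptY; apply: (disj v k).
  by rewrite -eY; apply: hv => //; rewrite eY; apply: hk => //; apply: L_refl => //; exact: eps_gt0.
by rewrite -eZ; apply: hv => //; rewrite eY eZ; exact: hk.
Qed.

End Space.

End Power.

End Reals.
End Reals.

(** * Arbitrary models of RCA0 *)

Module Models.
Import Completeness Definability Fractions Semantics Reals.
Import all_boot order ssralg ssrnum boolp.
Set Implicit Arguments.
Unset Strict Implicit.

Section Models.

Variable M : model.
Hypothesis HM : satisfies M Defs.RCA0.
Variable X0 : sdom M.

Local Notation N := (dom M).

Lemma model_one_neq0 : mone M <> mzero M.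
Proof. by move=> h; apply: (succ_neq0 M HM X0 (mzero M)); rewrite (add_0_l M HM X0). Qed.

Lemma model_le_total (x y : N) : (exists k, y = madd M x k) \/ (exists k, x = madd M y k).
Proof.
have [/(lt_iff _ HM X0) [k ->]|[->|/(lt_iff _ HM X0) [k ->]]] := lt_total M HM X0 x y.
- by left; exists (madd M k (mone M)); rewrite (add_assoc M HM X0).
- by left; exists (mzero M); rewrite (add_0_r M HM X0).
- by right; exists (madd M k (mone M)); rewrite (add_assoc M HM X0).
Qed.

Definition model_arith : arith :=
  Arith N (mzero M) (mone M) (madd M) (mmul M) (dom_semiring M HM X0) (add_cancel_r M HM X0)
    (add_eq_0 M HM X0) model_one_neq0 (zero_or_succ M HM X0) model_le_total.

(* Without a set coding the powers of 2 the defining formulas of [<=] on reals hold vacuously,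
   so [<] is empty and no covering of a nonempty space exists. *)
Lemma heine_borel_no_pow2 A D : (forall k m, ~ pow2 M k m) -> heine_borel M A D.
Proof.
move=> no U [_ cU]; have [X hX] : exists X, forall n : N, mmem M n X <-> n <> n.
  apply: (comprehension M HM X0 (fun n => n <> n)).
    by apply: Sg_neq => //; apply: Fnc_Tm => //; exact: Tm_var.
  apply: (Sg_iff M (fun e => e 0%N = e 0%N)) => [e|]; first by split=> // h /(_ h).
  by apply: Sg_eq => //; apply: Fnc_Tm => //; exact: Tm_var.
exists X; split; first by exists (mzero M) => n /hX.
move=> x /cU [n [i [a [u [v [w [_ [_ []]]]]]]]].
by move=> k m /no.
Qed.

Lemma model_heine_borel A D :
  is_space M A D -> perfect M A D -> lebesgue M A D -> heine_borel M A D.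
Proof.
(* A set witnessing one instance of [pow2] satisfies the recursion equations everywhere, so it codes
   all powers of 2. *)
have [[k [m [Z [Zs [Z0 [ZS _]]]]]]|no] := pselect (exists k m, pow2 M k m); last first.
  by move=> _ _ _; apply: heine_borel_no_pow2 => k m h; apply: no; exists k, m.
apply: (@perfect_lebesgue_heine_borel M HM X0 (fracF model_arith) (@inj model_arith)
  (inj0 _) (inj1 _) (@injD model_arith) (@injM model_arith) (@inj_ge0 model_arith)
  (@inj_inj model_arith) _ (@inj_bound model_arith) Z Zs Z0 ZS).
by move=> m' n; rewrite (lt_iff _ HM X0); split=> /(inj_ltP model_arith).
Qed.

End Models.
End Models.

Require Import Defs.

Theorem theorem5p4 :
  proves RCA0
    (sentence
       (alls A d,
          let M := Space A d in
          is_space M /\ perfect M /\ lebesgue M ==> heine_borel M)%l2).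
Proof.
  apply Completeness.completeness; [exact Completeness.RCA0_subst|].
  intros M e g HM. apply Transfer.sat_theorem. intros A D [H1 [H2 H3]].
  exact (Models.model_heine_borel HM (g 0) H1 H2 H3).
Qed.
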